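(* Let $G$ be a bipartite graph on $n$ vertices, none of which are isolated. Then $$\operatorname{depth}_S G\le \left\lfloor \frac n2\right\rfloor,\qquad \operatorname{depth}_E G\le \left\lfloor \frac n2\right\rfloor-1,$$ $$\operatorname{pd}_S G\ge \left\lceil \frac n2\right\rceil,\qquad \operatorname{cx}_E G\ge \left\lceil \frac n2\right\rceil+1.$$ Moreover, both sets of bounds are tight.
   Context: Let $\mathbf{k}$ be an algebraically closed field of characteristic zero. Graphs are finite and simple. For a graph $G$ with vertices $v_1,\dots,v_n$, let $E=\bigwedge_{\mathbf k}\langle e_1,\dots,e_n\rangle$ be the exterior algebra over $\mathbf{k}$ in $n$ variables (one per vertex), with degree-one part $E_1$ spanned by $e_1,\dots,e_n$, and let $S=\mathbf{k}[x_1,\dots,x_n]$ be the polynomial ring. The edge ideals are $I_E(G)=(e_ie_j \mid \{v_i,v_j\}\text{ is an edge of }G)\subseteq E$ and $I_S(G)=(x_ix_j\mid \{v_i,v_j\}\text{ is an edge of }G)\subseteq S$. For a graded $E$-module $M$, an element $\ell\in E_1$ is $M$-regular if $\{m\in M\mid \ell m=0\}=\ell M$. A sequence $\ell_1,\dots,\ell_r\in E_1$ is an $M$-regular sequence if $\ell_i$ is regular on $M/(\ell_1,\dots,\ell_{i-1})M$ for all $i\le r$; $\operatorname{depth}_E M$ is the maximum length of an $M$-regular sequence. The complexity of $M$ is $\operatorname{cx}_E M=\inf\{c\in\mathbb{Z}\mid \beta_i^E(M)\le \alpha i^{c-1}\text{ for some }\alpha\in\mathbb{R}\text{ and all } i\ge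 1\}$, where $\beta_i^E(M)$ is the rank of the $i$-th free module in the minimal graded free resolution of $M$ over $E$. Write $\operatorname{depth}_E G$ and $\operatorname{cx}_E G$ for the depth and complexity of $E/I_E(G)$ over $E$, and $\operatorname{depth}_S G$ and $\operatorname{pd}_S G$ for the (usual) depth and projective dimension of $S/I_S(G)$ over $S$. *)

(* Defs.v *)
(* mpoly has to be imported before MathComp-Analysis: in the other order the
   levels of their notations are incompatible. *)
From HB Require Import structures.
From mathcomp Require Import mpoly.
From mathcomp Require Import all_boot all_order all_algebra.

Set Implicit Arguments.
Unset Strict Implicit.
Unset Printing Implicit Defensive.

Import Order.TTheory GRing.Theory Num.Theory.

Local Open Scope ring_scope.

Record sgraph (n : nat) := SGraph {
  adj :> rel 'I_n;
  adj_sym : symmetric adj;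
  adj_irr : irreflexive adj }.

Definition bipartite n (G : sgraph n) : Prop :=
  exists c : 'I_n -> bool, forall i j, G i j -> c i != c j.

Definition no_isolated n (G : sgraph n) : Prop := forall i, exists j, G i j.

(* An element of the exterior algebra is the family of its coordinates on the
   basis e_A = e_(i_1) ... e_(i_d), for A = {i_1 < ... < i_d}.  If A and B are
   disjoint then e_A e_B = (-1) ^ (ext_inv A B) e_(A u B), and otherwise
   e_A e_B = 0. *)

Definition ext_inv n (A B : {set 'I_n}) : nat :=
  (\sum_(i in A) \sum_(j in B) (j < i))%N.

Definition exterior (k : comNzRingType) (n : nat) := {ffun {set 'I_n} -> k}.

Section Exterior.
Variables (k : comNzRingType) (n : nat).
Local Notation E := (exterior k n).

HB.instance Definition _ := GRing.Zmodule.on E.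

Implicit Types (a b : k) (x y z : E) (A B C D : {set 'I_n}).

Definition ext_scale a x : E := [ffun A => a * x A].

Fact ext_scaleA a b x : ext_scale a (ext_scale b x) = ext_scale (a * b) x.
Proof. by apply/ffunP => A; rewrite !ffunE mulrA. Qed.

Fact ext_scale1 : left_id 1 ext_scale.
Proof. by move=> x; apply/ffunP => A; rewrite ffunE mul1r. Qed.

Fact ext_scaleDr : right_distributive ext_scale +%R.
Proof. by move=> a x y; apply/ffunP => A; rewrite !ffunE mulrDr. Qed.

Fact ext_scaleDl x : {morph ext_scale^~ x : a b / a + b}.
Proof. by move=> a b; apply/ffunP => A; rewrite !ffunE mulrDl. Qed.

HB.instance Definition _ := GRing.Zmodule_isLmodule.Build k E
  ext_scaleA ext_scale1 ext_scaleDr ext_scaleDl.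

Definition ext_one : E := [ffun A => (A == set0)%:R].

Definition ext_mul x y : E := [ffun A : {set 'I_n} =>
  \sum_(B : {set 'I_n} | B \subset A)
     (-1) ^+ ext_inv B (A :\: B) * (x B * y (A :\: B))].

Definition ext_gen (i : 'I_n) : E := [ffun A => (A == [set i]%SET)%:R].

Lemma ext_inv0l A : ext_inv set0 A = 0%N.
Proof. by rewrite /ext_inv big_set0. Qed.

Lemma ext_inv0r A : ext_inv A set0 = 0%N.
Proof. by rewrite /ext_inv big1 // => i _; rewrite big_set0. Qed.

Lemma ext_invUl A B C : [disjoint A & B] ->
  ext_inv (A :|: B) C = (ext_inv A C + ext_inv B C)%N.
Proof.
by move=> dAB; rewrite /ext_inv -bigU //; apply: eq_bigl => i; rewrite !inE.
Qed.

Lemma ext_invUr A B C : [disjoint B & C] ->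
  ext_inv A (B :|: C) = (ext_inv A B + ext_inv A C)%N.
Proof.
move=> dBC; rewrite /ext_inv -big_split /=; apply: eq_bigr => i _.
by rewrite -bigU //; apply: eq_bigl => j; rewrite !inE.
Qed.

Fact ext_mulA : associative ext_mul.
Proof.
move=> x y z; apply/ffunP => A; rewrite !ffunE.
under [RHS]eq_bigr => B _ do rewrite ffunE mulr_suml mulr_sumr.
rewrite (exchange_big_dep (fun C => C \subset A)) /=; last first.
  by move=> B C sBA sCB; apply: subset_trans sCB sBA.
apply: eq_bigr => C sCA; rewrite ffunE !mulr_sumr.
rewrite [RHS](reindex_onto (fun D => C :|: D) (fun B => B :\: C)) /=;
  last first.
  by move=> B /andP[_ sCB]; rewrite -{1}(setIidPr sCB) setID.
apply: eq_big => [D|D].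
  rewrite subUset sCA subsetUl /= andbT subsetD setDUl setDv set0U.
  by congr (_ && _); apply: (sameP setDidPl eqP).
rewrite subsetD => /andP[sDA dDC]; rewrite setDUl setDv set0U.
have -> : D :\: C = D by apply/setDidPl.
rewrite setDDl; set F := A :\: (C :|: D).
have dDF : [disjoint D & F].
  rewrite disjoint_sym /F disjoints_subset setDE subIset //.
  by rewrite setCS subsetUr orbT.
have -> : A :\: C = D :|: F.
  apply/setP => i; rewrite !inE negb_or.
  case: (boolP (i \in D)) => [iD|_] /=; last by rewrite andbT.
  by rewrite (subsetP sDA) // (disjointFr dDC).
rewrite ext_invUr // ext_invUl; last by rewrite disjoint_sym.
rewrite !exprD -!mulrA mulrCA; congr (_ * _).
rewrite (mulrCA (x C) (_ ^+ _)); exact: mulrCA.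
Qed.

Fact ext_mul1l : left_id ext_one ext_mul.
Proof.
move=> x; apply/ffunP => A; rewrite ffunE (bigD1 set0) ?sub0set //= big1.
  by rewrite ffunE eqxx setD0 ext_inv0l expr0 !mul1r addr0.
by move=> B /andP[_ /negPf B0]; rewrite ffunE B0 mul0r mulr0.
Qed.

Fact ext_mul1r : right_id ext_one ext_mul.
Proof.
move=> x; apply/ffunP => A; rewrite ffunE (bigD1 A) //= big1.
  by rewrite ffunE setDv eqxx ext_inv0r expr0 mulr1 mul1r addr0.
move=> B /andP[sBA neBA]; rewrite ffunE setD_eq0.
case: (boolP (A \subset B)) => [sAB|_]; last by rewrite !mulr0.
by rewrite eqEsubset sBA sAB in neBA.
Qed.

Fact ext_mulDl : left_distributive ext_mul +%R.
Proof.
move=> x y z; apply/ffunP => A; rewrite !ffunE -big_split /=.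
by apply: eq_bigr => B _; rewrite ffunE mulrDl mulrDr.
Qed.

Fact ext_mulDr : right_distributive ext_mul +%R.
Proof.
move=> x y z; apply/ffunP => A; rewrite !ffunE -big_split /=.
by apply: eq_bigr => B _; rewrite ffunE !mulrDr.
Qed.

Fact ext_one_neq0 : ext_one != 0.
Proof. by apply/eqP => /ffunP/(_ set0)/eqP; rewrite !ffunE eqxx oner_eq0. Qed.

HB.instance Definition _ := GRing.Zmodule_isNzRing.Build E
  ext_mulA ext_mul1l ext_mul1r ext_mulDl ext_mulDr ext_one_neq0.

Fact ext_scaleAl (a : k) x y : a *: (x * y) = (a *: x) * y.
Proof.
apply/ffunP => A; rewrite !ffunE mulr_sumr; apply: eq_bigr => B _.
by rewrite ffunE mulrCA !mulrA.
Qed.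

HB.instance Definition _ := GRing.Lmodule_isLalgebra.Build k E ext_scaleAl.

Fact ext_scaleAr (a : k) x y : a *: (x * y) = x * (a *: y).
Proof.
apply/ffunP => A; rewrite !ffunE mulr_sumr; apply: eq_bigr => B _.
by rewrite ffunE mulrCA (mulrCA a).
Qed.

HB.instance Definition _ := GRing.Lalgebra_isAlgebra.Build k E ext_scaleAr.

Lemma ext_gen_mul i j : ext_gen i * ext_gen j =
  [ffun A => if (i != j) && (A == [set i; j]) then (-1) ^+ (j < i)%N else 0].
Proof.
apply/ffunP => A; rewrite !ffunE big_mkcond (bigD1 [set i]) //= big1 => [|B].
  rewrite addr0 !ffunE eqxx mul1r sub1set.
  have -> : (i != j) && (A == [set i; j]) = (i \in A) && (A :\ i == [set j]).
    apply/andP/andP => [[nij /eqP->]|[iA /eqP eA]].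
      by rewrite set21 setU1K // inE.
    split; last by rewrite -eA setD1K.
    by have := set11 j; rewrite -eA !inE eq_sym => /andP[].
  case: (i \in A) => //=; case: eqP => [->|_] /=; last by rewrite mulr0.
  by rewrite mulr1 /ext_inv !big_set1.
by move=> /negPf Bi; rewrite ffunE Bi mul0r mulr0 if_same.
Qed.

Lemma ext_gen_sqr i : ext_gen i * ext_gen i = 0.
Proof. by rewrite ext_gen_mul; apply/ffunP => A; rewrite !ffunE eqxx. Qed.

Lemma ext_gen_anticomm i j : ext_gen i * ext_gen j = - (ext_gen j * ext_gen i).
Proof.
rewrite !ext_gen_mul; apply/ffunP => A; rewrite !ffunE setUC (eq_sym j i).
case: ifP => [/andP[nij _]|_]; last by rewrite oppr0.
by case: ltngtP nij => [||/val_inj->]; rewrite ?eqxx ?expr0 ?expr1 ?opprK.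
Qed.

End Exterior.

From mathcomp Require Import boolp classical_sets.
From mathcomp Require Import reals constructive_ereal ereal.

Local Open Scope classical_set_scope.
Local Open Scope ring_scope.

Section Span.
Variables (R : pzRingType) (M : lmodType R) (X : set M).

Definition span : {pred M} := [pred m | `[< exists d (a : 'I_d -> R)
  (x : 'I_d -> M), (forall i, X (x i)) /\ m = \sum_(i < d) a i *: x i >]].

Lemma span_zmod_closed : zmod_closed span.
Proof.
split=> [|u v /asboolP[d [a [x [Xx ->]]]] /asboolP[e [b [y [Xy ->]]]]].
  apply/asboolP; exists 0%N, (fun=> 0), (fun=> 0); rewrite big_ord0.
  by split=> // -[].
apply/asboolP; exists (d + e)%N.
exists (fun i => match split i with inl i => a i | inr j => - b j end).
exists (fun i => match split i with inl i => x i | inr j => y j end).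
split=> [i|]; first by case: (split i).
rewrite big_split_ord /= -sumrN; congr (_ + _); apply: eq_bigr => i _.
  by rewrite (unsplitK (inl i)).
by rewrite (unsplitK (inr i)) scaleNr.
Qed.

HB.instance Definition _ := GRing.isZmodClosed.Build M span span_zmod_closed.

Lemma span_scale a m : m \in span -> a *: m \in span.
Proof.
move=> /asboolP[d [b [x [Xx ->]]]]; apply/asboolP.
exists d, (fun i => a * b i), x; split=> //.
by rewrite scaler_sumr; apply: eq_bigr => i _; rewrite scalerA.
Qed.

Local Open Scope quotient_scope.

Definition quotmod := Quotient.quot span.
HB.instance Definition _ := GRing.Zmodule.on quotmod.

Definition quotmod_pi (m : M) : quotmod := \pi_(Quotient.quot span) m.

Definition quotmod_scale (a : R) (u : quotmod) : quotmod :=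
  quotmod_pi (a *: repr u).

Lemma quotmod_scaleE a m : quotmod_scale a (quotmod_pi m) = quotmod_pi (a *: m).
Proof.
apply/eqP; rewrite -Quotient.idealrBE -scalerBr; apply: span_scale.
by rewrite Quotient.idealrBE reprK.
Qed.

Lemma quotmod_piD m m' : quotmod_pi (m + m') = quotmod_pi m + quotmod_pi m'.
Proof. by rewrite /quotmod_pi !piE. Qed.

Lemma quotmod_piP (u : quotmod) : exists m, u = quotmod_pi m.
Proof. by exists (repr u); rewrite /quotmod_pi reprK. Qed.

Fact quotmod_scaleA a b u :
  quotmod_scale a (quotmod_scale b u) = quotmod_scale (a * b) u.
Proof.
by have [m ->] := quotmod_piP u; rewrite !quotmod_scaleE scalerA.
Qed.

Fact quotmod_scale1 : left_id 1 quotmod_scale.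
Proof.
by move=> u; have [m ->] := quotmod_piP u; rewrite quotmod_scaleE scale1r.
Qed.

Fact quotmod_scaleDr : right_distributive quotmod_scale +%R.
Proof.
move=> a u v; have [m ->] := quotmod_piP u; have [m' ->] := quotmod_piP v.
by rewrite -quotmod_piD !quotmod_scaleE scalerDr quotmod_piD.
Qed.

Fact quotmod_scaleDl u : {morph quotmod_scale^~ u : a b / a + b}.
Proof.
move=> a b; have [m ->] := quotmod_piP u.
by rewrite !quotmod_scaleE scalerDl quotmod_piD.
Qed.

HB.instance Definition _ := GRing.Zmodule_isLmodule.Build R quotmod
  quotmod_scaleA quotmod_scale1 quotmod_scaleDr quotmod_scaleDl.

Lemma quotmod_piZ a m : quotmod_pi (a *: m) = a *: quotmod_pi m.
Proof. by rewrite -quotmod_scaleE. Qed.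

Lemma quotmod_pi_eq0 m : (quotmod_pi m = 0) <-> (m \in span).
Proof.
have -> : (0 : quotmod) = quotmod_pi 0 by rewrite /quotmod_pi piE.
rewrite -[m in m \in _]subr0 Quotient.idealrBE.
by split=> [|] /eqP.
Qed.

End Span.

Section Ideals.
Variable R : pzRingType.

(* The two-sided ideal generated by X, i.e. the sums of products a * x * b with
   x in X, as the left submodule of R spanned by the x * b. *)
Definition ideal_span (X : set R) : set R^o :=
  [set r | exists x b, X x /\ r = x * b].

Definition ideal_gen (X : set R) : {pred R^o} := span (ideal_span X).

Definition quotring (X : set R) : lmodType R := quotmod (ideal_span X).

(* M / (X)M *)
Definition quot_ideal (M : lmodType R) (X : set R) : lmodType R :=
  quotmod [set m : M | exists (a : R) (m' : M),
    a \in ideal_gen X /\ m = a *: m'].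

Definition edge_monomials n (x : 'I_n -> R) (G : sgraph n) : set R :=
  [set r | exists i j, G i j /\ r = x i * x j].

End Ideals.

(* The homogeneous component E_d; it is 0 if d < 0. *)
Definition ext_deg (k : comNzRingType) n (d : int) : set (exterior k n) :=
  [set x : exterior k n | forall A : {set 'I_n}, x A != 0 -> #|A|%:Z = d].

Section ExteriorModules.
Variables (K : realType) (k : fieldType) (n : nat).
Local Notation E := (exterior k n).

Definition ext_regular (M : lmodType E) (l : E) : Prop :=
  forall m : M, l *: m = 0 <-> exists m', m = l *: m'.

Definition ext_regular_seq (M : lmodType E) (s : seq E) : Prop :=
  forall i, (i < size s)%N -> ext_deg 1 s`_i /\
    ext_regular (quot_ideal M [set` take i s]) s`_i.

(* Depth, complexity and projective dimension are extended reals, so that the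
   suprema and infima below always exist. *)
Definition ext_depth (M : lmodType E) : \bar K :=
  ereal_sup [set (size s)%:R%:E | s in ext_regular_seq M].

(* Minimal graded free resolutions
     ... -> F_2 -> F_1 -> F_0 -> M -> 0
   of the graded module M whose component of degree d is gr d.  F_i is the
   module of row vectors over E of length b i, whose q-th basis vector has
   degree deg i q; F_(i+1) -> F_i is u |-> u *m D i, of degree 0, and F_0 -> M
   maps the q-th basis vector to g q.  Minimality says that the image of
   F_(i+1) lies in (e_0, ..., e_(n-1)) F_i. *)
Record min_graded_free_resolution (M : lmodType E) (gr : int -> set M)
    (b : nat -> nat) (deg : forall i, 'I_(b i) -> int)
    (g : 'I_(b 0%N) -> M) (D : forall i, 'M[E]_(b i.+1, b i)) : Prop := {
  mgfr_deg0 : forall q, gr (deg 0%N q) (g q);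
  mgfr_deg : forall i p q, ext_deg (deg i.+1 p - deg i q) (D i p q);
  mgfr_min : forall i p q, D i p q \in ideal_gen (range (@ext_gen k n));
  mgfr_surj : forall m, exists u : 'rV[E]_(b 0%N), m = \sum_q u 0 q *: g q;
  mgfr_exact0 : forall u : 'rV[E]_(b 0%N),
    \sum_q u 0 q *: g q = 0 <-> exists v, u = v *m D 0%N;
  mgfr_exact : forall i (u : 'rV[E]_(b i.+1)),
    u *m D i = 0 <-> exists v, u = v *m D i.+1 }.

Definition ext_betti (M : lmodType E) (gr : int -> set M) : nat -> nat :=
  xget (fun=> 0%N) [set b | exists deg g D,
    @min_graded_free_resolution M gr b deg g D].

Definition ext_complexity (M : lmodType E) (gr : int -> set M) : \bar K :=
  ereal_inf [set c%:~R%:E | c in [set c : int | exists alpha : K,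
    forall i, (1 <= i)%N ->
      (ext_betti gr i)%:R <= alpha * (i%:R : K) ^ (c - 1)]].

End ExteriorModules.

Section Modules.
Variables (K : realType) (R : pzRingType).

Definition regular_seq (M : lmodType R) (s : seq R) : Prop :=
  (forall i, (i < size s)%N ->
    forall m : quot_ideal M [set` take i s], s`_i *: m = 0 -> m = 0) /\
  (exists m : quot_ideal M [set` s], m != 0).

(* The maximal length of a regular sequence on M contained in I. *)
Definition depth_in (I : {pred R}) (M : lmodType R) : \bar K :=
  ereal_sup [set (size s)%:R%:E | s in
    [set s : seq R | {subset s <= I} /\ regular_seq M s]].

Definition projective (P : lmodType R) : Prop :=
  forall (A B : lmodType R) (g : {linear A -> B}) (f : {linear P -> B}),
    (forall y, exists x, g x = y) ->
    exists h : {linear P -> A}, forall x, g (h x) = f x.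

Record projective_resolution (M : lmodType R) (P : nat -> lmodType R)
    (f : forall i, {linear P i.+1 -> P i}) (aug : {linear P 0%N -> M}) :
    Prop := {
  pr_proj : forall i, projective (P i);
  pr_surj : forall m, exists x, aug x = m;
  pr_exact0 : forall x, aug x = 0 <-> exists y, x = f 0%N y;
  pr_exact : forall i (x : P i.+1), f i x = 0 <-> exists y, x = f i.+1 y }.

Definition proj_dim (M : lmodType R) : \bar K :=
  ereal_inf [set d%:R%:E | d in [set d : nat | exists P f aug,
    @projective_resolution M P f aug /\
    forall i, (d < i)%N -> forall x : P i, x = 0]].

End Modules.

Section Graphs.
Variables (K : realType) (k : fieldType) (n : nat) (G : sgraph n).
Local Notation E := (exterior k n).
Local Notation S := {mpoly k[n]}.

Definition ext_edge_quot : lmodType E :=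
  quotring (edge_monomials (@ext_gen k n) G).

Definition ext_edge_quot_deg (d : int) : set ext_edge_quot :=
  @quotmod_pi _ E^o _ @` @ext_deg k n d.

Definition pol_edge_quot : lmodType S :=
  quotring (edge_monomials (fun i => 'X_i : S) G).

Definition depthE : \bar K := ext_depth K ext_edge_quot.

Definition cxE : \bar K := ext_complexity K ext_edge_quot_deg.

(* Depth with respect to the homogeneous maximal ideal (x_0, ..., x_(n-1)). *)
Definition depthS : \bar K :=
  depth_in K (ideal_gen (range (fun i => 'X_i : S))) pol_edge_quot.

Definition pdS : \bar K := proj_dim K pol_edge_quot.

End Graphs.

(* Main.v *)
Require Import Defs.
From HB Require Import structures.
From mathcomp Require Import mpoly freeg.
From mathcomp Require Import all_boot all_order all_algebra.
From mathcomp Require Import zify ring.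
From mathcomp Require Import boolp classical_sets.
From mathcomp Require Import reals constructive_ereal ereal.
From mathcomp Require Import fintype finset.
Import Defs.

Set Implicit Arguments.
Unset Strict Implicit.
Unset Printing Implicit Defensive.

Import Order.TTheory GRing.Theory Num.Theory.

Local Open Scope ring_scope.

(** A bipartition of G without isolated vertices has two sides, A and B, each of
    them a maximal independent set and each of them dominating the other. So the
    monomials e_A, e_B of E / I_E and x_A, x_B of S / I_S are nonzero, e_A and e_B
    are killed by all of E_1, and x_A is killed by the variables of B. These
    monomials, and a variant of e_A for the complexity, give bounds in terms of the
    sizes of the sides, one of which is at most n / 2 and the other at least n / 2.

    Depth over E. As over a free module, the annihilator in M of a regular sequence
    l_1, .., l_r is l_1 .. l_r M ([regular_socle]); so w = l_1 .. l_r divides both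
    e_A and e_B, which forces r < |B| ([regular_seq_lt]).

    Projective dimension. The |B| variables of B kill x_A. A nonzero element killed
    by a regular sequence of S lives, step by step, along any projective resolution,
    which has length at least that of the sequence ([resolution_length]).

    Depth over S. A regular sequence of length r in the maximal ideal kills the
    Koszul cohomology of S / I on all the variables in degrees below r
    ([koszul_vanish]). By graded Nakayama a variable can be dropped, lowering the
    degree of vanishing by one ([hvanish_cons]). If r > |A|, dropping the variables
    of A leaves H^0 = 0 on the variables of B, whereas x_A is a nonzero class there
    ([regular_seq_size]).

    Complexity. The Betti numbers of a minimal resolution are the dimensions of
    Tor^E(E / I, k), computed by the Cartan complex, E / I tensored with divided
    powers in variables y_i ([indep_leq_betti], [betti_leq_indep]). If A is now a
    minimal set outside of B that dominates B, then e_A y^c is a cycle for all c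
    supported on the union of A and B. Each vertex of A has a neighbour in B that it
    shares with no other vertex of A; the residues along these edges show that the
    classes are independent as soon as c is positive at these neighbours
    ([indep_single]). With |B| exponents chosen freely this gives growth like
    t ^ |B| ([indep_family], [cx_lower]).

    The bounds are attained by the double star: vertices 0 and 1 are adjacent, the
    other odd vertices are leaves at 0 and the other even ones leaves at 1. Its
    quotient has a filtration whose factors are the quotients by the odd variables,
    by the even ones and by the two centres ([dstar_filtration]). Resolutions,
    regular sequences and Tor all pass through the filtration ([cyclic_res_ext],
    [wreg_ext], [homology_ext]), which settles projective dimension, depth over S
    and complexity. Over E the sums e_(2j) + e_(2j+1) of a leaf on each centre form
    a regular sequence ([leaf_seq_regular]). *)

(** * Submodules generated by sequences *)

Section Spans.
Variables (R : pzRingType) (M : lmodType R) (X : set M).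

Lemma span_gen x : X x -> x \in span X.
Proof.
move=> Xx; apply/asboolP; exists 1%N, (fun=> 1), (fun=> x).
by rewrite big_ord1 scale1r.
Qed.

Lemma span_ind (P : M -> Prop) : P 0 -> (forall x y, P x -> P y -> P (x + y)) ->
  (forall a x, P x -> P (a *: x)) -> (forall x, X x -> P x) ->
  forall m, m \in span X -> P m.
Proof.
move=> P0 PD PZ PX m /asboolP[d [a [x [Xx ->]]]].
by elim/big_ind: _ => // i _; apply/PZ/PX.
Qed.

End Spans.

Section SequenceMultiples.
Variables (R : pzRingType) (N : lmodType R).
Implicit Types (s : seq R) (m : N).

(** s_0 N + .. + s_(t-1) N.  It is a submodule only under the condition on s stated
    further down. *)
Definition insum s t m := exists y : nat -> N, m = \sum_(j < t) s`_j *: y j.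

Lemma insum0 s t : insum s t 0.
Proof. by exists (fun=> 0); rewrite big1 // => j _; rewrite scaler0. Qed.

Lemma insumD s t m m' : insum s t m -> insum s t m' -> insum s t (m + m').
Proof.
move=> [y ->] [y' ->]; exists (fun j => y j + y' j).
by rewrite -big_split; apply: eq_bigr => j _; rewrite scalerDr.
Qed.

Lemma insum_gen s t j m : (j < t)%N -> insum s t (s`_j *: m).
Proof.
move=> jt; exists (fun i => if i == j then m else 0).
rewrite (bigD1 (Ordinal jt)) //= eqxx big1 ?addr0 // => i.
by rewrite -val_eqE /= => /negPf ->; rewrite scaler0.
Qed.

Lemma insum_nil s m : insum s 0 m <-> m = 0.
Proof.
by split=> [[y ->]|->]; [rewrite big_ord0 | exact: insum0].
Qed.

Lemma insumS s t m :
  insum s t.+1 m <-> exists x m', insum s t m' /\ m = s`_t *: x + m'.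
Proof.
split=> [[y ->]|[x [m' [[y ->] ->]]]].
  exists (y t), (\sum_(j < t) s`_j *: y j); split; first by exists y.
  by rewrite big_ord_recr /= addrC.
exists (fun j => if j == t then x else y j).
rewrite big_ord_recr /= eqxx addrC; congr (_ + _); apply: eq_bigr => j _.
by rewrite ltn_eqF.
Qed.

Lemma insum_ind s t (P : N -> Prop) : P 0 ->
  (forall x y, P x -> P y -> P (x + y)) ->
  (forall j x, (j < t)%N -> P (s`_j *: x)) -> forall m, insum s t m -> P m.
Proof.
move=> P0 PD PX m [y ->]; elim/big_ind: _ => // j _; exact: PX.
Qed.

Lemma insum_take s t m : insum (take t s) t m <-> insum s t m.
Proof.
by split=> -[y ->]; exists y; apply: eq_bigr => j _; rewrite nth_take.
Qed.

(** This makes the right ideal generated by the s_j two-sided, and insum a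
    submodule; it holds in commutative rings and for linear forms of an exterior
    algebra. *)
Definition normal_seq s :=
  forall c j, (j < size s)%N -> exists c', c * s`_j = s`_j * c'.

Lemma insumZ s t c m : normal_seq s -> (t <= size s)%N ->
  insum s t m -> insum s t (c *: m).
Proof.
move=> ns ts; elim/insum_ind: m / => [|x y|j x jt].
- by rewrite scaler0; exact: insum0.
- by rewrite scalerDr; exact: insumD.
- have [c' e] := ns c j (leq_trans jt ts).
  by rewrite scalerA e -scalerA; exact: insum_gen.
Qed.

Lemma normal_take s t : normal_seq s -> normal_seq (take t s).
Proof.
move=> ns c j; rewrite size_take_min => jt; rewrite nth_take; last first.
  by apply: leq_trans jt _; apply: geq_minl.
by apply: ns; apply: leq_trans jt _; apply: geq_minr.
Qed.

Lemma quot_ideal_eq0 s : normal_seq s -> forall m : N,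
  (quotmod_pi _ m = 0 :> quot_ideal N [set` s]%classic) <-> insum s (size s) m.
Proof.
move=> ns m; rewrite quotmod_pi_eq0; split; last first.
  move=> [y ->]; apply: rpred_sum => j _; apply: span_gen.
  exists s`_j, (y j); split=> //; apply: span_gen.
  by exists s`_j, 1; split; [exact: mem_nth | rewrite mulr1].
elim/span_ind: m / => [|x y|a x|x].
- exact: insum0.
- exact: insumD.
- exact: insumZ.
move=> [a [m' [a_s ->]]]; elim/span_ind: a / a_s => [|a b Ha Hb|c a Ha|a].
- by rewrite scale0r; exact: insum0.
- by rewrite scalerDl; exact: insumD.
- by rewrite -scalerA; exact: insumZ.
move=> [l [b [/= ls ->]]]; rewrite -scalerA -(nth_index 0 ls).
by apply: insum_gen; rewrite index_mem.
Qed.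

Lemma quot_take_eq0 s t : normal_seq s -> (t <= size s)%N -> forall m : N,
  (quotmod_pi _ m = 0 :> quot_ideal N [set` take t s]%classic) <-> insum s t m.
Proof.
move=> ns ts m; have := quot_ideal_eq0 (normal_take (t := t) ns) m.
by rewrite size_takel // insum_take.
Qed.

End SequenceMultiples.

Lemma normal_seq_comm (R : comPzRingType) (s : seq R) : normal_seq s.
Proof. by move=> c j _; exists c; rewrite mulrC. Qed.

(** * Contractions and units of the exterior algebra *)

Section ExteriorCalculus.
Variables (k : fieldType) (n : nat).
Local Notation E := (exterior k n).
Local Notation e := (@ext_gen k n).
Implicit Types (A B C : {set 'I_n}) (x y : E) (i j : 'I_n).

Lemma ext_gen_mulE i x A :
  (e i * x) A = if i \in A then (-1) ^+ ext_inv [set i] (A :\ i) * x (A :\ i)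
                else 0.
Proof.
rewrite ffunE big_mkcond (bigD1 [set i]%SET) //= big1 ?addr0 => [|B neB].
  by rewrite sub1set ffunE eqxx mul1r.
by rewrite ffunE (negPf neB) mul0r mulr0 if_same.
Qed.

Definition contr i x : E :=
  [ffun A : {set 'I_n} => if i \in A then 0 else (-1) ^+ ext_inv [set i] A * x (i |: A)].

Lemma contrE i x A : contr i x A =
  if i \in A then 0 else (-1) ^+ ext_inv [set i] A * x (i |: A).
Proof. by rewrite ffunE. Qed.

Lemma contr_is_additive i : zmod_morphism (contr i).
Proof.
move=> x y; apply/ffunP => A; rewrite !ffunE.
by case: ifP => _; rewrite ?subr0 // mulrBr.
Qed.

HB.instance Definition _ i :=
  GRing.isZmodMorphism.Build E E (contr i) (contr_is_additive i).

Lemma contrZ i a x : contr i (a *: x) = a *: contr i x.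
Proof.
apply/ffunP => A; rewrite !ffunE; case: ifP => _; first by rewrite mulr0.
by rewrite mulrCA.
Qed.

Lemma ext_inv1 i j : ext_inv [set i] [set j] = (j < i)%N.
Proof. by rewrite /ext_inv !big_set1. Qed.

Lemma ext_inv1U i j A : j \notin A ->
  ext_inv [set i] (j |: A) = ((j < i) + ext_inv [set i] A)%N.
Proof. by move=> jA; rewrite ext_invUr ?ext_inv1 // disjoints1. Qed.

Lemma signr_sqr_id (m : nat) (a : k) : (-1) ^+ m * ((-1) ^+ m * a) = a.
Proof. by rewrite mulrA -expr2 sqrr_sign mul1r. Qed.

Lemma extB x y A : (x - y) A = x A - y A.
Proof. by rewrite !ffunE. Qed.

(** Wedging with e_i and contracting with the dual of e_j generate a Clifford
    algebra; every homotopy below rests on this relation. *)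
Lemma contr_gen i j x :
  contr j (e i * x) = (if i == j then x else 0) - e i * contr j x.
Proof.
apply/ffunP => A; rewrite extB contrE !ext_gen_mulE !contrE.
have [<-{j}|neij] := eqVneq i j.
  rewrite !inE eqxx /=; case: (boolP (i \in A)) => iA.
    by rewrite setD1K // signr_sqr_id subrr.
  by rewrite setU1K // signr_sqr_id subr0.
rewrite !inE (negPf neij) eq_sym neij /= ffunE sub0r.
case: (boolP (j \in A)) => jA; first by rewrite mulr0 if_same oppr0.
case: (boolP (i \in A)) => iA; last by rewrite mulr0 oppr0.
have -> : (j |: A) :\ i = j |: (A :\ i).
  by apply/setP => l; rewrite !inE; case: (eqVneq l i) => [->|]; rewrite ?(negPf neij).
have jAi : j \notin A :\ i by rewrite !inE (negPf jA) andbF.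
rewrite ext_inv1U // -{1}(setD1K iA) ext_inv1U ?setD11 //.
set a := ext_inv _ _; set b := ext_inv _ _; set c := x _.
rewrite !exprD -!mulrA; case: (ltngtP i j) neij => [||/val_inj->]; rewrite ?eqxx //.
  by move=> _ _; rewrite expr0 expr1 !mul1r !mulN1r; congr (- _); rewrite mulrCA.
by move=> _ _; rewrite expr0 expr1 !mul1r !mulN1r mulrN; congr (- _); rewrite mulrCA.
Qed.

Lemma ext_mul_set0 x y : (x * y) set0 = x set0 * y set0.
Proof.
rewrite ffunE (big_pred1 set0) => [|B]; last by rewrite subset0.
by rewrite setDv ext_inv0l mul1r.
Qed.

Lemma gen_mul_set0 i x : (e i * x) set0 = 0.
Proof. by rewrite ext_gen_mulE inE. Qed.

Definition ext_mon A : E := [ffun B : {set 'I_n} => (B == A)%:R].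

Lemma ext_sum_mon x : x = \sum_A x A *: ext_mon A.
Proof.
apply/ffunP => A; rewrite sum_ffunE (bigD1 A) //= big1 => [|B neBA].
  by rewrite !ffunE eqxx mulr1 addr0.
by rewrite !ffunE eq_sym (negPf neBA) mulr0.
Qed.

Lemma gen_mon i A : i \notin A ->
  e i * ext_mon A = (-1) ^+ ext_inv [set i] A *: ext_mon (i |: A).
Proof.
move=> iA; apply/ffunP => B; rewrite ext_gen_mulE !ffunE.
case: (boolP (i \in B)) => iB; last first.
  by case: eqP iB => [->|_]; rewrite ?setU11 ?mulr0.
have -> : (B :\ i == A) = (B == i |: A).
  by apply/eqP/eqP => [<-|->]; rewrite ?setD1K ?setU1K.
by case: eqP => [->|]; rewrite ?setU1K // !mulr0.
Qed.

Lemma gen_mon0 i A : i \in A -> e i * ext_mon A = 0.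
Proof.
move=> iA; apply/ffunP => B; rewrite ext_gen_mulE !ffunE.
case: ifP => // iB; case: eqP => [eA|_]; last by rewrite mulr0.
by rewrite -eA !inE eqxx in iA.
Qed.

(** Every e_A is a signed product of generators, so left multiplication by the
    generators suffices. *)
Lemma ext_ind (P : E -> Prop) : P 1 ->
  (forall x y, P x -> P y -> P (x + y)) -> (forall a x, P x -> P (a *: x)) ->
  (forall i x, P x -> P (e i * x)) -> forall x, P x.
Proof.
move=> P1 PD PZ PM x; rewrite (ext_sum_mon x).
have P0 : P 0 by rewrite -(scale0r (1 : E)); apply: PZ.
elim/big_ind: _ => // A _; apply: (PZ).
elim: {A}#|A| {-2}A (erefl #|A|) => [|m IH] A cA.
  by have -> : A = set0 by apply: cards0_eq; rewrite cA.
have [i iA] : {i | i \in A} by apply/sigW/card_gt0P; rewrite cA.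
have -> : ext_mon A = (-1) ^+ ext_inv [set i] (A :\ i) *: (e i * ext_mon (A :\ i)).
  by rewrite gen_mon ?setD11 // scalerA -expr2 sqrr_sign scale1r setD1K.
by apply: PZ; apply: PM; apply: IH; move: cA; rewrite (cardsD1 i A) iA => -[].
Qed.

(** An element without constant term is nilpotent: its m-th power has no monomial of
    degree less than m.  So the geometric series inverts 1 - v. *)
Lemma ext_unit x : x set0 != 0 -> exists y, y * x = 1 /\ x * y = 1.
Proof.
move=> x0; pose v : E := 1 - (x set0)^-1 *: x.
have vlow m A : (#|A| < m)%N -> (v ^+ m) A = 0.
  elim: m A => // m IH A; rewrite ltnS exprS => cA.
  rewrite ffunE big1 // => B sBA; have [->|B0] := eqVneq B set0.
    by rewrite !ffunE eqxx mulVf // subrr mul0r mulr0.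
  rewrite IH ?mulr0 //; apply: leq_trans cA.
  by rewrite -(cardsID B A) (setIidPr sBA) -{1}[#|_ :\: _|]add0n ltn_add2r card_gt0.
have v0 : v ^+ n.+1 = 0.
  apply/ffunP => A; rewrite vlow ?ffunE // ltnS -[leqRHS](card_ord n).
  exact: max_card.
pose g := \sum_(i < n.+1) v ^+ i.
have comm_vg : GRing.comm v g by apply: commr_sum => i _; apply: commrX.
have e1 : (1 - v) * g = 1.
  by apply: oppr_inj; rewrite -mulNr opprB -subrX1 v0 sub0r.
have e2 : g * (1 - v) = 1.
  by rewrite mulrBr mulr1 -comm_vg -[X in X - _]mul1r -mulrBl.
have xv : 1 - v = (x set0)^-1 *: x by rewrite /v opprB addrC subrK.
exists ((x set0)^-1 *: g); split.
  by rewrite -scalerAl scalerAr -xv.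
by rewrite -scalerAr scalerAl -xv.
Qed.

(** ** Edge ideals *)

Definition indep_set (G : sgraph n) A := forall i j, i \in A -> j \in A -> ~~ G i j.

(** I_E(G) is spanned by the monomials of the dependent sets; this description makes
    it a matter of coordinates to decide membership. *)
Definition ext_edge_ideal (G : sgraph n) x := forall A, indep_set G A -> x A = 0.

Lemma indep_subset (G : sgraph n) A B : B \subset A -> indep_set G A -> indep_set G B.
Proof. by move=> /subsetP sBA iA i j iB jB; apply: iA; apply: sBA. Qed.

Lemma mon_prod A B : A \subset B ->
  exists a, ext_mon B = a *: (ext_mon A * ext_mon (B :\: A)).
Proof.
move=> sAB; exists ((-1) ^+ ext_inv A (B :\: A)).
have -> : ext_mon A * ext_mon (B :\: A) = (-1) ^+ ext_inv A (B :\: A) *: ext_mon B.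
  apply/ffunP => C; rewrite !ffunE big_mkcond (bigD1 A) //= big1 ?addr0.
    rewrite !ffunE eqxx mul1r; case: ifPn => [sAC|nAC].
      have -> : (C :\: A == B :\: A) = (C == B).
        apply/eqP/eqP => [eCB|->//].
        by rewrite -(setID C A) -(setID B A) eCB (setIidPr sAC) (setIidPr sAB).
      by case: eqP => [->|]; rewrite ?mulr0.
    by case: eqP nAC => [->|]; rewrite ?sAB ?mulr0.
  by move=> D neDA; rewrite ffunE (negPf neDA) mul0r mulr0 if_same.
by rewrite scalerA -expr2 sqrr_sign scale1r.
Qed.

Lemma ext_edge_idealP (G : sgraph n) x :
  x \in ideal_gen (edge_monomials e G) <-> ext_edge_ideal G x.
Proof.
split=> [|Ix].
  elim/span_ind: x / => [A _|x y Hx Hy A iA|a x Hx A iA|x].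
  - by rewrite ffunE.
  - by rewrite ffunE Hx ?Hy ?addr0.
  - rewrite ffunE big1 // => B sBA; rewrite Hx ?mulr0 //.
    by apply: indep_subset iA; rewrite subsetDl.
  move=> [_ [b [[i [j [Gij ->]]] ->]]] A iA; rewrite -mulrA ext_gen_mulE.
  case: ifP => // iA1; rewrite ext_gen_mulE; case: ifP => [|_]; last by rewrite mulr0.
  by rewrite inE => /andP[_ jA]; have := iA _ _ iA1 jA; rewrite Gij.
rewrite (ext_sum_mon x); apply: rpred_sum => B _.
have [iB|] := pselect (indep_set G B).
  by rewrite Ix // scale0r; apply: rpred0.
move/existsNP => [i] /existsNP[j] /not_implyP[iB] /not_implyP[jB] /negP/negPn Gij.
have neij : i != j by apply: contraTneq Gij => ->; rewrite adj_irr.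
have sB : [set i; j]%SET \subset B by rewrite subUset !sub1set iB.
have [a ->] := mon_prod sB; rewrite scalerA.
have -> : forall (c : k) (y z : E), c *: (y * z) = (c *: y) * z.
  by move=> c y z; rewrite scalerAl.
have -> : forall c : k, c *: ext_mon [set i; j]%SET = (c *: 1) * ext_mon [set i; j]%SET.
  by move=> c; rewrite -scalerAl mul1r.
have [b ->] : exists b : k, ext_mon [set i; j]%SET = (b *: 1) * (e i * e j).
  exists ((-1) ^+ (j < i)%N); rewrite -scalerAl mul1r ext_gen_mul.
  apply/ffunP => C; rewrite !ffunE neij /=; case: eqP => _; rewrite ?mulr0 //.
  by rewrite -expr2 sqrr_sign.
rewrite mulrA -mulrA; apply: span_scale; apply: span_gen.
by exists (e i * e j), (ext_mon (B :\: [set i; j]%SET)); split=> //; exists i, j.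
Qed.

End ExteriorCalculus.

(** * The Cartan complex *)

Lemma alternating_sum (V : zmodType) n (F : 'I_n -> 'I_n -> V) :
  (forall i, F i i = 0) -> (forall i j, F i j = - F j i) ->
  \sum_i \sum_j F i j = 0.
Proof.
move=> F0 FN.
have split_ij i : \sum_j F i j =
    \sum_(j : 'I_n | (j < i)%N) F i j + \sum_(j : 'I_n | (i < j)%N) F i j.
  rewrite (bigID (fun j : 'I_n => (j < i)%N)) /=; congr (_ + _).
  rewrite (bigD1 i) ?ltnn //= F0 add0r; apply: eq_bigl => j.
  by rewrite -leqNgt ltn_neqAle eq_sym andbC val_eqE.
under eq_bigr => i _ do rewrite split_ij.
rewrite big_split /= [X in _ + X](exchange_big_dep predT) //= -big_split /=.
apply: big1 => i _; rewrite -big_split /=; apply: big1 => j _.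
by rewrite FN addNr.
Qed.

Definition submod (R : pzRingType) (N : lmodType R) (L : N -> Prop) :=
  [/\ L 0, forall x y, L x -> L y -> L (x + y) & forall a x, L x -> L (a *: x)].

Lemma submod_sum (R : pzRingType) (N : lmodType R) (L : N -> Prop) (I : Type)
    (r : seq I) (P : pred I) (F : I -> N) : submod L ->
  (forall i, P i -> L (F i)) -> L (\sum_(i <- r | P i) F i).
Proof. by move=> [L0 LD _] LF; elim/big_ind: _. Qed.

Lemma submodB (R : pzRingType) (N : lmodType R) (L : N -> Prop) x y :
  submod L -> L x -> L y -> L (x - y).
Proof. by move=> [_ LD LZ] Lx Ly; apply: LD => //; rewrite -scaleN1r; apply: LZ. Qed.

Section Rows.
Variable R : nzRingType.

Lemma im_submod b b' (D : 'M[R]_(b', b)) :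
  submod (fun u : 'rV[R]_b => exists v, u = v *m D).
Proof.
split=> [|_ _ [u ->] [v ->]|a _ [u ->]]; first by exists 0; rewrite mul0mx.
  by exists (u + v); rewrite mulmxDl.
by exists (a *: u); rewrite scalemxAl.
Qed.

Lemma ker_submod b b' (D : 'M[R]_(b', b)) :
  submod (fun v : 'rV[R]_b' => v *m D = 0).
Proof.
split=> [|u v Hu Hv|a u Hu]; first by rewrite mul0mx.
  by rewrite mulmxDl Hu Hv addr0.
by rewrite -scalemxAl Hu scaler0.
Qed.

Variables (b : nat) (M : lmodType R) (g : 'I_b -> M).

Definition row_map (u : 'rV[R]_b) : M := \sum_q u 0 q *: g q.

Lemma row_map_is_linear : linear row_map.
Proof.
move=> a u v; rewrite /row_map scaler_sumr -big_split.
by apply: eq_bigr => q _; rewrite !mxE scalerDl scalerA.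
Qed.

HB.instance Definition _ :=
  GRing.isLinear.Build R 'rV[R]_b M *:%R row_map row_map_is_linear.

End Rows.

Section Cartan.
Variables (k : fieldType) (n : nat).
Local Notation E := (exterior k n).
Local Notation e := (@ext_gen k n).
Local Notation mon := 'X_{1..n}.
Implicit Types (N : lmodType E) (mu : mon).

(** N (x) D with D the divided power algebra on n variables y_j: the coordinate
    of z on y^(mu) is z mu.  The homology of this complex is Tor^E(N, k), the
    homological degree being the degree of mu. *)
Definition dcar N (z : mon -> N) mu : N := \sum_i e i *: z (mu + U_(i))%MM.

Lemma dcarB N (z z' : mon -> N) mu :
  dcar (fun mu => z mu - z' mu) mu = dcar z mu - dcar z' mu.
Proof. by rewrite /dcar -sumrB; apply: eq_bigr => i _; rewrite scalerBr. Qed.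

Lemma dcarD N (z z' : mon -> N) mu :
  dcar (fun mu => z mu + z' mu) mu = dcar z mu + dcar z' mu.
Proof. by rewrite /dcar -big_split; apply: eq_bigr => i _; rewrite scalerDr. Qed.

Lemma scaleA_comm (a : k) (x : E) : a%:A * x = x * a%:A.
Proof. by rewrite -scalerAl -scalerAr mul1r mulr1. Qed.

Lemma dcar_sum N I (r : seq I) (a : I -> k) (z : I -> mon -> N) mu :
  dcar (fun mu => \sum_(j <- r) (a j)%:A *: z j mu) mu =
  \sum_(j <- r) (a j)%:A *: dcar (z j) mu.
Proof.
rewrite /dcar; under eq_bigr => i _ do rewrite scaler_sumr.
rewrite exchange_big; apply: eq_bigr => j _ /=.
by rewrite scaler_sumr; apply: eq_bigr => i _; rewrite !scalerA scaleA_comm.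
Qed.

Lemma dcar_linear N N' (p : {linear N -> N'}) (z : mon -> N) mu :
  p (dcar z mu) = dcar (p \o z) mu.
Proof. by rewrite /dcar linear_sum; apply: eq_bigr => i _; rewrite linearZ. Qed.

Lemma eq_dcar N (z z' : mon -> N) mu :
  (forall i, z (mu + U_(i))%MM = z' (mu + U_(i))%MM) -> dcar z mu = dcar z' mu.
Proof. by move=> ez; apply: eq_bigr => i _; rewrite ez. Qed.

Lemma dcarK N (z : mon -> N) mu : dcar (dcar z) mu = 0.
Proof.
rewrite /dcar; under eq_bigr => i _ do rewrite scaler_sumr.
apply: alternating_sum => [i|i j]; first by rewrite scalerA ext_gen_sqr scale0r.
by rewrite !scalerA ext_gen_anticomm scaleNr -!addmA (addmC U_(i)%MM).
Qed.

Lemma dcar_submod N (L : N -> Prop) (z : mon -> N) mu : submod L ->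
  (forall i, L (z (mu + U_(i))%MM)) -> L (dcar z mu).
Proof. by move=> sL Lz; apply: submod_sum => // i _; case: sL => _ _; apply. Qed.

(** Cycles and boundaries of the complex of N / L, written with chains of N so as to
    avoid quotients. *)
Definition cyc t N (L : N -> Prop) (z : mon -> N) :=
  forall mu, (mdeg mu).+1 = t -> L (dcar z mu).

Definition bnd t N (L : N -> Prop) (z : mon -> N) :=
  exists v, forall mu, mdeg mu = t -> L (z mu - dcar v mu).

Definition lincomb m (a : 'rV[k]_m) N (z : 'I_m -> mon -> N) mu : N :=
  \sum_j (a 0 j)%:A *: z j mu.

(** The classes of the z_j in H_t of the complex of N / L are linearly independent
    over k. *)
Definition indep t N (L : N -> Prop) m (z : 'I_m -> mon -> N) :=
  (forall j, cyc t L (z j)) /\ (forall a, bnd t L (lincomb a z) -> a = 0).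

Lemma dcar_lincomb m (a : 'rV[k]_m) N (z : 'I_m -> mon -> N) mu :
  dcar (lincomb a z) mu = \sum_j (a 0 j)%:A *: dcar (z j) mu.
Proof. exact: dcar_sum. Qed.

Lemma lincomb_linear m (a : 'rV[k]_m) N N' (p : {linear N -> N'}) z mu :
  p (lincomb a z mu) = lincomb a (fun j => p \o z j) mu.
Proof. by rewrite /lincomb linear_sum; apply: eq_bigr => j _; rewrite linearZ. Qed.

Lemma eq_bnd t N (L : N -> Prop) (z z' : mon -> N) :
  (forall mu, mdeg mu = t -> z mu = z' mu) -> bnd t L z -> bnd t L z'.
Proof. by move=> ez [v Hv]; exists v => mu tmu; rewrite -ez //; apply: Hv. Qed.

Section Pull.
Variables (N N' : lmodType E) (p : {linear N -> N'}).
Variables (L : N -> Prop) (L' : N' -> Prop).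
Hypothesis p_surj : forall y, exists x, y = p x.
Hypothesis pL : forall x, L x <-> L' (p x).

Lemma cyc_pull t z : cyc t L z <-> cyc t L' (p \o z).
Proof.
by split=> cz mu tmu; have := cz mu tmu; rewrite -dcar_linear pL.
Qed.

Lemma bnd_pull t z : bnd t L z <-> bnd t L' (p \o z).
Proof.
split=> [[v Hv]|[v Hv]].
  by exists (p \o v) => mu tmu; rewrite -dcar_linear -linearB -pL; apply: Hv.
have [w Hw] := choice (fun mu => p_surj (v mu)).
exists w => mu tmu; rewrite pL linearB dcar_linear.
by rewrite (eq_dcar (z' := v)) => [|i]; [exact: Hv | rewrite /= -Hw].
Qed.

Lemma indep_pull t m (z : 'I_m -> mon -> N) :
  indep t L z <-> indep t L' (fun j => p \o z j).
Proof.
have E1 a : bnd t L (lincomb a z) <-> bnd t L' (lincomb a (fun j => p \o z j)).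
  rewrite bnd_pull; split; apply: eq_bnd => mu _; by rewrite /= lincomb_linear.
split=> -[cz iz]; split=> [j|a Ha].
- by rewrite -cyc_pull.
- by apply: iz; rewrite E1.
- by rewrite cyc_pull.
- by apply: iz; rewrite -E1.
Qed.

Lemma indep_lift t m (z : 'I_m -> mon -> N') : indep t L' z ->
  exists w : 'I_m -> mon -> N, indep t L w.
Proof.
move=> iz; have [w Hw] := choice (fun y => p_surj y).
exists (fun j => w \o z j); rewrite indep_pull.
suff -> : (fun j => p \o (w \o z j)) = z by [].
by apply/funext => j; apply/funext => mu /=; rewrite -Hw.
Qed.

End Pull.

(** A module with contractions compatible with the action of E, like a free
    module, has homotopies h_j killing all the y^(mu) that involve y_j. *)
Section Homotopy.
Variables (N : lmodType E) (c : 'I_n -> N -> N).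
Hypothesis cB : forall j, zmod_morphism (c j).
Hypothesis cE : forall i j x,
  c j (e i *: x) = (if i == j then x else 0) - e i *: c j x.

(** The homotopy that divides by y_j and contracts with e_j. *)
Definition hcar j (z : mon -> N) mu : N :=
  if (0 < mu j)%N then c j (z (mu - U_(j))%MM) else 0.

Let c0 j : c j 0 = 0. Proof. by rewrite -{1}(subrr 0) cB subrr. Qed.
Let cN j x : c j (- x) = - c j x. Proof. by rewrite -[- x]sub0r cB c0 sub0r. Qed.
Let cD j : {morph c j : x y / x + y}.
Proof. by move=> x y; rewrite -{1}(opprK y) cB cN opprK. Qed.

Lemma hcar_pos j z mu : (0 < mu j)%N ->
  z mu - dcar (hcar j z) mu = c j (dcar z (mu - U_(j))%MM).
Proof.
move=> muj; rewrite /dcar (big_morph (c j) (cD j) (c0 j)).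
under [RHS]eq_bigr => i _ do rewrite cE.
rewrite sumrB; congr (_ - _).
  rewrite -big_mkcond big_pred1_eq submK //.
  apply/mnm_lepP => l; rewrite mnm1E; case: eqVneq => [<-|//]; exact: muj.
apply: eq_bigr => i _; congr (_ *: _).
rewrite /hcar mnmDE addn_gt0 muj /=; congr (c j (z _)).
by apply/mnmP => l; rewrite !(mnmDE, mnmBE, mnm1E); case: (eqVneq j l) => [<-|_] /=; lia.
Qed.

Lemma hcar_zero j z mu : mu j = 0%N -> dcar (hcar j z) mu = e j *: c j (z mu).
Proof.
move=> muj; rewrite /dcar (bigD1 j) //= big1 ?addr0 => [|i neij].
  by rewrite /hcar mnmDE mnm1E eqxx addn1 /= addmK.
by rewrite /hcar mnmDE mnm1E (negPf neij) muj scaler0.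
Qed.

End Homotopy.

Definition trunc t N (z : mon -> N) mu := if mdeg mu == t then z mu else 0.

Lemma dcar_trunc t N (L : N -> Prop) z mu : L 0 -> cyc t L z -> L (dcar (trunc t z) mu).
Proof.
move=> L0 cz; have [emu|nemu] := eqVneq (mdeg mu).+1 t.
  rewrite (eq_dcar (z' := z)); first exact: cz.
  by move=> i; rewrite /trunc mdegD mdeg1 addn1 emu eqxx.
rewrite /dcar big1 // => i _.
by rewrite /trunc mdegD mdeg1 addn1 (negPf nemu) scaler0.
Qed.

Section FreeModules.
Variable b : nat.
Local Notation F := 'rV[E]_b.

Definition contr_row j (u : F) : F := map_mx (@contr k n j) u.

Lemma contr_row_is_additive j : zmod_morphism (contr_row j).
Proof. by move=> u v; rewrite /contr_row raddfB. Qed.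

Lemma contr_row_gen i j (u : F) :
  contr_row j (e i *: u) = (if i == j then u else 0) - e i *: contr_row j u.
Proof.
apply/rowP => q; rewrite !mxE contr_gen; by case: ifP => _; rewrite ?mxE.
Qed.

(** The homotopies h_j of all the variables in turn subtract boundaries from a cycle
    until it vanishes on every y^(mu) of positive degree. *)
Lemma free_exact t (z : mon -> F) : (0 < t)%N -> cyc t (fun u => u = 0) z ->
  bnd t (fun u => u = 0) z.
Proof.
move=> t0 cz; pose h := hcar contr_row.
have [v [_ Hv]] : exists v, (forall mu, dcar (fun mu => trunc t z mu - dcar v mu) mu = 0) /\
    (forall j mu, j \in enum 'I_n -> (0 < mu j)%N -> trunc t z mu - dcar v mu = 0).
  elim: (enum 'I_n) => [|j s [v [cv Hv]]].
    exists (fun=> 0); split=> // mu; rewrite dcarB dcarK subr0.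
    by apply: (@dcar_trunc t _ (fun u => u = 0)).
  pose z' mu := trunc t z mu - dcar v mu.
  have Hz' mu : trunc t z mu - dcar (fun mu => v mu + h j z' mu) mu =
                z' mu - dcar (h j z') mu.
    by rewrite dcarD opprD addrA.
  exists (fun mu => v mu + h j z' mu); split=> [mu|l mu].
    rewrite (eq_dcar (z' := fun mu => z' mu - dcar (h j z') mu)) => [|i]; last exact: Hz'.
    by rewrite dcarB dcarK subr0 cv.
  rewrite inE Hz'; case: (posnP (mu j)) => muj.
    case: eqVneq => [->|_ /= ls mul]; first by rewrite muj.
    have z'0 : z' mu = 0 by apply: (Hv l).
    rewrite (hcar_zero _ _ muj) z'0.
    by rewrite /contr_row raddf0 scaler0 subr0.
  move=> _ _; rewrite (hcar_pos contr_row_is_additive contr_row_gen) // cv.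
  by rewrite /contr_row raddf0.
exists v => mu tmu; have [j muj] : exists j, (0 < mu j)%N.
  apply/existsP; apply: contraLR t0; rewrite negb_exists -leqNgt leqn0 => /forallP H.
  by rewrite -tmu mdegE big1 // => i _; apply/eqP; rewrite -leqn0 leqNgt.
by have := Hv j mu (mem_enum _ j) muj; rewrite /trunc tmu eqxx.
Qed.

End FreeModules.

End Cartan.

(** * Ranks of free resolutions over the exterior algebra *)

Section Steps.
Variables (k : fieldType) (n : nat).
Local Notation E := (exterior k n).
Local Notation e := (@ext_gen k n).
Local Notation mon := 'X_{1..n}.

Lemma aug_decomp (x : E) : x set0 = 0 -> exists f : 'I_n -> E, x = \sum_i e i * f i.
Proof.
suff [a [f ->]] : exists a f, x = a%:A + \sum_i e i * f i.
  have -> : (a%:A + \sum_i e i * f i) set0 = a.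
    rewrite !ffunE sum_ffunE big1 ?addr0 ?eqxx ?mulr1 // => i _.
    exact: gen_mul_set0.
  by move=> ->; exists f; rewrite scale0r add0r.
elim/ext_ind: x => [|x y [a [f ->]] [b [g ->]]|b x [a [f ->]]|i x _].
- by exists 1, (fun=> 0); rewrite scale1r big1 ?addr0 // => i _; rewrite mulr0.
- exists (a + b), (fun i => f i + g i); rewrite scalerDl addrACA; congr (_ + _).
  by rewrite -big_split; apply: eq_bigr => i _; rewrite mulrDr.
- exists (b * a), (fun i => b *: f i); rewrite scalerDr scalerA; congr (_ + _).
  by rewrite scaler_sumr; apply: eq_bigr => i _; rewrite -scalerAr.
- exists 0, (fun j => if j == i then x else 0).
  rewrite scale0r add0r (bigD1 i) //= eqxx big1 ?addr0 // => j /negPf ->.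
  by rewrite mulr0.
Qed.

Lemma aug_decomp_row b (u : 'rV[E]_b) : (forall q, u 0 q set0 = 0) ->
  exists f : 'I_n -> 'rV[E]_b, u = \sum_i e i *: f i.
Proof.
move=> u0; have [f Hf] := choice (fun q => aug_decomp (u0 q)).
exists (fun i => \row_q f q i); apply/rowP => q; rewrite Hf summxE.
by apply: eq_bigr => i _; rewrite !mxE.
Qed.

Lemma dcar_set0 b (z : mon -> 'rV[E]_b) mu q : dcar z mu 0 q set0 = 0.
Proof.
rewrite summxE sum_ffunE big1 // => i _; rewrite mxE; exact: gen_mul_set0.
Qed.

Lemma lincomb_set0 b m (a : 'rV[k]_m) (z : 'I_m -> mon -> 'rV[E]_b) mu q :
  lincomb a z mu 0 q set0 = \sum_j a 0 j * z j mu 0 q set0.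
Proof.
rewrite summxE sum_ffunE; apply: eq_bigr => j _.
by rewrite mxE -scalerAl mul1r ffunE.
Qed.

(** H_0 of a quotient of F is F / (L + E_+ F), a quotient of k^b: a chain
    without constant terms is a boundary. *)
Lemma indep0_leq b L m (z : 'I_m -> mon -> 'rV[E]_b) :
  submod L -> indep 0 L z -> (m <= b)%N.
Proof.
move=> sL [_ iz]; pose M := \matrix_(j < m, q < b) z j 0%MM 0 q set0.
suff : row_free M by move/eqP <-; apply: rank_leq_col.
apply: inj_row_free => a aM; apply: iz.
have [q|f Hf] := @aug_decomp_row _ (lincomb a z 0%MM).
  have := congr1 (fun A : 'rV_b => A 0 q) aM; rewrite !mxE => aM0.
  by rewrite lincomb_set0 -[RHS]aM0; apply: eq_bigr => j _; rewrite mxE.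
pose v mu := \sum_(i | mu == U_(i)%MM) f i; exists v => mu /eqP.
rewrite mdeg_eq0 => /eqP ->; rewrite Hf.
suff -> : dcar v 0%MM = \sum_i e i *: f i by rewrite subrr; case: sL.
apply: eq_bigr => i _; congr (_ *: _); rewrite /v add0m (big_pred1 i) // => j.
apply/eqP/eqP => [/(congr1 (fun m : mon => m i))|-> //].
by rewrite !mnm1E eqxx; case: eqVneq.
Qed.

(** If L is inside E_+ F then F / (L + E_+ F) has dimension b. *)
Lemma indep0_ge b (L : 'rV[E]_b -> Prop) :
  (forall v, L v -> forall q, v 0 q set0 = 0) ->
  exists z : 'I_b -> mon -> 'rV[E]_b, indep 0 L z.
Proof.
move=> L0; exists (fun j _ => delta_mx 0 j); split=> // a [v Hv].
apply/rowP => q; rewrite [RHS]mxE.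
have := L0 _ (Hv 0%MM mdeg0) q.
rewrite !mxE ffunE [X in X + _](_ : _ = a 0 q).
  by rewrite ffunE dcar_set0 oppr0 addr0.
rewrite (lincomb_set0 a (fun j _ => delta_mx 0 j) 0%MM q) (bigD1 q) //= big1.
  by rewrite mxE !eqxx ffunE eqxx mulr1 addr0.
by move=> j neqj; rewrite mxE eq_sym (negPf neqj) ffunE mulr0.
Qed.

Section OneStep.
Variables (b b' : nat) (D : 'M[E]_(b', b)).
Let p : {linear 'rV[E]_b' -> 'rV[E]_b} := mulmxr D.
Let L (u : 'rV[E]_b) := exists v, u = v *m D.
Let L' (v : 'rV[E]_b') := v *m D = 0.

(** Dimension shifting for 0 -> F' / ker D -> F -> F / im D -> 0: the connecting map
    H_(t+1) (F / im D) -> H_t (F' / ker D) is injective because F is acyclic. *)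
Lemma step_down t m (z : 'I_m -> mon -> 'rV[E]_b) : indep t.+1 L z ->
  exists w : 'I_m -> mon -> 'rV[E]_b', indep t L' w.
Proof.
move=> [cz iz].
have /choice[w Hw] j : exists w : mon -> _, forall mu, mdeg mu = t -> dcar (z j) mu = p (w mu).
  have /choice[w Hw] mu : exists w, mdeg mu = t -> dcar (z j) mu = p w.
    have [emu|nemu] := eqVneq (mdeg mu) t; last by exists 0 => /eqP; rewrite (negPf nemu).
    by have [v Hv] := cz j mu (congr1 S emu); exists v.
  by exists w.
exists w; split=> [j mu tmu|a [v Hv]].
  change (p (dcar (w j) mu) = 0); rewrite dcar_linear.
  rewrite (eq_dcar (z' := dcar (z j))) ?dcarK // => i.
  by rewrite /= Hw // mdegD mdeg1 addn1.
apply: iz; pose z' mu := lincomb a z mu - p (v mu).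
have [mu tmu|y Hy] := @free_exact _ _ _ t.+1 z' isT; last first.
  exists y => mu tmu; have := Hy mu tmu; rewrite /z' => /eqP.
  by rewrite addrAC subr_eq0 => /eqP ->; exists (v mu).
case: tmu => tmu; rewrite dcarB dcar_lincomb.
rewrite [X in _ - X](_ : _ = p (dcar v mu)); last by rewrite dcar_linear.
have : p (lincomb a w mu - dcar v mu) = 0 by apply: Hv.
rewrite linearB lincomb_linear => pw0; rewrite -[RHS]pw0; congr (_ - _).
by rewrite /lincomb; apply: eq_bigr => j _; rewrite /= Hw.
Qed.

(** The connecting map is onto as well; for t = 0 this requires that
    H_0 (F' / ker D) -> H_0 (F) be zero, which is the minimality of D. *)
Lemma step_up t m (w : 'I_m -> mon -> 'rV[E]_b') :
  (forall q' q, D q' q set0 = 0) -> indep t L' w ->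
  exists z : 'I_m -> mon -> 'rV[E]_b, indep t.+1 L z.
Proof.
move=> D0 [cw iw].
have /choice[z Hz] j : exists z : mon -> _, forall mu, mdeg mu = t -> p (w j mu) = dcar z mu.
  have [t0|t0] := posnP t; last first.
    have [|v Hv] := @free_exact _ _ _ t (p \o w j) t0.
      by move=> mu tmu; rewrite -dcar_linear; apply: cw.
    by exists v => mu tmu; apply/eqP; rewrite -subr_eq0; apply/eqP/Hv.
  have [q|f Hf] := @aug_decomp_row _ (p (w j 0%MM)).
    rewrite mxE sum_ffunE big1 // => q' _.
    by rewrite [LHS]ext_mul_set0 D0 mulr0.
  exists (fun mu => \sum_(i | mu == U_(i)%MM) f i) => mu /eqP.
  rewrite t0 mdeg_eq0 => /eqP ->; rewrite Hf; apply: eq_bigr => i _; congr (_ *: _).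
  rewrite add0m (big_pred1 i) // => l.
  apply/eqP/eqP => [/(congr1 (fun m : mon => m i))|-> //].
  by rewrite !mnm1E eqxx; case: eqVneq.
exists z; split=> [j mu [tmu]|a [y Hy]].
  by exists (w j mu); rewrite -Hz.
apply: iw.
have /choice[v Hv] mu : exists v, mdeg mu = t.+1 -> lincomb a z mu - dcar y mu = p v.
  have [emu|nemu] := eqVneq (mdeg mu) t.+1; last by exists 0 => /eqP; rewrite (negPf nemu).
  by have [v Hv] := Hy mu emu; exists v.
exists v => mu tmu; change (p (lincomb a w mu - dcar v mu) = 0).
rewrite linearB lincomb_linear dcar_linear.
rewrite (eq_dcar (z' := fun mu => lincomb a z mu - dcar y mu)) => [|i]; last first.
  by apply/esym; apply: Hv; rewrite mdegD mdeg1 addn1 tmu.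
rewrite dcarB dcarK subr0 dcar_lincomb -sumrB big1 // => j _.
by rewrite /= -Hz // subrr.
Qed.

End OneStep.

Section Resolution.
Variables (M : lmodType E) (b : nat -> nat) (g : 'I_(b 0%N) -> M).
Variable D : forall i, 'M[E]_(b i.+1, b i).
Hypothesis surj : forall m, exists u : 'rV[E]_(b 0%N), m = \sum_q u 0 q *: g q.
Hypothesis exact0 : forall u : 'rV[E]_(b 0%N),
  \sum_q u 0 q *: g q = 0 <-> exists v, u = v *m D 0%N.
Hypothesis exactS : forall i (u : 'rV[E]_(b i.+1)),
  u *m D i = 0 <-> exists v, u = v *m D i.+1.

Let L i (u : 'rV[E]_(b i)) := exists v, u = v *m D i.
Local Arguments L : clear implicits.

Local Notation aug_map := (row_map g).

Lemma ker_im i : (fun v : 'rV[E]_(b i.+1) => v *m D i = 0) = L i.+1.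
Proof. by apply/funext => v; apply/propext; apply: exactS. Qed.

(** dim Tor_i (M, k) <= b i, after i dimension shifts. *)
Lemma indep_leq_betti i m (z : 'I_m -> mon -> M) :
  indep i (fun x => x = 0) z -> (m <= b i)%N.
Proof.
move=> iz.
have [w iw] : exists w : 'I_m -> mon -> 'rV[E]_(b 0%N), indep i (L 0%N) w.
  by apply: (indep_lift (p := aug_map)) iz => [y|u]; [exact: surj | rewrite exact0].
suff H j : (j <= i)%N ->
    exists w : 'I_m -> mon -> 'rV[E]_(b j), indep (i - j) (L j) w.
  have [w' iw'] := H i (leqnn i); rewrite subnn in iw'.
  exact: indep0_leq (im_submod _) iw'.
elim: j => [|j IH] ji; first by exists w; rewrite subn0.
have [w' iw'] := IH (ltnW ji); rewrite -ker_im.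
by move: iw'; rewrite -subnSK // => iw'; apply: step_down iw'.
Qed.

(** Over a minimal resolution the i shifts can be reversed, so b i is the dimension
    of Tor_i (M, k). *)
Lemma betti_leq_indep i : (forall i q' q, D i q' q set0 = 0) ->
  exists z : 'I_(b i) -> mon -> M, indep i (fun x => x = 0) z.
Proof.
move=> D0.
have [w iw] : exists w : 'I_(b i) -> mon -> 'rV[E]_(b i), indep 0 (L i) w.
  apply: indep0_ge => _ [v ->] q; rewrite mxE sum_ffunE big1 // => q' _.
  by rewrite [LHS]ext_mul_set0 D0 mulr0.
suff H j : (j <= i)%N ->
    exists w : 'I_(b i) -> mon -> 'rV[E]_(b (i - j)), indep j (L (i - j)%N) w.
  have [w' iw'] := H i (leqnn i); rewrite subnn in w' iw'.
  exists (fun j => aug_map \o w' j).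
  have kerL u : L 0%N u <-> aug_map u = 0 by rewrite exact0.
  exact: ((indep_pull (p := aug_map) surj kerL i w').1 iw').
elim: j => [|j IH] ji; first by rewrite subn0; exists w.
have [w' iw'] := IH (ltnW ji); move: w' iw'; rewrite -subnSK // => w' iw'.
by apply: (@step_up _ _ _ _ _ w') => //; rewrite ker_im.
Qed.

End Resolution.
End Steps.

(** * Existence of minimal graded free resolutions *)

Section FiniteSpan.
Variables (k : fieldType) (m : nat) (P : 'rV[k]_m -> Prop).

(** A linearly independent family in P of largest size spans P.  The point is that P
    is an arbitrary proposition, not a decidable subspace. *)
Lemma fd_span : exists r (A : 'M[k]_(r, m)), (forall i, P (row i A)) /\
  forall u, P u -> exists a, u = a *m A.
Proof.
pose Q r := `[< exists A : 'M[k]_(r, m), row_free A /\ forall i, P (row i A) >].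
have exQ : exists r, Q r.
  exists 0%N; apply/asboolP; exists 0; split; last by case.
  by rewrite /row_free mxrank0.
have ubQ r : Q r -> (r <= m)%N.
  by move=> /asboolP[A [/eqP fA _]]; rewrite -fA; apply: rank_leq_col.
case: (ex_maxnP exQ ubQ) => r /asboolP[A [fA PA]] r_max.
exists r, A; split=> // u Pu; apply/submxP; apply: contrapT => /negP nuA.
suff : (r + 1 <= r)%N by rewrite addn1 ltnn.
apply: r_max; apply/asboolP; exists (col_mx A u); split; last first.
  move=> i; case: (splitP i) => j ij.
    by rewrite (_ : i = lshift 1 j) ?rowKu; [exact: PA | exact: val_inj].
  rewrite (_ : i = rshift r j); last exact: val_inj.
  by rewrite rowKd (ord1 j) row_id.
apply: inj_row_free => a; rewrite -[a]hsubmxK mul_row_col => aAu.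
have [a0|a0] := eqVneq (rsubmx a 0 0) 0; last first.
  have cu : rsubmx a 0 0 *: u = - (lsubmx a *m A).
    apply/eqP; rewrite -addr_eq0 addrC -aAu {2}[rsubmx a]mx11_scalar.
    by rewrite mul_scalar_mx.
  case/negP: nuA; apply/submxP; exists ((rsubmx a 0 0)^-1 *: - lsubmx a).
  by rewrite -scalemxAl mulNmx -cu scalerA mulVf // scale1r.
have a0' : rsubmx a = 0 by rewrite [rsubmx a]mx11_scalar a0 raddf0.
move: aAu; rewrite a0' mul0mx addr0 => /eqP.
by rewrite mulmx_free_eq0 // => /eqP ->; rewrite row_mx0.
Qed.

End FiniteSpan.

Section Existence.
Variables (k : fieldType) (n : nat).
Local Notation E := (exterior k n).

Lemma aug_idealP (x : E) : x \in ideal_gen (range (@ext_gen k n)) <-> x set0 = 0.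
Proof.
split=> [|x0].
  elim/span_ind: x / => [|x y x0 y0|a x x0|_ [_ [b [[i _ <-] ->]]]].
  - by rewrite ffunE.
  - by rewrite ffunE x0 y0 addr0.
  - by rewrite [LHS]ext_mul_set0 x0 mulr0.
  - exact: gen_mul_set0.
have [f ->] := aug_decomp x0; apply: rpred_sum => i _; apply: span_gen.
by exists (ext_gen k i), (f i); split=> //; exists i.
Qed.

Definition ext_proj (d : int) (x : E) : E :=
  [ffun A : {set 'I_n} => if #|A|%:Z == d then x A else 0].

Lemma ext_proj_is_additive d : zmod_morphism (ext_proj d).
Proof.
by move=> x y; apply/ffunP => A; rewrite !ffunE; case: ifP; rewrite ?subr0.
Qed.

HB.instance Definition _ d :=
  GRing.isZmodMorphism.Build E E (ext_proj d) (ext_proj_is_additive d).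

Lemma ext_projM d f (x y : E) : ext_deg f y ->
  ext_proj d (x * y) = ext_proj (d - f) x * y.
Proof.
move=> fy; apply/ffunP => A; rewrite ffunE [RHS]ffunE -[if _ then _ else _]/(_).
case: ifP => dA.
  rewrite ffunE; apply: eq_bigr => B sBA; rewrite ffunE; congr (_ * _).
  have [->|y0] := eqVneq (y (A :\: B)) 0; first by rewrite !mulr0.
  rewrite ifT //; move: dA (fy _ y0); rewrite -(cardsID B A) (setIidPr sBA); lia.
rewrite big1 // => B sBA; rewrite ffunE.
have [->|y0] := eqVneq (y (A :\: B)) 0; first by rewrite !mulr0.
rewrite ifF ?mul0r ?mulr0 //.
by move: dA (fy _ y0); rewrite -(cardsID B A) (setIidPr sBA); lia.
Qed.

Section HomogeneousRows.
Variables (b : nat) (deg : 'I_b -> int).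
Local Notation F := 'rV[E]_b.

(** The component of degree d in the graded free module whose q-th basis vector
    has degree deg q. *)
Definition hrow d (u : F) : F := \row_q ext_proj (d - deg q) (u 0 q).

Lemma hrow_deg d u q : ext_deg (d - deg q) (hrow d u 0 q).
Proof. by move=> A; rewrite mxE ffunE; case: ifP => [/eqP //|]; rewrite eqxx. Qed.

Lemma hrow_sum : exists s : seq int, forall u, u = \sum_(d <- s) hrow d u.
Proof.
exists (undup [seq deg q.1 + #|q.2 : {set 'I_n}|%:Z | q : 'I_b * {set 'I_n}]) => u.
apply/rowP => q; rewrite summxE; apply/ffunP => A; rewrite sum_ffunE.
rewrite (bigD1_seq (deg q + #|A|%:Z)) ?undup_uniq //=; last first.
  by rewrite mem_undup; apply/imageP; exists (q, A).
rewrite big1 => [|d ned]; first by rewrite addr0 mxE ffunE addrAC subrr add0r eqxx.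
by rewrite mxE ffunE ifF //; apply: contraNF ned => /eqP ->; rewrite addrC subrK.
Qed.

Definition graded (L : F -> Prop) := forall d u, L u -> L (hrow d u).

Variable L : F -> Prop.
Hypothesis L_gr : graded L.

(** F has finite dimension over k; so L is finitely generated already over k. *)
Lemma fin_gen : exists r (v : 'I_r -> F), (forall i, L (v i)) /\
  forall u, L u -> exists a : 'I_r -> k, u = \sum_i (a i)%:A *: v i.
Proof.
pose T := ('I_b * {set 'I_n})%type.
pose flat (u : F) : 'rV[k]_#|{: T}| := \row_i u 0 (enum_val i).1 (enum_val i).2.
have flat_inj : injective flat.
  move=> u v /rowP uv; apply/rowP => q; apply/ffunP => A.
  by have := uv (enum_rank (q, A)); rewrite !mxE enum_rankK.
have flatD u v : flat (u + v) = flat u + flat v.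
  by apply/rowP => i; rewrite !mxE ffunE.
have flatZ a u : flat (a%:A *: u) = a *: flat u.
  by apply/rowP => i; rewrite !mxE -scalerAl mul1r ffunE.
have flat0 : flat 0 = 0 by apply/rowP => i; rewrite !mxE ffunE.
have [r [A [PA Asp]]] := fd_span (fun w => exists u, L u /\ w = flat u).
have [v Hv] := choice PA; exists r, v; split=> [i|u Lu]; first by case: (Hv i).
have [|a Ha] := Asp (flat u); first by exists u.
exists (fun i => a 0 i); apply: flat_inj; rewrite Ha mulmx_sum_row.
rewrite (big_morph flat flatD flat0); apply: eq_bigr => i _.
by case: (Hv i) => _ ->; rewrite flatZ.
Qed.

Definition hom_gens N (deg' : 'I_N -> int) (D : 'M[E]_(N, b)) :=
  [/\ forall p q, ext_deg (deg' p - deg q) (D p q), forall p, L (row p D) &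
      forall u, L u -> exists v, u = v *m D].

Lemma hom_gens_ex : exists N deg' D, @hom_gens N deg' D.
Proof.
have [s Hs] := hrow_sum; have [r [v [Lv Hv]]] := fin_gen.
pose T := ('I_r * 'I_(size s))%type.
pose el (p : 'I_#|{: T}|) : T := enum_val p.
exists #|{: T}|, (fun p => s`_(el p).2).
exists (\matrix_(p, q) hrow s`_(el p).2 (v (el p).1) 0 q).
have rowE p : row p (\matrix_(p, q) hrow s`_(el p).2 (v (el p).1) 0 q) =
    hrow s`_(el p).2 (v (el p).1).
  by apply/rowP => q; rewrite !mxE.
split=> [p q|p|u Lu].
- by rewrite mxE; apply: hrow_deg.
- by rewrite rowE; apply: L_gr.
have [a ->] := Hv u Lu; exists (\row_p (a (el p).1)%:A).
rewrite mulmx_sum_row; under [RHS]eq_bigr => p _ do rewrite rowE mxE.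
rewrite -(big_enum_val (A := {: T}) (fun t : T => (a t.1)%:A *: hrow s`_t.2 (v t.1))) /=.
rewrite -(pair_bigA _ (fun i (j : 'I_(size s)) => (a i)%:A *: hrow s`_j (v i))) /=.
apply: eq_bigr => i _; rewrite -scaler_sumr; congr (_ *: _).
by rewrite {1}[v i]Hs (big_nth 0) big_mkord.
Qed.

(** A homogeneous generating family of least size is minimal: a relation with a
    unit coefficient would allow one generator to be dropped. *)
Lemma min_gens : exists N deg' D, @hom_gens N deg' D /\
  forall v : 'rV[E]_N, v *m D = 0 -> forall p, v 0 p set0 = 0.
Proof.
pose Q N := `[< exists deg' D, @hom_gens N deg' D >].
have exQ : exists N, Q N.
  by have [N [deg' [D HD]]] := hom_gens_ex; exists N; apply/asboolP; exists deg', D.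
case: (ex_minnP exQ) => N /asboolP[deg' [D [D1 D2 D3]]] N_min.
exists N, deg', D; split=> // v vD p; have [//|vp0] := eqVneq (v 0 p set0) 0; exfalso.
case: N => [|N'] in deg' D D1 D2 D3 N_min v vD p vp0 *; first by case: p vp0.
suff : (N'.+1 <= N')%N by rewrite ltnn.
apply: N_min; apply/asboolP; exists (fun i => deg' (lift p i)), (row' p D).
split=> [i q|i|u Lu]; first by rewrite mxE.
  suff -> : row i (row' p D) = row (lift p i) D by [].
  by apply/rowP => q; rewrite !mxE.
have [w ->] := D3 u Lu.
have expand (x : 'rV[E]_N'.+1) : x *m D = x 0 p *: row p D + (col' p x) *m row' p D.
  apply/rowP => q; rewrite !mxE (bigD1_ord p) //=; congr (_ + _).
  by apply: eq_bigr => i _; rewrite !mxE.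
have [y [yv _]] := ext_unit vp0; move: vD; rewrite expand => vD.
have rowp : row p D = (- y *: col' p v) *m row' p D.
  move/(congr1 (fun u => y *: u)): vD; rewrite scalerDr scalerA yv scale1r scaler0.
  by move/eqP; rewrite addr_eq0 => /eqP ->; rewrite -scalemxAl scaleNr.
by exists (w 0 p *: (- y *: col' p v) + col' p w);
   rewrite expand {1}rowp mulmxDl !scalemxAl.
Qed.

End HomogeneousRows.

Lemma hrow_mul b b' deg deg' (D : 'M[E]_(b', b)) d (v : 'rV[E]_b') :
  (forall p q, ext_deg (deg' p - deg q) (D p q)) ->
  hrow deg d (v *m D) = hrow deg' d v *m D.
Proof.
move=> hD; apply/rowP => q; rewrite !mxE raddf_sum; apply: eq_bigr => p _.
by rewrite mxE [LHS](ext_projM _ _ (hD p q)) opprB addrA subrK.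
Qed.

(** A graded free module with a graded submodule of relations inside E_+ F; iterating
    the minimal cover of the relations builds a minimal resolution. *)
Record syzygy := Syzygy {
  sz_rank : nat;
  sz_deg : 'I_sz_rank -> int;
  sz_rel : 'rV[E]_sz_rank -> Prop;
  sz_sub : submod sz_rel;
  sz_gr : graded sz_deg sz_rel;
  sz_min : forall u, sz_rel u -> forall q, u 0 q set0 = 0 }.

Record cover (s : syzygy) := Cover {
  cv_rank : nat;
  cv_deg : 'I_cv_rank -> int;
  cv_mx : 'M[E]_(cv_rank, sz_rank s);
  cv_hom : forall p q, ext_deg (cv_deg p - sz_deg q) (cv_mx p q);
  cv_im : forall u, sz_rel u <-> exists v, u = v *m cv_mx;
  cv_min : forall v : 'rV[E]_cv_rank, v *m cv_mx = 0 -> forall p, v 0 p set0 = 0 }.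

Lemma cover_ex s : exists c : cover s, True.
Proof.
have [N [deg' [D [[D1 D2 D3] D4]]]] := min_gens (@sz_gr s).
have im u : sz_rel u <-> exists v, u = v *m D.
  split=> [|[v ->]]; first exact: D3.
  rewrite mulmx_sum_row; apply: submod_sum (sz_sub s) _ => p _.
  by case: (sz_sub s) => _ _; apply.
by exists (Cover D1 im D4).
Qed.

Definition the_cover s := projT1 (cid (cover_ex s)).

Lemma ker_graded s (c : cover s) :
  graded (@cv_deg s c) (fun v : 'rV[E]_(cv_rank c) => v *m cv_mx c = 0).
Proof.
move=> d v vD; rewrite -(hrow_mul _ _ (@cv_hom s c)) vD.
by apply/rowP => q; rewrite !mxE raddf0.
Qed.

Definition next s : syzygy :=
  Syzygy (ker_submod (cv_mx (the_cover s))) (@ker_graded s (the_cover s))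
         (@cv_min s (the_cover s)).

Section EdgeQuotient.
Variable G : sgraph n.

Definition ext_pi (x : E^o) : ext_edge_quot k G :=
  @quotmod_pi E E^o (ideal_span (edge_monomials (@ext_gen k n) G)) x.

Lemma ext_pi_is_linear : linear ext_pi.
Proof. by move=> a x y; rewrite /ext_pi quotmod_piD quotmod_piZ. Qed.

HB.instance Definition _ :=
  GRing.isLinear.Build E E^o (ext_edge_quot k G) *:%R ext_pi ext_pi_is_linear.

Lemma ext_pi_surj m : exists x, m = ext_pi x.
Proof. exact: quotmod_piP. Qed.

Lemma ext_pi_eq0 x : ext_pi x = 0 <-> ext_edge_ideal G x.
Proof. by rewrite -ext_edge_idealP; apply: quotmod_pi_eq0. Qed.

Lemma indep_edge_quot t m (z : 'I_m -> 'X_{1..n} -> E^o) :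
  indep t (@ext_edge_ideal k n G : E^o -> Prop) z <->
  indep t (fun x => x = 0) (fun j => ext_pi \o z j).
Proof.
apply: (@indep_pull _ _ _ _ ext_pi _ (fun x => x = 0)) => x; first exact: ext_pi_surj.
by rewrite ext_pi_eq0.
Qed.

End EdgeQuotient.

Lemma resolution_ex (G : sgraph n) : exists b deg g D,
  @min_graded_free_resolution k n (ext_edge_quot k G) (@ext_edge_quot_deg k n G)
     b deg g D.
Proof.
pose L0 (u : 'rV[E]_1) := ext_edge_ideal G (u 0 0).
have sub0 : submod L0.
  split=> [A _|u v Iu Iv A iA|a u Iu]; rewrite /L0.
  - by rewrite mxE ffunE.
  - by rewrite mxE ffunE Iu ?Iv ?addr0.
  - by rewrite mxE; apply/ext_edge_idealP; apply: span_scale; apply/ext_edge_idealP.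
have gr0 : graded (fun=> 0) L0.
  by move=> d u Iu A iA; rewrite mxE ffunE Iu // if_same.
have min0 u : L0 u -> forall q, u 0 q set0 = 0.
  by move=> Iu q; rewrite (ord1 q) Iu // => i j; rewrite inE.
pose S := fun i => iter i next (Syzygy sub0 gr0 min0).
exists (fun i => sz_rank (S i)), (fun i => @sz_deg (S i)).
exists (fun=> ext_pi G 1), (fun i => cv_mx (the_cover (S i))).
have sum1 (u : 'rV[E]_1) : \sum_q u 0 q *: ext_pi G 1 = ext_pi G (u 0 0).
  by rewrite big_ord1 -linearZ; congr (ext_pi G _); exact: mulr1.
split=> /=.
- move=> q; exists 1 => // A; rewrite ffunE.
  by have [->|_] := eqVneq A set0; rewrite ?cards0 ?eqxx.
- by move=> i; apply: cv_hom.
- move=> i p q; apply/aug_idealP.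
  have : sz_rel (row p (cv_mx (the_cover (S i)))).
    by apply/cv_im; exists (delta_mx 0 p); rewrite rowE.
  by move/sz_min => /(_ q); rewrite mxE.
- by move=> m; have [x ->] := ext_pi_surj m; exists (\row__ x); rewrite sum1 mxE.
- by move=> u; rewrite sum1 ext_pi_eq0; apply: (cv_im (the_cover (S 0%N))).
- by move=> i u; apply: (cv_im (the_cover (S i.+1))).
Qed.

End Existence.

(** * Growth of the Betti numbers of a bipartite edge ideal *)

Section CycleFamily.
Variables (k : fieldType) (n : nat) (G : sgraph n) (A : {set 'I_n}) (pb : 'I_n -> 'I_n).
Local Notation E := (exterior k n).
Local Notation e := (@ext_gen k n).
Local Notation mon := 'X_{1..n}.
Implicit Types (mu c : mon) (s : seq 'I_n) (C : {set 'I_n}).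

(* The pairs {a, pb a}, for a in A, are disjoint, and G has no edge between two of
   them: in the application they form an induced matching. *)
Hypothesis pbA : forall a, a \in A -> pb a \notin A.
Hypothesis pb_inj : {in A &, injective pb}.
Hypothesis indepA : forall a a', a \in A -> a' \in A -> ~~ G a a'.
Hypothesis indep_pb : forall a a', a \in A -> a' \in A -> ~~ G (pb a) (pb a').
Hypothesis priv : forall a a', a \in A -> a' \in A -> G a (pb a') -> a = a'.

(** dcar for N = E^o, restated with the product of E, whose lemmas it uses. *)
Definition dE (v : mon -> E) mu : E := \sum_i e i * v (mu + U_(i))%MM.

(** If e_i and y_i have weight i, the shift of mu gives both terms the same weight; with
    it the residue anticommutes with the Cartan differential. *)
Definition residue a b (z : mon -> E) mu : E :=
  contr a (z mu) - contr b (z (mu + U_(a) - U_(b))%MM).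

Lemma residue_dE a b (v : mon -> E) mu : (0 < mu b)%N ->
  residue a b (dE v) mu = - dE (residue a b v) mu.
Proof.
move=> mub; rewrite /residue /dE !raddf_sum /= -big_split /=.
have eb i : (mu + U_(a) - U_(b) + U_(i) = mu + U_(i) + U_(a) - U_(b))%MM.
  by apply/mnmP => l; rewrite !(mnmDE, mnmBE, mnm1E); case: (eqVneq b l) => [<-|_] /=; lia.
have ac (p q r t : E) : p - q - (r - t) = (p - r) - (q - t).
  by rewrite !opprB addrACA [RHS]addrACA; congr (_ + _); rewrite addrC.
under eq_bigr => i _ do rewrite !contr_gen eb ac -mulrBr.
rewrite !big_split /= !sumrN -!big_mkcond !big_pred1_eq -eb.
have -> : (mu + U_(a) - U_(b) + U_(b) = mu + U_(a))%MM.
  by apply/mnmP => l; rewrite !(mnmDE, mnmBE, mnm1E); case: (eqVneq b l) => [<-|_] /=; lia.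
by rewrite subrr add0r.
Qed.

Definition residues s z := foldr (fun a => residue a (pb a)) z s.

Definition pos_on s mu := forall a, a \in s -> (0 < mu (pb a))%N.

Lemma pos_on_shift a s mu : uniq (a :: s) -> {subset a :: s <= A} ->
  pos_on (a :: s) mu -> pos_on s (mu + U_(a) - U_(pb a))%MM.
Proof.
move=> /= /andP[nas _] sA mupos a' a's; rewrite mnmBE mnmDE !mnm1E.
have ne : pb a != pb a'.
  apply: contraNneq nas => /pb_inj -> //; apply: sA; rewrite inE ?eqxx //.
  by rewrite a's orbT.
rewrite (negPf ne) subn0 ltn_addr //; apply: mupos; by rewrite inE a's orbT.
Qed.

Lemma residues_dE s v mu : uniq s -> {subset s <= A} -> pos_on s mu ->
  residues s (dE v) mu = (-1) ^+ size s *: dE (residues s v) mu.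
Proof.
elim: s mu => [|a s IH] mu us sA mupos /=; first by rewrite scale1r.
have sA' : {subset s <= A} by move=> x xs; apply: sA; rewrite inE xs orbT.
have [_ us'] := andP us.
have e1 : residue a (pb a) (residues s (dE v)) mu =
          (-1) ^+ size s *: residue a (pb a) (dE (residues s v)) mu.
  have p1 : pos_on s mu by move=> x xs; apply: mupos; rewrite inE xs orbT.
  have p2 := pos_on_shift us sA mupos.
  by rewrite /residue !IH // !contrZ scalerBr.
rewrite e1 residue_dE; last by apply: mupos; rewrite inE eqxx.
by rewrite exprS mulN1r scaleNr scalerN.
Qed.

Lemma dE_set0 (v : mon -> E) mu : dE v mu set0 = 0.
Proof. by rewrite sum_ffunE big1 // => i _; exact: gen_mul_set0. Qed.

(** C has at most one vertex in each pair {a, pb a} with a outside of s, and no other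
    vertex.  The residues along s complete such a C to independent sets. *)
Definition transversal_off s C :=
  (forall x, x \in C -> exists a, [/\ a \in A, a \notin s & x = a \/ x = pb a]) /\
  (forall a, a \in A -> a \in C -> pb a \notin C).

Lemma transversal_cons a s C x : a \in A -> x = a \/ x = pb a ->
  transversal_off (a :: s) C -> a \notin s -> transversal_off s (x |: C).
Proof.
move=> aA xa [H1 H2] as_; split=> [y|a' a'A].
  rewrite !inE => /orP[/eqP ->|/H1[a' [a'A]]]; first by exists a.
  by rewrite inE negb_or => /andP[_ a's] ya'; exists a'.
have nC y : y = a \/ y = pb a -> y \notin C.
  move=> ya; apply/negP => /H1[a'' [a''A]]; rewrite inE negb_or => /andP[ne _].
  case: ya => -> [] ey.
  - by rewrite ey eqxx in ne.
  - by have := pbA a''A; rewrite -ey aA.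
  - by have := pbA aA; rewrite ey a''A.
  - by rewrite (pb_inj aA a''A ey) eqxx in ne.
rewrite !inE !negb_or => /orP[/eqP ea'|a'C].
  move: ea'; case: xa => -> ea'; last by have := pbA aA; rewrite -ea' a'A.
  by rewrite ea' (nC (pb a)) ?andbT; [apply: contraNneq (pbA aA) => ->| right].
rewrite H2 // andbT; apply/eqP => ea'.
case: xa => ex; first by have := pbA a'A; rewrite ea' ex aA.
have := nC a (or_introl erefl); rewrite -(pb_inj a'A aA) ?a'C //.
by rewrite ea'.
Qed.

Lemma transversal_indep C : transversal_off [::] C -> indep_set G C.
Proof.
move=> [H1 H2] x y xC yC; apply/negP => Gxy.
have [a [aA _ xa]] := H1 x xC; have [a' [a'A _ ya']] := H1 y yC.
case: xa ya' => ex [] ey; subst x y.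
- by have := indepA aA a'A; rewrite Gxy.
- by move: yC; rewrite -(priv aA a'A Gxy); apply/negP/H2.
- by rewrite adj_sym in Gxy; move: xC; rewrite -(priv a'A aA Gxy); apply/negP/H2.
- by have := indep_pb aA a'A; rewrite Gxy.
Qed.

Lemma contr_eq0 a (x : E) C :
  (a \notin C -> x (a |: C) = 0) -> contr a x C = 0.
Proof. by move=> H; rewrite contrE; case: ifPn => // /H ->; rewrite mulr0. Qed.

Lemma mdeg_shift mu a b : (0 < mu b)%N -> mdeg (mu + U_(a) - U_(b))%MM = mdeg mu.
Proof.
move=> mub; have : (mu + U_(a) - U_(b) + U_(b) = mu + U_(a))%MM.
  by apply/mnmP => l; rewrite !(mnmDE, mnmBE, mnm1E); case: (eqVneq b l) => [<-|_] /=; lia.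
by move/(congr1 (@mdeg n)); rewrite !mdegD !mdeg1 => /addIn.
Qed.

(** The value at C of the residues along s involves the chain at sets made of C and
    one vertex of each pair of s only.  These are independent, and a chain in the
    edge ideal vanishes on them. *)
Lemma residues_ideal t s (z : mon -> E) mu C :
  (forall mu, mdeg mu = t -> ext_edge_ideal G (z mu)) ->
  uniq s -> {subset s <= A} -> pos_on s mu -> mdeg mu = t ->
  transversal_off s C -> residues s z mu C = 0.
Proof.
move=> Iz; elim: s mu C => [|a s IH] mu C us sA mupos tmu tC /=.
  by apply: Iz => //; apply: transversal_indep.
have sA' : {subset s <= A} by move=> x xs; apply: sA; rewrite inE xs orbT.
have /andP[nas us'] := us; have aA : a \in A by apply: sA; rewrite inE eqxx.
rewrite /residue extB !contr_eq0 ?subr0 // => _.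
  apply: IH => //; first exact: pos_on_shift.
    by rewrite mdeg_shift //; apply: mupos; rewrite inE eqxx.
  by apply: (transversal_cons aA) tC nas; right.
apply: IH => //; first by move=> x xs; apply: mupos; rewrite inE xs orbT.
by apply: (transversal_cons aA) tC nas; left.
Qed.

(** The chain e_A (x) y^(c). *)
Definition single c mu : E := if mu == c then ext_mon k A else 0.

Lemma residues_single0 c s mu C x : x \in C -> x \notin A ->
  residues s (single c) mu C = 0.
Proof.
elim: s mu C => [|a s IH] mu C xC xA /=.
  rewrite /single; case: eqP => _; last by rewrite ffunE.
  by rewrite ffunE; case: eqP xA => // <-; rewrite xC.
by rewrite /residue extB !contr_eq0 ?subr0 // => _; apply: IH => //; rewrite inE xC orbT.
Qed.

(** Of the 2 ^ |s| terms of the residue only the one that contracts all the vertices a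
    of s survives, as A contains no pb a. *)
Lemma residues_single s C : uniq s -> {subset s <= A} ->
  [set x in s] :|: C = A -> (forall x, x \in s -> x \notin C) ->
  exists2 eps : k, eps != 0 & forall c mu,
    residues s (single c) mu C = eps * (mu == c)%:R.
Proof.
elim: s C => [|a s IH] C us sA eA sC.
  exists 1; rewrite ?oner_eq0 // => c mu; rewrite mul1r /= /single.
  have -> : C = A by rewrite -eA; apply/setP => x; rewrite !inE.
  by case: eqP => _; rewrite ffunE ?eqxx.
have sA' : {subset s <= A} by move=> x xs; apply: sA; rewrite inE xs orbT.
have /andP[nas us'] := us; have aA : a \in A by apply: sA; rewrite inE eqxx.
have [||||eps eps0 Heps] := IH (a |: C) => //.
- by rewrite -eA; apply/setP => x; rewrite !inE; case: (x == a); rewrite ?orbT.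
- move=> x xs; rewrite !inE negb_or sC ?andbT; last by rewrite inE xs orbT.
  by apply: contraNneq nas => <-.
have aC : a \notin C by apply: sC; rewrite inE eqxx.
exists ((-1) ^+ ext_inv [set a] C * eps); first by rewrite mulf_neq0 ?signr_eq0.
move=> c mu /=; rewrite /residue extB contrE (negPf aC) Heps mulrA.
rewrite contr_eq0 ?subr0 // => _.
by apply: (@residues_single0 c s _ _ (pb a)); rewrite ?inE ?eqxx // pbA.
Qed.

Lemma residues_lincomb s m (a : 'rV[k]_m) (z : 'I_m -> mon -> E) mu :
  residues s (fun mu => \sum_j a 0 j *: z j mu) mu = \sum_j a 0 j *: residues s (z j) mu.
Proof.
elim: s mu => [|i s IH] mu /=.
  by [].
rewrite /residue !IH !raddf_sum -big_split; apply: eq_bigr => j _ /=.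
by rewrite !contrZ scalerBr.
Qed.

Lemma residues_sub s (z z' : mon -> E) mu :
  residues s (fun mu => z mu - z' mu) mu = residues s z mu - residues s z' mu.
Proof.
elim: s mu => [//|i s IH] mu /=; rewrite /residue !IH !raddfB /=.
by rewrite addrACA.
Qed.

(** The classes of e_A (x) y^(c) in Tor^E(E/I, k) are independent: the iterated
    residue along the matching is a functional on the complex that vanishes on
    boundaries.  This is the pairing of the facet A of the independence complex
    with the cross-polytope spanned by the pairs {a, pb a}. *)
Lemma indep_single t m (c : 'I_m -> mon) : injective c ->
  (forall j, mdeg (c j) = t) ->
  (forall j a, a \in A -> (0 < c j (pb a))%N) ->
  (forall j i, (0 < c j i)%N -> i \in A \/ exists2 a, a \in A & G a i) ->
  indep t (@ext_edge_ideal k n G : E^o -> Prop) (fun j => single (c j)).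
Proof.
move=> c_inj c_deg c_pos c_supp; split=> [j mu tmu C iC|a [v Hv]].
  rewrite sum_ffunE big1 // => i _; rewrite /single.
  case: eqP => [emu|_]; last by rewrite scaler0 ffunE.
  (* It is a cycle, as every vertex i of c is in A or adjacent to A. *)
  change ((e i * ext_mon k A) C = 0).
  have [iA|iA] := boolP (i \in A); first by rewrite gen_mon0 // ffunE.
  have [|iA'|[l lA Gli]] := c_supp j i; first by rewrite -emu mnmDE mnm1E eqxx addn1.
    by rewrite iA' in iA.
  rewrite gen_mon // !ffunE; case: eqP => [eC|_]; last by rewrite mulr0.
  by have := iC l i; rewrite eC !inE lA eqxx orbT Gli => /(_ isT isT).
apply/rowP => j; rewrite mxE; pose s := enum A.
have sA : {subset s <= A} by move=> x; rewrite mem_enum.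
have [||||eps eps0 Heps] := @residues_single s set0 => //; first exact: enum_uniq.
- by apply/setP => x; rewrite !inE mem_enum orbF.
- by move=> x _; rewrite inE.
have c_pos' : pos_on s (c j) by move=> x /sA; apply: c_pos.
have Hv' nu : mdeg nu = t ->
    ext_edge_ideal G ((\sum_j a 0 j *: single (c j) nu) - dE v nu).
  move=> tnu; rewrite (_ : \sum_j _ = lincomb a (fun j => single (c j) : mon -> E^o) nu).
    exact: Hv.
  by apply: eq_bigr => l _; rewrite -[RHS]scalerAl mul1r.
have := @residues_ideal t s (fun mu => (\sum_j a 0 j *: single (c j) mu) - dE v mu)
          (c j) set0 Hv' (enum_uniq _) sA c_pos' (c_deg j).
rewrite residues_sub extB residues_dE ?enum_uniq //.
rewrite [X in _ - X](_ : _ = 0); last by rewrite ffunE dE_set0 mulr0.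
rewrite subr0 residues_lincomb sum_ffunE (bigD1 j) //= big1 ?addr0.
  rewrite ffunE Heps eqxx mulr1 => H; apply/eqP.
  have tr : transversal_off s set0 by split=> x; rewrite !inE.
  by have /eqP := H tr; rewrite mulf_eq0 (negPf eps0) orbF.
move=> i neij; rewrite ffunE Heps (inj_eq c_inj) eq_sym (negPf neij).
by rewrite !mulr0.
Qed.

End CycleFamily.

(** Minimality gives each a in A a private neighbour pb a, without which A minus a
    would still dominate B. *)
Lemma min_dominating n (G : sgraph n) (B : {set 'I_n}) :
  (forall b, b \in B -> exists2 a, a \notin B & G a b) ->
  exists (A : {set 'I_n}) (pb : 'I_n -> 'I_n),
    [/\ forall a, a \in A -> a \notin B,
        forall b, b \in B -> exists2 a, a \in A & G a b,
        forall a, a \in A -> pb a \in B /\ G a (pb a) &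
        forall a a', a \in A -> a' \in A -> G a (pb a') -> a = a'].
Proof.
move=> domB; pose P (X : {set 'I_n}) := [forall b in B, exists a in X, G a b].
have PB : P (~: B).
  apply/forall_inP => b /domB[a aB Gab]; apply/exists_inP; exists a => //.
  by rewrite inE.
have [A /minsetP[/forall_inP PA A_min] sAB] := minset_exists PB.
have priv a : exists b, a \in A -> [/\ b \in B, G a b &
    forall a', a' \in A -> G a' b -> a' = a].
  have [aA|] := boolP (a \in A); last by exists a.
  have : ~~ P (A :\ a).
    apply/negP => PAa; have := A_min _ PAa (subsetDl _ _).
    by move/setP/(_ a); rewrite !inE eqxx aA.
  rewrite negb_forall_in => /exists_inP[b bB]; rewrite negb_exists_in => /forall_inP nG.
  have uniq_a a' : a' \in A -> G a' b -> a' = a.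
    move=> a'A Gb; apply/eqP; apply: contraTT Gb => ne; apply: nG.
    by rewrite !inE ne.
  exists b => _; split=> //; have /exists_inP[a' a'A Gb] := PA b bB.
  by rewrite -(uniq_a a').
have [pb Hpb] := choice priv; exists A, pb; split.
- by move=> a /(subsetP sAB); rewrite inE.
- by move=> b /PA/exists_inP.
- by move=> a /Hpb[].
- by move=> a a' aA a'A Gab; have [_ _] := Hpb a' a'A; apply.
Qed.

Section BettiGrowth.
Variables (k : fieldType) (n : nat) (G : sgraph n) (B : {set 'I_n}).
Local Notation E := (exterior k n).
Local Notation mon := 'X_{1..n}.

Hypothesis B_edge : forall i j, G i j -> (i \in B) != (j \in B).
Hypothesis no_iso : no_isolated G.
Hypothesis B_gt0 : (0 < #|B|)%N.

(** The chains e_A (x) y^(c) with A a minimal set dominating B: the exponents at the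
    vertices of B range freely over 0, .., t, on top of the exponents 1 at the private
    neighbours which the independence of the classes requires; the exponent of a
    vertex a0 of A brings the degree to a fixed value. *)
Lemma indep_family : exists2 C, (C <= n)%N & forall t,
  exists z : 'I_(t.+1 ^ #|B|) -> mon -> E^o,
    indep (C + #|B| * t) (@ext_edge_ideal k n G : E^o -> Prop) z.
Proof.
have domB b : b \in B -> exists2 a, a \notin B & G a b.
  move=> bB; have [a Gba] := no_iso b; exists a; last by rewrite adj_sym.
  by have := B_edge Gba; rewrite bB; case: (a \in B).
have [A [pb [AB domA Hpb priv]]] := min_dominating domB.
have [a0 a0A] : exists a, a \in A.
  by case/card_gt0P: B_gt0 => b /domA[a aA _]; exists a.
exists #|A|; first by rewrite -[leqRHS](card_ord n) max_card.
move=> t.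
pose S := {i | i \in B}; pose T := {ffun S -> 'I_t.+1}.
have cardT : #|{: T}| = (t.+1 ^ #|B|)%N by rewrite card_ffun card_ord card_sig.
pose c (f : T) : mon := (\sum_(a in A) U_(pb a) + \sum_s U_(val s) *+ f s +
  U_(a0) *+ (#|B| * t - \sum_s f s))%MM.
have sum_f (f : T) : (\sum_s f s <= #|B| * t)%N.
  have -> : #|B| = #|{: S}| by rewrite card_sig.
  by rewrite -sum_nat_const; apply: leq_sum => s _; rewrite -ltnS.
have c_deg f : mdeg (c f) = (#|A| + #|B| * t)%N.
  rewrite !mdegD mdegMn mdeg1 mul1n mdeg_sum mdeg_sum -addnA; congr (_ + _)%N.
    by rewrite -sum1_card; apply: eq_bigr => a _; rewrite mdeg1.
  rewrite -[RHS](subnKC (sum_f f)); congr (_ + _)%N.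
  by apply: eq_bigr => s _; rewrite mdegMn mdeg1 mul1n.
have cB (f : T) (s : S) : c f (val s) =
    (\sum_(a in A) (pb a == val s) + f s)%N.
  rewrite /c !mnmDE mulmnE mnm1E.
  have -> : (a0 == val s) = false.
    by apply: contraNF (AB _ a0A) => /eqP ->; apply: valP.
  rewrite mul0n addn0 !mnm_sumE; congr (_ + _)%N.
    by apply: eq_bigr => a _; rewrite mnm1E.
  rewrite (bigD1 s) //= mulmnE mnm1E eqxx mul1n big1 ?addn0 // => s' ne.
  by rewrite mulmnE mnm1E (inj_eq val_inj) (negPf ne).
have c_inj : injective c.
  move=> f g efg; apply/ffunP => s; apply: val_inj.
  by have := cB f s; rewrite efg cB => /addnI.
pose el (j : 'I_(t.+1 ^ #|B|)) : T := enum_val (cast_ord (esym cardT) j).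
have el_inj : injective el by move=> i j /enum_val_inj/cast_ord_inj.
exists (fun j => single k A (c (el j))).
apply: (@indep_single k n G A pb) => //.
- move=> a aA; apply: contraL (Hpb a aA).1; exact: AB.
- by move=> a a' aA a'A epb; apply: priv => //; rewrite -epb; case: (Hpb a aA).
- move=> a a' aA a'A; apply/negP => /B_edge.
  by rewrite (negPf (AB _ aA)) (negPf (AB _ a'A)).
- move=> a a' aA a'A; apply/negP => /B_edge.
  by rewrite (Hpb a aA).1 (Hpb a' a'A).1.
- exact: inj_comp.
- by move=> j a aA; rewrite /c !mnmDE mnm_sumE (bigD1 a) //= mnm1E eqxx.
- move=> j i; rewrite /c !mnmDE !mnm_sumE => ci.
  have [iB|iB] := boolP (i \in B); first by right; apply: domA.
  left; apply: contraLR ci => iA; rewrite -leqNgt leqn0 !addn_eq0.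
  rewrite mulmnE mnm1E.
  have -> : (a0 == i) = false by apply: contraNF iA => /eqP <-.
  rewrite mul0n eqxx andbT; apply/andP; split; apply/eqP; apply: big1.
    move=> a aA; rewrite mnm1E; case: eqP => // epb.
    by rewrite -epb (Hpb a aA).1 in iB.
  move=> s _; rewrite mulmnE mnm1E; case: eqP => // es.
  by move: iB; rewrite -es (valP s).
Qed.

Lemma betti_growth b deg g D :
  @min_graded_free_resolution k n (ext_edge_quot k G) (@ext_edge_quot_deg k n G)
     b deg g D ->
  exists2 C, (C <= n)%N & forall t, (t.+1 ^ #|B| <= b (C + #|B| * t))%N.
Proof.
move=> res; have [C Cn HC] := indep_family; exists C => // t; have [z iz] := HC t.
have [_ _ _ surj ex0 exS] := res.
exact: (indep_leq_betti surj ex0 exS ((indep_edge_quot _ _ _).1 iz)).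
Qed.

End BettiGrowth.

Section ComplexityLowerBound.
Variables (K : realType) (k : fieldType) (n : nat) (G : sgraph n) (B : {set 'I_n}).
Hypothesis B_edge : forall i j, G i j -> (i \in B) != (j \in B).
Hypothesis no_iso : no_isolated G.
Hypothesis B_gt0 : (0 < #|B|)%N.

(** The Betti numbers are chosen among the rank sequences of minimal resolutions; as
    there is a resolution, the choice is not the default value. *)
Lemma ext_bettiP : exists deg g D, @min_graded_free_resolution k n
  (ext_edge_quot k G) (@ext_edge_quot_deg k n G)
  (ext_betti (@ext_edge_quot_deg k n G)) deg g D.
Proof.
rewrite /ext_betti; case: xgetP => [b _ //|nob].
have [b [deg [g [D res]]]] := resolution_ex k G.
by exfalso; apply: (nob b); exists deg, g, D.
Qed.

(** Along the arithmetic progression C + |B| t the Betti numbers grow at least like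
    t ^ |B|, which no bound alpha i ^ (c - 1) with c <= |B| allows for large t. *)
Lemma cx_lower : ((#|B|%:R + 1)%:E <= cxE K k G)%E.
Proof.
apply: le_ereal_inf_tmp => _ [c [alpha Hc] <-]; rewrite lee_fin.
have [deg [g [D res]]] := ext_bettiP.
have [C Cn HC] := betti_growth B_edge no_iso B_gt0 res.
set b := ext_betti _ in Hc HC.
have -> : #|B|%:R + 1 = (#|B|%:Z + 1)%:~R :> K by rewrite intrD.
rewrite ler_int; apply: contraT; rewrite -ltNge => c_small.
have n_gt0 : (0 < n)%N.
  by case/card_gt0P: B_gt0 => i _; apply: leq_ltn_trans (ltn_ord i).
have [t t_gt0 ht] : exists2 t : nat, (0 < t)%N & `|alpha| * n%:R ^+ #|B|.-1 < t%:R.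
  exists (Num.bound (`|alpha| * n%:R ^+ #|B|.-1)).+1 => //.
  apply: lt_trans (archi_boundP _) _; last by rewrite ltr_nat.
  by rewrite mulr_ge0 // exprn_ge0.
pose i := (C + #|B| * t)%N.
have i_gt0 : (0 < i)%N by rewrite addn_gt0 muln_gt0 B_gt0 t_gt0 orbT.
have i_le : (i <= n * t.+1)%N.
  rewrite mulnS leq_add // leq_mul2r; apply/orP; right.
  by rewrite -[leqRHS](card_ord n) max_card.
have := Hc i i_gt0; rewrite leNgt => /negP[].
have ce : (c - 1 <= #|B|.-1%:Z) by move: c_small B_gt0; lia.
apply: (@le_lt_trans _ _ (`|alpha| * i%:R ^+ #|B|.-1)).
  apply: (@le_trans _ _ (`|alpha| * (i%:R : K) ^ (c - 1))).
    by apply: ler_wpM2r (ler_norm _); rewrite exprz_ge0.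
  apply: ler_wpM2l => //; rewrite exprnP; apply: ler_weXz2l => //.
  by rewrite ler1n.
apply: (@lt_le_trans _ _ (t.+1 ^ #|B|)%:R); last by rewrite ler_nat; apply: HC.
apply: (@le_lt_trans _ _ (`|alpha| * n%:R ^+ #|B|.-1 * t.+1%:R ^+ #|B|.-1)).
  rewrite -mulrA -exprMn; apply: ler_wpM2l => //.
  by rewrite lerXn2r ?nnegrE // -natrM ler_nat.
rewrite -(prednK B_gt0) expnS natrM natrX /=.
rewrite ltr_pM2r ?exprn_gt0 ?ltr0n //.
by apply: lt_trans ht _; rewrite ltr_nat.
Qed.

End ComplexityLowerBound.

(** * Regular sequences over the exterior algebra *)

Lemma quotmod_piB (R : pzRingType) (M : lmodType R) (X : set M) (m m' : M) :
  quotmod_pi X (m - m') = quotmod_pi X m - quotmod_pi X m'.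
Proof. by rewrite -scaleN1r quotmod_piD quotmod_piZ scaleN1r. Qed.

Section LinearForms.
Variables (k : fieldType) (n : nat).
Local Notation E := (exterior k n).
Local Notation e := (@ext_gen k n).
Implicit Types (l : E) (s : seq E).

Lemma ext_deg1_sum l : ext_deg 1 l -> l = \sum_i l [set i]%SET *: e i.
Proof.
move=> dl; apply/ffunP => A; rewrite sum_ffunE.
have [lA|lA] := eqVneq (l A) 0.
  rewrite lA big1 // => i _; rewrite !ffunE.
  by case: eqP => [<-|]; rewrite ?lA ?mul0r ?mulr0.
have /cards1P[i eA] : #|A| == 1%N by have := dl A lA; move/eqP; rewrite eqz_nat.
rewrite (bigD1 i) //= big1 => [|j neji].
  by rewrite !ffunE eA eqxx mulr1 addr0.
by rewrite !ffunE eA (inj_eq set1_inj) eq_sym (negPf neji) mulr0.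
Qed.

(** The twisted element c' is the image of c under e_i |-> - e_i. *)
Lemma ext_twist (c : E) : exists c', forall l, ext_deg 1 l -> c * l = l * c'.
Proof.
suff [c' Hc] : exists c', forall i, c * e i = e i * c'.
  exists c' => l /ext_deg1_sum ->; rewrite mulr_sumr mulr_suml.
  by apply: eq_bigr => i _; rewrite -scalerAr Hc scalerAl.
elim/ext_ind: c => [|x y [x' Hx] [y' Hy]|a x [x' Hx]|j x [x' Hx]].
- by exists 1 => i; rewrite mul1r mulr1.
- by exists (x' + y') => i; rewrite mulrDl mulrDr Hx Hy.
- by exists (a *: x') => i; rewrite -scalerAl Hx scalerAr.
- exists (- (e j * x')) => i.
  by rewrite -mulrA Hx mulrA ext_gen_anticomm mulNr mulrN mulrA.
Qed.

Lemma ext_deg1_anticomm l l' : ext_deg 1 l -> ext_deg 1 l' -> l * l' = - (l' * l).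
Proof.
move=> /ext_deg1_sum -> /ext_deg1_sum ->; rewrite !mulr_suml -sumrN.
under eq_bigr => i _ do rewrite mulr_sumr.
under [RHS]eq_bigr => i _ do rewrite mulr_sumr -sumrN.
rewrite exchange_big; apply: eq_bigr => i _; apply: eq_bigr => j _.
by rewrite -!scalerAl -!scalerAr ext_gen_anticomm !scalerN !scalerA mulrC.
Qed.

Lemma ext_deg1_sqr l : ext_deg 1 l -> l * l = 0.
Proof.
move=> /ext_deg1_sum ->; rewrite mulr_suml.
under eq_bigr => i _ do rewrite mulr_sumr.
apply: alternating_sum => [i|i j]; first by rewrite -scalerAl -scalerAr ext_gen_sqr !scaler0.
by rewrite -!scalerAl -!scalerAr ext_gen_anticomm !scalerN !scalerA mulrC.
Qed.

Lemma ext_deg_mul (d d' : int) (x y : E) : ext_deg d x -> ext_deg d' y ->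
  ext_deg (d + d') (x * y).
Proof.
move=> dx dy A; rewrite ffunE => /eqP nz; apply: contrapT => dA; apply: nz.
apply: big1 => B sBA; have [->|xB] := eqVneq (x B) 0; first by rewrite mul0r mulr0.
have [->|yB] := eqVneq (y (A :\: B)) 0; first by rewrite !mulr0.
case: dA; rewrite -(dx _ xB) -(dy _ yB) -(cardsID B A) (setIidPr sBA).
by rewrite PoszD.
Qed.

Definition linear_forms s := forall i, (i < size s)%N -> ext_deg 1 s`_i.

Lemma normal_linear_forms s : linear_forms s -> normal_seq s.
Proof.
by move=> ds c j js; have [c' Hc] := ext_twist c; exists c'; apply/Hc/ds.
Qed.

Lemma ext_regularP (M : lmodType E) s i (l : E) : normal_seq s -> (i <= size s)%N ->
  @ext_regular k n (quot_ideal M [set` take i s]%classic) l <->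
  forall m : M, insum s i (l *: m) <-> exists m', insum s i (m - l *: m').
Proof.
move=> ns si; pose pi := @quotmod_pi E M [set m : M | exists (a : E) (m' : M),
  a \in ideal_gen [set` take i s]%classic /\ m = a *: m']%classic.
have pi0 m : pi m = 0 <-> insum s i m.
  exact: quot_take_eq0.
have quot_exists m : (exists m' : quot_ideal M [set` take i s]%classic, pi m = l *: m') <->
    exists m', insum s i (m - l *: m').
  split=> [[m' em]|[m' Hm]].
    have [u eu] := quotmod_piP m'; exists u; apply/pi0.
    by rewrite /pi quotmod_piB quotmod_piZ -eu -em subrr.
  exists (pi m'); apply/eqP; rewrite -subr_eq0; apply/eqP.
  by rewrite -[l *: _]quotmod_piZ -[LHS]quotmod_piB; apply/pi0.
split=> [reg m|reg m'].
  rewrite -pi0 -quot_exists.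
  by have := reg (pi m); rewrite -[l *: pi m]quotmod_piZ.
have [m ->] := quotmod_piP m'.
have := reg m; rewrite -pi0 -quot_exists.
by rewrite -[X in _ -> (X = 0 <-> _)]quotmod_piZ.
Qed.

Definition prodE s i : E := \prod_(j < i) s`_j.

Lemma prodES s i : prodE s i.+1 = prodE s i * s`_i.
Proof. by rewrite /prodE big_ord_recr. Qed.

Lemma prodE_kill s i j : linear_forms s -> (i <= size s)%N -> (j < i)%N ->
  prodE s i * s`_j = 0.
Proof.
move=> ds; elim: i => // i IH si; rewrite ltnS leq_eqVlt prodES -mulrA => /orP[/eqP ->|ji].
  by rewrite ext_deg1_sqr ?mulr0 //; apply: ds.
rewrite (ext_deg1_anticomm (ds i si) (ds j (ltn_trans ji si))).
by rewrite mulrN mulrA IH ?mul0r ?oppr0 // ltnW.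
Qed.

Lemma prodE_comm s i l : linear_forms s -> (i <= size s)%N -> ext_deg 1 l ->
  l * prodE s i = (-1) ^+ i *: (prodE s i * l).
Proof.
move=> ds + dl; elim: i => [|i IH] si.
  by rewrite /prodE big_ord0 mulr1 mul1r scale1r.
rewrite prodES mulrA IH 1?ltnW // -scalerAl -!mulrA.
by rewrite (ext_deg1_anticomm dl (ds i si)) mulrN scalerN exprS mulN1r scaleNr.
Qed.

Lemma prodE_deg s i : linear_forms s -> (i <= size s)%N -> ext_deg i (prodE s i).
Proof.
move=> ds; elim: i => [|i IH] si.
  rewrite /prodE big_ord0 => A; rewrite ffunE.
  by have [->|_] := eqVneq A set0; rewrite ?cards0 ?eqxx.
by rewrite prodES -addn1 PoszD; apply: ext_deg_mul; [apply/IH/ltnW | apply: ds].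
Qed.

Section RegularSequence.
Variables (M : lmodType E) (s : seq E).
Hypothesis reg_s : ext_regular_seq M s.

Let ds : linear_forms s. Proof. by move=> i /reg_s[]. Qed.

Let reg i (m : M) : (i < size s)%N -> insum s i (s`_i *: m) ->
  exists m', insum s i (m - s`_i *: m').
Proof.
move=> si; have [_ /ext_regularP H] := reg_s si.
by apply: (H (normal_linear_forms ds) (ltnW si) m).1.
Qed.

(** Peel off the last factor: l_1 .. l_i (l_(i+1) u) = 0 puts l_(i+1) u in
    (l_1, .., l_i) M, and regularity puts u in (l_1, .., l_(i+1)) M. *)
Lemma regular_ann_prod i (u : M) : (i <= size s)%N ->
  prodE s i *: u = 0 -> insum s i u.
Proof.
elim: i u => [|i IH] u si; first by rewrite /prodE big_ord0 scale1r insum_nil.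
rewrite prodES -scalerA => /(IH _ (ltnW si))/(reg si)[m' Hm'].
by apply/insumS; exists m', (u - s`_i *: m'); split=> //; rewrite addrC subrK.
Qed.

(** The annihilator of a regular sequence l_1, .., l_r in M is l_1 .. l_r M, as for a
    free module over the exterior algebra on the l_i.  If m = l_1 .. l_i m' is killed
    by l_(i+1), then l_(i+1) m' is in (l_1, .., l_i) M; so m' is in l_(i+1) M modulo
    (l_1, .., l_i) M, which the product l_1 .. l_i kills. *)
Lemma regular_socle (m : M) : (forall j, (j < size s)%N -> s`_j *: m = 0) ->
  exists m', m = prodE s (size s) *: m'.
Proof.
move=> sm.
suff H i : (i <= size s)%N -> exists m', m = prodE s i *: m' by apply: H.
elim: i => [|i IH] si; first by exists m; rewrite /prodE big_ord0 scale1r.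
have [m' em] := IH (ltnW si).
have [|m'' Hm''] := @reg i m' si.
  apply: regular_ann_prod (ltnW si) _; rewrite scalerA.
  have := sm i si; rewrite em scalerA prodE_comm //; last exact: ds.
    move/(congr1 (fun u => ((-1) ^+ i)%:A *: u)).
    by rewrite scaler0 scalerA -scalerAl mul1r scalerA -expr2 sqrr_sign scale1r.
  exact: ltnW.
exists m''; rewrite prodES -scalerA em.
apply/eqP; rewrite -subr_eq0 -scalerBr; apply/eqP.
elim/insum_ind: Hm'' => [|x y Hx Hy|j x ji].
- by rewrite scaler0.
- by rewrite scalerDr Hx Hy addr0.
- by rewrite scalerA prodE_kill ?scale0r // ltnW.
Qed.

End RegularSequence.
End LinearForms.

Section DepthUpperBound.
Variables (K : realType) (k : fieldType) (n : nat) (G : sgraph n) (B : {set 'I_n}).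
Local Notation E := (exterior k n).
Local Notation e := (@ext_gen k n).

Hypothesis B_edge : forall i j, G i j -> (i \in B) != (j \in B).
Hypothesis no_iso : no_isolated G.
Hypothesis B_gt0 : (0 < #|B|)%N.

(** If C dominates its complement, then e_i e_C is zero, or the monomial of a set with
    an edge. *)
Lemma side_socle (C : {set 'I_n}) (l : E) :
  (forall i, i \notin C -> exists2 j, j \in C & G i j) ->
  ext_deg 1 l -> l *: ext_pi G (ext_mon k C) = 0.
Proof.
move=> domC /ext_deg1_sum ->; rewrite scaler_suml big1 // => i _.
rewrite -linearZ; apply/ext_pi_eq0 => D iD.
change (((l [set i]%SET *: e i) * ext_mon k C) D = 0).
have [iC|iC] := boolP (i \in C); first by rewrite -scalerAl gen_mon0 // scaler0 ffunE.
rewrite -scalerAl gen_mon // scalerA !ffunE.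
case: eqP => [eD|_]; last by rewrite mulr0.
have [j jC Gij] := domC i iC.
by have := iD i j; rewrite eD !inE eqxx jC orbT Gij => /(_ isT isT).
Qed.

Lemma indep_side : indep_set G B.
Proof. by move=> i j iB jB; apply/negP => /B_edge; rewrite iB jB. Qed.

Lemma indep_coside : indep_set G (~: B).
Proof.
move=> i j; rewrite !inE => iB jB; apply/negP => /B_edge.
by rewrite (negPf iB) (negPf jB).
Qed.

Lemma dom_side i : i \notin B -> exists2 j, j \in B & G i j.
Proof.
move=> iB; have [j Gij] := no_iso i; exists j => //.
by have := B_edge Gij; rewrite (negPf iB); case: (j \in B).
Qed.

Lemma dom_coside i : i \notin ~: B -> exists2 j, j \in ~: B & G i j.
Proof.
rewrite inE negbK => iB; have [j Gij] := no_iso i; exists j => //.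
by have := B_edge Gij; rewrite iB inE; case: (j \in B).
Qed.

(** The monomials of the two sides of G are killed by E_1, hence divisible by
    the product w of the regular sequence.  As w divides e_B, its degree is at most
    |B|; were it |B|, w would be e_B times a unit, and e_B does not divide the
    monomial of the other side. *)
Lemma regular_seq_lt s : ext_regular_seq (ext_edge_quot k G) s -> (size s < #|B|)%N.
Proof.
move=> reg_s; have ds i (si : (i < size s)%N) : ext_deg 1 s`_i by case: (reg_s i si).
pose w := prodE s (size s).
have div (C : {set 'I_n}) : (forall i, i \notin C -> exists2 j, j \in C & G i j) ->
    exists x, ext_edge_ideal G (ext_mon k C - w * x).
  move=> domC.
  have [j js|m' em] := regular_socle reg_s (m := ext_pi G (ext_mon k C)).
    by apply: side_socle domC _; apply: ds.
  have [x ex] := ext_pi_surj m'; exists x; apply/ext_pi_eq0.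
  apply/eqP; rewrite linearB subr_eq0 /= em ex; apply/eqP.
  by rewrite -linearZ.
have [x Hx] := div B dom_side; have [x' Hx'] := div _ dom_coside.
have wdeg : ext_deg (size s)%:Z w by apply: prodE_deg.
have /eqP wxB : (w * x) B = 1.
  have := Hx B indep_side; rewrite extB ffunE eqxx => /eqP.
  by rewrite subr_eq0 => /eqP <-.
have wB (C : {set 'I_n}) : w C != 0 -> #|C| = size s by move=> /wdeg[].
rewrite ltn_neqAle; apply/andP; split; last first.
  rewrite leqNgt; apply/negP => sB; move: wxB; rewrite ffunE big1 1?eq_sym ?oner_eq0 //.
  move=> C sCB; have [->|/wB wC] := eqVneq (w C) 0; first by rewrite mul0r mulr0.
  by have := leq_trans sB (eq_leq (esym wC)); rewrite ltnNge subset_leq_card.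
apply/eqP => sB.
(* As w and e_B have the same degree, only the constant term of x contributes to the
   coefficient of w x at B. *)
have x0 : x set0 != 0.
  apply: contraTneq wxB => x0; rewrite ffunE big1 1?eq_sym ?oner_eq0 // => C sCB.
  have [->|/wB wC] := eqVneq (w C) 0; first by rewrite mul0r mulr0.
  have -> : C = B by apply/eqP; rewrite eqEcard sCB wC sB leqnn.
  by rewrite setDv x0 !mulr0.
have [y [_ xy]] := ext_unit x0.
have Iy : ext_edge_ideal G (ext_mon k (~: B) - ext_mon k B * (y * x')).
  have -> : ext_mon k (~: B) - ext_mon k B * (y * x') =
      (ext_mon k (~: B) - w * x') - (ext_mon k B - w * x) * (y * x').
    by rewrite mulrBl opprB addrA -(mulrA w x) (mulrA x y) xy mul1r subrK.
  move=> C iC; rewrite extB Hx' // sub0r ffunE big1 ?oppr0 // => D sDC.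
  by rewrite Hx ?mul0r ?mulr0 //; apply: indep_subset iC.
have := Iy _ indep_coside; rewrite extB !ffunE eqxx big1 ?subr0.
  by move/eqP; rewrite oner_eq0.
move=> C sC; rewrite ffunE; case: eqP => [eC|_]; last by rewrite mul0r mulr0.
case/card_gt0P: B_gt0 => b bB; have := subsetP sC b.
by rewrite eC inE bB => /(_ isT).
Qed.

Lemma depthE_upper : (depthE K k G <= (#|B|%:R - 1)%:E)%E.
Proof.
apply: ge_ereal_sup => _ [s /regular_seq_lt sB <-]; rewrite lee_fin.
by rewrite lerBrDr natr1 ler_nat.
Qed.

End DepthUpperBound.

(** * Projective dimension and annihilators *)

Section ProjectiveColon.
Variables (R : comNzRingType) (P : lmodType R).

Definition free_ev : {freeg P / R} -> P := fglift (fun x : P => x).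

HB.instance Definition _ := GRing.isZmodMorphism.Build {freeg P / R} P free_ev
  (@lift_is_additive R P P (fun x => x)).

Lemma free_evU c x : free_ev << c *g x >> = c *: x.
Proof. exact: liftU. Qed.

Lemma free_evE D : free_ev D = \sum_(x <- dom D) coeff x D *: x.
Proof.
rewrite -{1}(freeg_sumE D) raddf_sum.
by apply: eq_bigr => x _; rewrite -free_evU.
Qed.

Lemma free_ev_is_scalable : scalable free_ev.
Proof.
have scaleE (a : R) (D : {freeg P / R}) :
  a *: D = \sum_(x <- dom D) << a * coeff x D *g x >> by [].
move=> a D; rewrite (free_evE D) scaleE raddf_sum scaler_sumr.
by apply: eq_bigr => x _; rewrite [LHS]free_evU scalerA.
Qed.

HB.instance Definition _ :=
  GRing.isScalable.Build R {freeg P / R} P *:%R free_ev free_ev_is_scalable.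

Lemma free_ev_surj p : exists D, free_ev D = p.
Proof. by exists (<< p >>); rewrite free_evU scale1r. Qed.

(** A projective module is a direct summand of the free module on its elements, so
    regular sequences on R are regular on it: check the coordinates. *)
Lemma projective_colon (s : seq R) t :
  (forall a : R^o, insum s t (s`_t *: a) -> insum s t a) -> projective P ->
  forall p : P, insum s t (s`_t *: p) -> insum s t p.
Proof.
move=> colon projP p [y ey].
have [h hK] := projP _ _ free_ev idfun free_ev_surj.
have hZ a v : h (a *: v) = a *: h v by exact: linearZ.
have cf x : insum (N := R^o) s t (coeff x (h p)).
  apply: colon; exists (fun j => coeff x (h (y j))).
  rewrite -[LHS]coeffZ -hZ ey linear_sum raddf_sum.
  by apply: eq_bigr => j _; rewrite /= hZ coeffZ.
have -> : p = free_ev (h p) by rewrite hK.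
rewrite free_evE; elim: (dom _) => [|x r IH].
  by rewrite big_nil; exact: insum0.
rewrite big_cons; apply: insumD => //; have [z ->] := cf x.
exists (fun j => z j *: x); rewrite scaler_suml; apply: eq_bigr => j _.
by rewrite scalerA.
Qed.

End ProjectiveColon.

Section ResolutionLength.
Variables (R : comNzRingType) (M : lmodType R) (s : seq R).
Variables (P : nat -> lmodType R) (f : forall i, {linear P i.+1 -> P i}).
Variable aug : {linear P 0%N -> M}.
Hypothesis res : projective_resolution f aug.
Hypothesis colon : forall i t (p : P i), (t < size s)%N ->
  insum s t (s`_t *: p) -> insum s t p.

Local Notation ins := (insum s).

Let f_insum i t (x : P i.+1) : ins t x -> ins t (f i x).
Proof.
by move=> [y ->]; exists (f i \o y); rewrite linear_sum; apply: eq_bigr => j _; rewrite linearZ.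
Qed.

Let insumB i t (x y : P i) : (t <= size s)%N -> ins t x -> ins t y -> ins t (x - y).
Proof.
move=> ts Hx Hy; apply: insumD => //; rewrite -scaleN1r.
by apply: insumZ => //; apply: normal_seq_comm.
Qed.

Let scale_insum i t a (x : P i) : (t <= size s)%N -> ins t x -> ins t (a *: x).
Proof. by move=> ts; apply: insumZ => //; apply: normal_seq_comm. Qed.

Let f_f i (x : P i.+2) : f i (f i.+1 x) = 0.
Proof. by have [_ _ _ ex] := res; apply/ex; exists x. Qed.

(** Tor_(i+1) (M, R / (s_0, .., s_(t-1))) = 0 for t <= i, as R / (s_0, .., s_(t-1)) has
    the Koszul resolution, of length t.  The induction on t uses that each s_t is
    regular on the P_i modulo its predecessors. *)
Lemma tor_vanish t i (x : P i.+1) : (t <= size s)%N -> (t <= i)%N ->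
  ins t (f i x) -> exists y, ins t (x - f i.+1 y).
Proof.
elim: t i x => [|t IH] i x ts ti.
  rewrite insum_nil => fx0; have [_ _ _ ex] := res.
  by have [y ->] := (ex i x).1 fx0; exists y; rewrite subrr; exact: insum0.
case: i x ti => // i x ti /insumS[q [r [Hr er]]].
have ts' := ltnW ts.
have : ins t (f i q).
  apply: colon => //; have := f_f x; rewrite er linearD linearZ /= => /eqP.
  rewrite addr_eq0 => /eqP ->; rewrite -scaleN1r; apply: scale_insum => //.
  exact: f_insum.
move=> /(IH _ _ ts' ti)[w Hw].
have : ins t (f i.+1 (x - s`_t *: w)).
  rewrite linearB linearZ /= er addrAC -scalerBr; apply: insumD => //.
  exact: scale_insum.
move=> /(IH _ _ ts' (leqW ti))[y Hy]; exists y; apply/insumS.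
by exists w, (x - s`_t *: w - f i.+2 y); split=> //; rewrite [RHS]addrC addrAC subrK.
Qed.

(** An element of M killed by s gives a nonzero element of
    Tor_t (M, R / (s_0, .., s_(t-1))), killed by the s_j with j >= t: pass from t to
    t + 1 by lifting through the connecting map of
    0 -> R / (s_0, .., s_(t-1)) -> R / (s_0, .., s_(t-1)) -> R / (s_0, .., s_t) -> 0. *)
Lemma tor_chain (m : M) t : (t <= size s)%N -> m != 0 ->
  (forall j, (j < size s)%N -> s`_j *: m = 0) ->
  exists p : P t, (~ exists y, ins t (p - f t y)) /\
    forall j, (t <= j < size s)%N -> exists y, ins t (s`_j *: p - f t y).
Proof.
have [_ surj ex0 _] := res.
move=> + m0 sm; elim: t => [|t IH] ts.
  have [p ep] := surj m; exists p; split=> [[y]|j js].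
    rewrite insum_nil => /eqP; rewrite subr_eq0 => /eqP epy.
    by move: m0; rewrite -ep (ex0 p).2 ?eqxx //; exists y.
  have [|y ey] := (ex0 (s`_j *: p)).1; first by rewrite linearZ /= ep sm.
  by exists y; rewrite ey subrr; exact: insum0.
have [p [np kp]] := IH (ltnW ts); have ts' := ltnW ts.
have [q Hq] : exists q, ins t (s`_t *: p - f t q) by apply: kp; rewrite leqnn.
exists q; split=> [[y]|j /andP[tj js]].
  move=> /insumS[u [r [Hr er]]]; apply: np; exists u; apply: colon => //.
  have efq : f t q = s`_t *: f t u + f t r.
    by rewrite -[q](subrK (f t.+1 y)) er !linearD linearZ /= f_f addr0.
  have -> : s`_t *: (p - f t u) = (s`_t *: p - f t q) + f t r.
    by rewrite scalerBr efq opprD addrA subrK.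
  exact: insumD (f_insum Hr).
have [q' Hq'] : exists y, ins t (s`_j *: p - f t y) by apply: kp; rewrite js ltnW.
have [|y Hy] := @tor_vanish t t (s`_j *: q - s`_t *: q') ts' (leqnn t).
  have -> : f t (s`_j *: q - s`_t *: q') =
      s`_t *: (s`_j *: p - f t q') - s`_j *: (s`_t *: p - f t q).
    have -> : f t (s`_j *: q - s`_t *: q') = s`_j *: f t q - s`_t *: f t q'.
      have fZ a x : f t (a *: x) = a *: f t x by exact: linearZ.
      by rewrite linearB /= !fZ.
    by rewrite !scalerBr !scalerA mulrC opprB [RHS]addrC addrA subrK.
  by apply: insumB => //; apply: scale_insum.
exists y; apply/insumS; exists q', (s`_j *: q - s`_t *: q' - f t.+1 y).
by split=> //; rewrite [RHS]addrC addrAC subrK.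
Qed.

Lemma resolution_length (m : M) d : m != 0 ->
  (forall j, (j < size s)%N -> s`_j *: m = 0) ->
  (forall i, (d < i)%N -> forall x : P i, x = 0) -> (size s <= d)%N.
Proof.
move=> m0 sm Pd; rewrite leqNgt; apply/negP => ds.
have [p [np _]] := tor_chain ds m0 sm; apply: np; exists 0.
by rewrite (Pd d.+1 (leqnn _) p) linear0 subr0; exact: insum0.
Qed.

End ResolutionLength.

(** ** Monomial ideals *)

Section MonomialIdeals.
Variables (k : fieldType) (n : nat).
Local Notation S := {mpoly k[n]}.
Implicit Types (p q : S) (m : 'X_{1..n}).

(** For an upset D, the ideal spanned by the monomials of D.  As for the exterior
    algebra, membership is read off the coefficients. *)
Definition mono_ideal (D : 'X_{1..n} -> Prop) (p : S) := forall m, p@_m != 0 -> D m.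

Definition upset (D : 'X_{1..n} -> Prop) := forall m m', D m -> D (m' + m)%MM.

Lemma mono_ideal_submod D : upset D -> submod (mono_ideal D : S^o -> Prop).
Proof.
move=> upD; split=> [m|p q Hp Hq m|a p Hp m].
- by rewrite mcoeff0 eqxx.
- by rewrite mcoeffD; have [->|/Hp //] := eqVneq p@_m 0; rewrite add0r; exact: Hq.
move=> nz; have /msuppM_le/allpairsP[[m1 m2] /= [_ m2p ->]] : m \in msupp (a * p).
  by rewrite mcoeff_msupp.
by apply/upD/Hp; rewrite -mcoeff_msupp.
Qed.

Lemma mnm1_le i m : (0 < m i)%N -> (U_(i) <= m)%MM.
Proof. by move=> mi; apply/mnm_lepP => l; rewrite mnm1E; case: eqVneq => [<-|]. Qed.

Lemma mcoeffXM i q m :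
  ('X_i * q)@_m = if (0 < m i)%N then q@_(m - U_(i))%MM else 0.
Proof.
case: ifP => mi.
  by rewrite mulrC -{1}(submK (mnm1_le mi)) addmC mcoeffMX.
rewrite mulrC [q in LHS]mpolyE mulr_suml raddf_sum big1 // => m' _.
rewrite -scalerAl -mpolyXD /= mcoeffZ mcoeffX; case: eqP => [em|_]; last by rewrite mulr0.
by move: mi; rewrite -em mnmDE mnm1E eqxx addn1.
Qed.

Definition vars (ws : seq 'I_n) : seq S := [seq 'X_w | w <- ws].

Lemma mono_ideal_ind D (Q : S -> Prop) : Q 0 -> (forall p q, Q p -> Q q -> Q (p + q)) ->
  (forall c m, D m -> Q (c *: 'X_[m])) -> forall p, mono_ideal D p -> Q p.
Proof.
move=> Q0 QD QX p Dp; rewrite [p]mpolyE big_seq; elim/big_ind: _ => // m.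
by rewrite mcoeff_msupp => /Dp; apply: QX.
Qed.

Lemma mpolyX_factor m i : (0 < m i)%N -> 'X_[m] = 'X_i * 'X_[(m - U_(i))%MM] :> S.
Proof. by move=> mi; rewrite -mpolyXD addmC submK // mnm1_le. Qed.

Lemma insum_varsP ws t p : (t <= size ws)%N ->
  insum (N := S^o) (vars ws) t p <->
  mono_ideal (fun m => exists2 w, w \in take t ws & (0 < m w)%N) p.
Proof.
move=> tws; split=> [[y ->] m nz|].
  have [j nzj] : exists j : 'I_t, ((vars ws)`_j *: y j : S)@_m != 0.
    apply: contrapT => /forallNP H; move: nz; rewrite raddf_sum big1 ?eqxx // => j _.
    by apply/eqP; have /negP := H j; rewrite negbK.
  have jws : (j < size ws)%N := leq_trans (ltn_ord j) tws.
  have [w0 _] : exists w : 'I_n, w \in ws.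
    by case: (ws) jws => // w r _; exists w; rewrite inE eqxx.
  exists (nth w0 ws j).
    by rewrite -(nth_take w0 (ltn_ord j)) mem_nth // size_takel.
  apply: contraNT nzj => nw; rewrite (nth_map w0) //.
  by rewrite [X in X == _]mcoeffXM (negPf nw).
elim/mono_ideal_ind: p / => [|p q|c m [w wt mw]]; first exact: insum0.
  exact: insumD.
rewrite (mpolyX_factor mw) scalerAr.
have iw : (index w (take t ws) < t)%N by rewrite -[ltnRHS](size_takel tws) index_mem.
have -> : 'X_w = (vars ws)`_(index w (take t ws)).
  rewrite (nth_map w); last exact: leq_trans iw tws.
  by rewrite -(nth_take w iw) nth_index.
exact: insum_gen.
Qed.

(** Distinct variables form a regular sequence. *)
Lemma vars_colon ws t (a : S^o) : uniq ws -> (t < size ws)%N ->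
  insum (vars ws) t ((vars ws)`_t *: a) -> insum (vars ws) t a.
Proof.
move=> uws tws; have [w0 _] : exists w : 'I_n, w \in ws.
  by case: (ws) tws => // w r _; exists w; rewrite inE eqxx.
rewrite !insum_varsP 1?ltnW // => Ha m nz; set w := nth w0 ws t.
have [|v vt] := Ha (m + U_(w))%MM.
  rewrite (nth_map w0) // [X in X != _]mcoeffXM mnmDE mnm1E eqxx addn1 /=.
  by rewrite addmK.
rewrite mnmDE mnm1E => mv; exists v => //; move: mv; case: eqP => [ewv|_]; last by rewrite addn0.
have := uws; rewrite -(cat_take_drop t.+1 ws) (take_nth w0) // cat_uniq rcons_uniq.
by rewrite -/w ewv vt.
Qed.

End MonomialIdeals.

Section PolynomialEdgeIdeal.
Variables (k : fieldType) (n : nat) (G : sgraph n).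
Local Notation S := {mpoly k[n]}.
Implicit Types (p q : S) (m : 'X_{1..n}).

Definition edge_mono m := exists i j, [/\ G i j, (0 < m i)%N & (0 < m j)%N].

Lemma edge_mono_up : upset edge_mono.
Proof.
move=> m m' [i [j [Gij mi mj]]]; exists i, j.
by rewrite !mnmDE !addn_gt0 mi mj !orbT.
Qed.

Lemma pol_edge_idealP p :
  p \in ideal_gen (edge_monomials (fun i => 'X_i : S) G) <-> mono_ideal edge_mono p.
Proof.
split.
  have [I0 ID IM] := mono_ideal_submod k edge_mono_up.
  elim/span_ind: p / => // _ [_ [b [[i [j [Gij ->]]] ->]]] m.
  rewrite -mulrA mcoeffXM; case: ifP => [mi|]; last by rewrite eqxx.
  rewrite mcoeffXM; case: ifP => [mj _|]; last by rewrite eqxx.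
  by exists i, j; split=> //; apply: leq_trans mj _; rewrite mnmBE leq_subr.
elim/mono_ideal_ind: p / => [|p q|c m [i [j [Gij mi mj]]]]; first exact: rpred0.
  exact: rpredD.
have neij : i != j by apply: contraTneq Gij => ->; rewrite adj_irr.
have mj' : (0 < (m - U_(i))%MM j)%N by rewrite mnmBE mnm1E (negPf neij) subn0.
rewrite (mpolyX_factor _ mi) (mpolyX_factor _ mj') mulrA scalerAr.
by apply: span_gen; exists ('X_i * 'X_j), (c *: 'X_[(m - U_(i) - U_(j))%MM]); split=> //; exists i, j.
Qed.

Definition pol_pi (p : S^o) : pol_edge_quot k G :=
  @quotmod_pi S S^o (ideal_span (edge_monomials (fun i => 'X_i : S) G)) p.

Lemma pol_pi_is_linear : linear pol_pi.
Proof. by move=> a x y; rewrite /pol_pi quotmod_piD quotmod_piZ. Qed.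

HB.instance Definition _ :=
  GRing.isLinear.Build S S^o (pol_edge_quot k G) *:%R pol_pi pol_pi_is_linear.

Lemma pol_pi_surj x : exists p : S^o, x = pol_pi p.
Proof. exact: quotmod_piP. Qed.

Lemma pol_pi_eq0 p : pol_pi p = 0 <-> mono_ideal edge_mono p.
Proof. by rewrite -pol_edge_idealP; apply: quotmod_pi_eq0. Qed.

End PolynomialEdgeIdeal.

Section PolynomialSides.
Variables (K : realType) (k : fieldType) (n : nat) (G : sgraph n) (B : {set 'I_n}).
Local Notation S := {mpoly k[n]}.
Hypothesis B_edge : forall i j, G i j -> (i \in B) != (j \in B).
Hypothesis no_iso : no_isolated G.

Definition side_mon : 'X_{1..n} := [multinom (i \notin B : nat) | i < n].

Lemma side_mon_neq0 : pol_pi G ('X_[side_mon] : S) <> 0.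
Proof.
move=> /pol_pi_eq0 /(_ side_mon); rewrite mcoeffX eqxx oner_eq0.
move=> /(_ isT)[i [j [/B_edge Gij]]]; rewrite !mnmE.
by case: (i \in B) Gij; case: (j \in B).
Qed.

Lemma side_mon_kill b : b \in B -> pol_pi G ('X_b * 'X_[side_mon] : S) = 0.
Proof.
move=> bB; have [a Gba] := no_iso b.
have aB : a \notin B by have := B_edge Gba; rewrite bB; case: (a \in B).
apply/pol_pi_eq0 => m; rewrite mcoeffXM; case: ifP => [mb|]; last by rewrite eqxx.
rewrite mcoeffX; case: (side_mon =P (m - U_(b))%MM) => [em|_]; last by rewrite eqxx.
move=> _; exists b, a; split=> //; have := congr1 (fun m : 'X_{1..n} => m a) em.
rewrite mnmE aB mnmBE => e1; rewrite ltnNge leqn0; apply/negP => /eqP ma.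
by rewrite ma in e1.
Qed.

(** The variables of B kill the monomial of the opposite side, which is nonzero in
    S / I; so a resolution is at least as long as B. *)
Lemma pd_lower : ((#|B|%:R)%:E <= pdS K k G)%E.
Proof.
apply: le_ereal_inf_tmp => _ [d [P [f [aug [res Pd]]]] <-]; rewrite lee_fin ler_nat.
pose ws := enum B.
have -> : #|B| = size (vars k ws) by rewrite size_map -cardE.
apply: (@resolution_length _ _ _ _ _ _ res _ (pol_pi G 'X_[side_mon])) Pd.
- move=> i t p; rewrite size_map => tws; apply: projective_colon => [a|].
    by apply: vars_colon; rewrite ?enum_uniq.
  exact: pr_proj res i.
- by apply/eqP; apply: side_mon_neq0.
move=> j; rewrite size_map => jws; rewrite -linearZ.
have [i0 _] : exists i : 'I_n, i \in ws.
  by case: (ws) jws => // w r _; exists w; rewrite inE eqxx.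
rewrite (nth_map i0) //; apply: side_mon_kill.
by rewrite -mem_enum mem_nth.
Qed.

End PolynomialSides.

(** * Koszul cohomology and regular sequences of polynomials *)

Section Koszul.
Variable R : comNzRingType.
Implicit Types (s : seq R) (c : seq bool -> R) (w : seq bool) (J : R -> Prop).

(** A cochain of the Koszul complex on s is given by its values c w on the words
    w of length size s, which are the characteristic functions of the sets of
    basis vectors. *)
Fixpoint kd s c w : R :=
  match s, w with
  | x :: s', b :: w' =>
    if b then x * c (false :: w') - kd s' (fun v => c (true :: v)) w'
    else kd s' (fun v => c (false :: v)) w'
  | _, _ => 0
  end.

(** Contraction with the j-th basis vector, a homotopy between multiplication by
    s_j and 0. *)
Fixpoint kh (j : nat) c w : R :=
  match j, w with
  | 0, b :: w' => if b then 0 else c (true :: w')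
  | j'.+1, b :: w' =>
    if b then - kh j' (fun v => c (true :: v)) w'
    else kh j' (fun v => c (false :: v)) w'
  | _, _ => 0
  end.

Lemma eq_kd s c c' w : (forall v, size v = size w -> c v = c' v) -> kd s c w = kd s c' w.
Proof.
elim: s c c' w => [//|x s IH] c c' [//|[] w] ec /=; last first.
  by apply: IH => v sv; rewrite ec //= sv.
by rewrite ec //; congr (_ - _); apply: IH => v sv; rewrite ec //= sv.
Qed.

Lemma eq_kh j c c' w : (forall v, size v = size w -> c v = c' v) -> kh j c w = kh j c' w.
Proof.
elim: j c c' w => [|j IH] c c' [//|[] w] ec //=; first by rewrite ec.
  by congr (- _); apply: IH => v sv; rewrite ec //= sv.
by apply: IH => v sv; rewrite ec //= sv.
Qed.

Lemma kdB s c c' w : kd s (fun v => c v - c' v) w = kd s c w - kd s c' w.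
Proof.
elim: s c c' w => [|x s IH] c c' w /=; first by rewrite subr0.
case: w => [|[] w]; rewrite ?subr0 ?IH //.
by rewrite mulrBr !opprB addrACA [RHS]addrACA; congr (_ + _); rewrite addrC.
Qed.

Lemma kdM s a c w : kd s (fun v => a * c v) w = a * kd s c w.
Proof.
elim: s c w => [|x s IH] c w /=; first by rewrite mulr0.
by case: w => [|[] w]; rewrite ?mulr0 ?IH // mulrBr mulrCA.
Qed.

Lemma kd0 s w : kd s (fun=> 0) w = 0.
Proof.
by rewrite -[RHS](mul0r (kd s (fun=> 0) w)) -kdM; apply: eq_kd => v _; rewrite mul0r.
Qed.

Lemma kdN s c w : kd s (fun v => - c v) w = - kd s c w.
Proof.
by rewrite -sub0r -(kd0 s w) -kdB; apply: eq_kd => v _; rewrite sub0r.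
Qed.

Lemma kdD s c c' w : kd s (fun v => c v + c' v) w = kd s c w + kd s c' w.
Proof.
by rewrite -[kd s c' w]opprK -kdN -kdB; apply: eq_kd => v _; rewrite opprK.
Qed.

Lemma kd_sum s I (r : seq I) (F : I -> seq bool -> R) w :
  kd s (fun v => \sum_(i <- r) F i v) w = \sum_(i <- r) kd s (F i) w.
Proof.
elim: r => [|i r IH].
  by rewrite [RHS]big_nil -[RHS](kd0 s w); apply: eq_kd => v _; rewrite big_nil.
by rewrite big_cons -IH -kdD; apply: eq_kd => v _; rewrite big_cons.
Qed.

Lemma khM j a c w : kh j (fun v => a * c v) w = a * kh j c w.
Proof.
elim: j c w => [|j IH] c [|[] w] //=; rewrite ?mulr0 ?IH //.
by rewrite mulrN.
Qed.

Lemma khB j c c' w : kh j (fun v => c v - c' v) w = kh j c w - kh j c' w.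
Proof.
elim: j c c' w => [|j IH] c c' [|[] w] //=; rewrite ?subr0 ?IH //.
by rewrite opprB opprK addrC.
Qed.

Lemma kd_homotopy j s c w : (j < size s)%N -> size w = size s ->
  kd s (kh j c) w + kh j (kd s c) w = s`_j * c w.
Proof.
elim: s j c w => [//|x s IH] [|j] c [//|b w] /=.
  move=> _ _; case: b => /=.
    by rewrite kd0 subr0 addr0.
  by rewrite addrC subrK.
rewrite ltnS => js [sw]; case: b => /=; last exact: IH.
have -> : kh j (fun v => x * c (false :: v) - kd s (fun u => c (true :: u)) v) w =
    x * kh j (fun v => c (false :: v)) w - kh j (kd s (fun u => c (true :: u))) w.
  by rewrite -khM -khB.
by rewrite kdN opprK opprB addrC addrA subrK addrC IH.
Qed.

Lemma kd_kd s c w : size w = size s -> kd s (kd s c) w = 0.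
Proof.
elim: s c w => [//|x s IH] c [//|[] w] /= [sw]; last exact: IH.
by rewrite kdB kdM IH // subr0 subrr.
Qed.

Section Ideal.
Variable J : R -> Prop.
Hypothesis sJ : submod (J : R^o -> Prop).

Let J0 : J 0. Proof. by case: sJ. Qed.
Let JB x y : J x -> J y -> J (x - y). Proof. exact: (submodB sJ). Qed.
Let JM a x : J x -> J (a * x). Proof. by case: sJ => _ _; apply. Qed.

Lemma kd_ideal s c w : (forall j v, (j < size s)%N -> size v = size s -> J (s`_j * c v)) ->
  size w = size s -> J (kd s c w).
Proof.
elim: s c w => [//|x s IH] c [//|b w] /= Hc [sw].
have H b' : J (kd s (fun v => c (b' :: v)) w).
  by apply: IH => // j v js sv; apply: (Hc j.+1); rewrite //= sv.
by case: b => //; apply: JB => //; apply: (Hc 0%N); rewrite //= sw.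
Qed.

Lemma kh_ideal j c w : (forall v, size v = size w -> J (c v)) -> J (kh j c w).
Proof.
elim: j c w => [|j IH] c [//|[] w] Hc //=; first exact: Hc.
  by rewrite -sub0r; apply: JB => //; apply: IH => v sv; apply: Hc; rewrite /= sv.
by apply: IH => v sv; apply: Hc; rewrite /= sv.
Qed.

End Ideal.

(** c is homogeneous of cohomological degree i: it is supported on the words with i
    letters true. *)
Definition cdeg i c := forall w, count id w != i -> c w = 0.

Lemma cdeg_kd s i c : cdeg i c -> cdeg i.+1 (kd s c).
Proof.
elim: s i c => [//|x s IH] i c Hc [//|[] w] /= cw; last first.
  by apply: (IH i) => // v cv; apply: Hc.
rewrite Hc; last by rewrite /= add0n -eqSS.
case: i Hc cw => [|i] Hc cw.
  rewrite mulr0 sub0r -(_ : kd s (fun=> 0) w = kd s (fun v => c (true :: v)) w).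
    by rewrite kd0 oppr0.
  by apply: eq_kd => v _; rewrite Hc.
by rewrite mulr0 (IH i) ?subr0 // => v cv; apply: Hc; rewrite /= add1n eqSS.
Qed.

Lemma kh0 j w : kh j (fun=> 0) w = 0.
Proof.
by rewrite (eq_kh _ (c' := fun=> 0 * 0)) ?khM ?mul0r // => v _; rewrite mul0r.
Qed.

Lemma cdeg0_kh j c w : cdeg 0 c -> kh j c w = 0.
Proof.
elim: j c w => [|j IH] c [|[] w] Hc //=; first exact: Hc.
  by rewrite (eq_kh _ (c' := fun=> 0)) ?kh0 ?oppr0 // => v _; apply: Hc.
by apply: IH => v cv; apply: Hc.
Qed.

Lemma cdeg_kh j i c : cdeg i.+1 c -> cdeg i (kh j c).
Proof.
elim: j i c => [|j IH] i c Hc [//|[] w] //= cw.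
- by apply: Hc; rewrite /= add1n eqSS.
- have Hc' : cdeg i (fun v => c (true :: v)).
    by move=> v cv; apply: Hc; rewrite /= add1n eqSS.
  case: i Hc Hc' cw => [|i] Hc Hc' cw; first by rewrite cdeg0_kh ?oppr0.
  by rewrite (IH i) ?oppr0.
- by apply: (IH i) => // v cv; apply: Hc.
Qed.

(** c is a coboundary modulo J, by a cochain of degree i - 1. *)
Definition cobnd s i J c :=
  if i is i'.+1 then
    exists2 b, cdeg i' b & forall w, size w = size s -> J (c w - kd s b w)
  else forall w, size w = size s -> J (c w).

(** J t stands for J_0 + (f_0, .., f_(t-1)), and f_0, .., f_(r-1) is regular on
    R / J_0. *)
Section RegularVanishing.
Variables (s : seq R) (r : nat) (f : nat -> R) (J : nat -> R -> Prop).
Hypothesis sJ : forall t, submod (J t : R^o -> Prop).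
Hypothesis J_step : forall t p, (t < r)%N -> J t.+1 p -> exists a, J t (p - f t * a).
Hypothesis J_incl : forall t p, J t p -> J t.+1 p.
Hypothesis J_f : forall t a, J t.+1 (f t * a).
Hypothesis J_reg : forall t a, (t < r)%N -> J t (f t * a) -> J t a.
Hypothesis f_in : forall t, (t < r)%N ->
  exists g : nat -> R, f t = \sum_(j < size s) s`_j * g j.

Let JB t x y : J t x -> J t y -> J t (x - y). Proof. exact: (submodB (sJ t)). Qed.
Let J0 t : J t 0. Proof. by case: (sJ t). Qed.
Let JD t x y : J t x -> J t y -> J t (x + y).
Proof. by case: (sJ t) => _ + _; apply. Qed.
Let JM t a x : J t x -> J t (a * x). Proof. by case: (sJ t) => _ _; apply. Qed.

(** Multiplication by f_t is null-homotopic, as f_t is a combination of the s_j and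
    multiplication by s_j is. *)
Lemma f_homotopy t : (t < r)%N -> exists h : (seq bool -> R) -> seq bool -> R,
  [/\ forall c w, size w = size s -> kd s (h c) w + h (kd s c) w = f t * c w,
      forall i c, cdeg i.+1 c -> cdeg i (h c), forall c w, cdeg 0 c -> h c w = 0 &
      forall c w, size w = size s -> (forall v, size v = size s -> J t (c v)) ->
        J t (h c w)].
Proof.
move=> tr; have [g fg] := f_in tr.
exists (fun c w => \sum_(j < size s) g j * kh j c w).
split=> [c w sw|i c Hc w cw|c w Hc|c w sw Hc].
- rewrite kd_sum -big_split fg mulr_suml; apply: eq_bigr => j _ /=.
  by rewrite kdM -mulrDr kd_homotopy // mulrCA mulrA.
- by rewrite big1 // => j _; rewrite (cdeg_kh _ Hc) ?mulr0.
- by rewrite big1 // => j _; rewrite cdeg0_kh ?mulr0.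
elim/big_ind: _ => [|x y|j _]; [exact: J0|exact: JD|].
apply: JM; apply: (kh_ideal (sJ t)) => v sv.
by apply: Hc; rewrite sv.
Qed.

(** Multiplication by f_t is injective on R / J_t and null-homotopic on its Koszul
    complex, so H^i (R / J_t) is a quotient of H^(i-1) (R / J_(t+1)).  By induction
    H^i (R / J_t) vanishes for i + t < r. *)
Lemma koszul_vanish i t c : (i + t < r)%N -> cdeg i c ->
  (forall w, size w = size s -> J t (kd s c w)) -> cobnd s i (J t) c.
Proof.
elim: i t c => [|i IH] t c itr Hc cc; have tr : (t < r)%N := leq_ltn_trans (leq_addl _ _) itr.
  have [h [hE _ h0 hJ]] := f_homotopy tr.
  move=> w sw; apply: J_reg => //; rewrite -hE //; apply: JD; last exact: hJ.
  by rewrite (eq_kd _ (c' := fun=> 0)) ?kd0 // => v _; apply: h0.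
have [h [hE hdeg _ hJ]] := f_homotopy tr.
have hc : cdeg i (h c) := hdeg i c Hc.
have kdh w : size w = size s -> J t (f t * c w - kd s (h c) w).
  by move=> sw; rewrite -hE // addrC addKr; apply: hJ.
have [b' b'i Hb'] : exists2 b', cdeg i b' &
    forall w, size w = size s -> J t (kd s (h c) w - f t * kd s b' w).
  have cJ w : size w = size s -> J t.+1 (kd s (h c) w).
    move=> sw; rewrite -[kd _ _ _](subrK (f t * c w)) addrC -opprB.
    apply: (submodB (sJ _)); first exact: J_f.
    by apply/J_incl/kdh.
  have itr' : (i + t.+1 < r)%N by rewrite addnS.
  (* Division by f_t of a cochain of degree i with values in J_(t+1). *)
  have div u : cdeg i u -> (forall w, size w = size s -> J t.+1 (u w)) ->
      exists2 u', cdeg i u' & forall w, size w = size s -> J t (u w - f t * u' w).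
    move=> ui uJ; have H w : exists a, (count id w != i -> a = 0) /\
        (size w = size s -> J t (u w - f t * a)).
      have [cw|cw] := eqVneq (count id w) i; last first.
        by exists 0; split=> // _; rewrite ui // mulr0 subr0.
      have [sw|sw] := eqVneq (size w) (size s); last first.
        by exists 0; split=> // /eqP; rewrite (negPf sw).
      by have [a Ha] := J_step tr (uJ w sw); exists a; split=> // /eqP; rewrite cw.
    by have [u' Hu'] := choice H; exists u' => w; case: (Hu' w).
  have := IH t.+1 (h c) itr' hc cJ; case: (i) hc div => [|i'] hc' div.
    move=> hcJ; have [b' b'0 Hb'] := div _ hc' hcJ; exists b' => // w sw.
    rewrite -kdM -kdB; apply: (kd_ideal (sJ t)) => // j v _ sv.
    by apply/JM/Hb'.
  move=> [e ei He]; have [||b' b'i Hb'] := div (fun w => h c w - kd s e w).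
  - by move=> w cw; rewrite hc' // (cdeg_kd _ ei) // subr0.
  - exact: He.
  exists b' => // w sw; rewrite -kdM -kdB.
  have -> : kd s (fun v => h c v - f t * b' v) w =
      kd s (fun v => h c v - kd s e v - f t * b' v) w + kd s (kd s e) w.
    by rewrite -kdD; apply: eq_kd => v _; rewrite addrAC subrK.
  rewrite kd_kd // addr0; apply: (kd_ideal (sJ t)) => // j v _ sv.
  by apply/JM/Hb'.
exists b' => // w sw; apply: J_reg => //; rewrite mulrBr.
by rewrite -[f t * c w](subrK (kd s (h c) w)) -addrA; apply: JD; [apply: kdh | apply: Hb'].
Qed.

End RegularVanishing.

End Koszul.

(** * Depth of polynomial edge ideals *)

Section GradedPolynomials.
Variables (k : fieldType) (n : nat).
Local Notation S := {mpoly k[n]}.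
Implicit Types (p q : S) (m : 'X_{1..n}).

Definition mproj e p : S := \sum_(m <- msupp p | mdeg m == e) p@_m *: 'X_[m].

Lemma mcoeff_mproj e p m : (mproj e p)@_m = if mdeg m == e then p@_m else 0.
Proof.
rewrite raddf_sum /= big_mkcond /=; have [mp|mp] := boolP (m \in msupp p); last first.
  rewrite big_seq big1 => [|m' m'p]; first by rewrite (memN_msupp_eq0 mp) if_same.
  case: ifP => // _; rewrite mcoeffZ mcoeffX.
  by case: eqP m'p mp => [->->|]; rewrite ?mulr0.
rewrite (bigD1_seq m) ?msupp_uniq //= big1 ?addr0 => [|m' nem].
  by case: ifP => // _; rewrite mcoeffZ mcoeffX eqxx mulr1.
by case: ifP => // _; rewrite mcoeffZ mcoeffX (negPf nem) mulr0.
Qed.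

Lemma mproj_is_additive e : zmod_morphism (mproj e).
Proof.
move=> p q; apply/mpolyP => m; rewrite !(mcoeff_mproj, mcoeffB).
by case: ifP; rewrite ?subr0.
Qed.

HB.instance Definition _ e :=
  GRing.isZmodMorphism.Build S S (mproj e) (mproj_is_additive e).

Lemma mprojB e p q : mproj e (p - q) = mproj e p - mproj e q.
Proof. exact: raddfB. Qed.

Lemma mproj_ideal D e p : mono_ideal D p -> mono_ideal D (mproj e p).
Proof. by move=> Dp m; rewrite mcoeff_mproj; case: ifP => [_|]; [exact: Dp | rewrite eqxx]. Qed.

Lemma mprojXS i e p : mproj e.+1 ('X_i * p) = 'X_i * mproj e p.
Proof.
apply/mpolyP => m; rewrite mcoeff_mproj !mcoeffXM mcoeff_mproj.
case: (ltnP 0 (m i)) => mi; last by rewrite if_same.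
by rewrite -{1}(submK (mnm1_le mi)) mdegD mdeg1 addn1 eqSS.
Qed.

Lemma mprojX0 i p : mproj 0 ('X_i * p) = 0.
Proof.
apply/mpolyP => m; rewrite mcoeff_mproj mcoeffXM mcoeff0.
case: ifP => //; rewrite mdeg_eq0 => /eqP ->; by rewrite mnm0E.
Qed.

Lemma kd_mprojS ws e (c : seq bool -> S) w :
  mproj e.+1 (kd (vars k ws) c w) = kd (vars k ws) (mproj e \o c) w.
Proof.
elim: ws c w => [|v ws IH] c w /=; first by rewrite raddf0.
case: w => [|[] w] /=; first by rewrite raddf0.
  by rewrite raddfB /= mprojXS IH.
exact: IH.
Qed.

Lemma kd_mproj0 ws (c : seq bool -> S) w : mproj 0 (kd (vars k ws) c w) = 0.
Proof.
elim: ws c w => [|v ws IH] c w /=; first by rewrite raddf0.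
case: w => [|[] w] /=; first by rewrite raddf0.
  by rewrite raddfB /= mprojX0 IH subr0.
exact: IH.
Qed.

Section Nakayama.
Variables (D : 'X_{1..n} -> Prop).
Hypothesis upD : upset D.
Let I := mono_ideal D : S -> Prop.

Let sI : submod (I : S^o -> Prop). Proof. exact: mono_ideal_submod. Qed.
Let I0 : I 0. Proof. by case: sI. Qed.
Let IB x y : I x -> I y -> I (x - y). Proof. exact: (submodB sI). Qed.
Let ID x y : I x -> I y -> I (x + y). Proof. by case: sI => _ + _; apply. Qed.
Let IM a x : I x -> I (a * x). Proof. by case: sI => _ _; apply. Qed.

(** Vanishing of the Koszul cohomology of S / I in degree i, on cocycles whose values
    are all homogeneous of the same degree; the induction on that degree is the graded
    Nakayama lemma. *)
Definition hvanish ws i := forall e c, cdeg i c -> (forall w, mproj e (c w) = c w) ->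
  (forall w, size w = size ws -> I (kd (vars k ws) c w)) -> cobnd (vars k ws) i I c.

Lemma cobnd_ideal s i (c : seq bool -> S) : (forall w, size w = size s -> I (c w)) ->
  cobnd s i I c.
Proof.
case: i => [//|i] Hc; exists (fun=> 0) => // w sw.
by rewrite kd0 subr0; apply: Hc.
Qed.

(** Put c on the words that begin with true: this is the image of c under the
    connecting map H^i (ws) -> H^(i+1) (v :: ws).  A cochain that bounds it gives both a
    and b. *)
Lemma cocycle_divide v ws i e c : hvanish (v :: ws) i.+1 -> cdeg i c ->
  (forall w, mproj e (c w) = c w) ->
  (forall w, size w = size ws -> I (kd (vars k ws) c w)) ->
  exists a b, [/\ cdeg i a, forall w, (count id w).+1 != i -> b w = 0 &
    forall w, size w = size ws -> I (kd (vars k ws) a w) /\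
      I (c w - ('X_v * a w - kd (vars k ws) b w))].
Proof.
move=> van ci he cc.
pose c' (w : seq bool) := if w is true :: w' then c w' else 0 : S.
have c'i : cdeg i.+1 c' by case=> [|[] w] //= cw; rewrite ci // -eqSS.
have c'h w : mproj e (c' w) = c' w by case: w => [|[] w] /=; rewrite ?raddf0 ?he.
have [|b bi Hb] := van e c' c'i c'h.
  case=> [|[] w] //= [sw]; last by rewrite kd0.
  by rewrite mulr0 sub0r -sub0r; apply: IB => //; apply: cc.
exists (fun w => b (false :: w)), (fun w => b (true :: w)); split=> [w cw|w cw|w sw].
- exact: bi.
- by apply: bi.
have := Hb (true :: w); rewrite /= size_map sw => /(_ erefl) H1; split=> //.
have := Hb (false :: w); rewrite /= size_map sw sub0r => /(_ erefl) H.
by rewrite -[kd _ _ _]opprK -sub0r; apply: IB.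
Qed.

(** By the long exact sequence that compares the complexes on ws and v :: ws, if
    H^(i+1) vanishes on the larger sequence then x_v acts surjectively on H^i of
    the smaller one; as x_v has degree one, H^i is zero. *)
Lemma hvanish_cons v ws i : hvanish (v :: ws) i.+1 -> hvanish ws i.
Proof.
move=> van; elim=> [|e IH] c ci he cc.
  have [a [b [_ _ Hab]]] := cocycle_divide van ci he cc.
  apply: cobnd_ideal => w; rewrite size_map => sw.
  have [_ /(mproj_ideal (e := 0%N))] := Hab w sw.
  by rewrite !mprojB he mprojX0 kd_mproj0 !subr0.
have [a [b1 [ai' b1i Hab]]] := cocycle_divide van ci he cc.
have Ka w : size w = size ws -> I (kd (vars k ws) a w) by move=> /Hab[].
have Kc w : size w = size ws -> I (c w - ('X_v * a w - kd (vars k ws) b1 w)).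
  by move=> /Hab[].
have Kc' w : size w = size ws ->
    I (c w - ('X_v * mproj e (a w) - kd (vars k ws) (mproj e \o b1) w)).
  move=> sw; have := mproj_ideal (e := e.+1) (Kc w sw).
  by rewrite !mprojB he mprojXS kd_mprojS.
have ai : cdeg i (mproj e \o a) by move=> w cw; rewrite /= ai' ?raddf0.
have : cobnd (vars k ws) i I (mproj e \o a).
  apply: IH => // [w|w sw].
    apply/mpolyP => m /=; rewrite !mcoeff_mproj. by case: eqP.
  by rewrite -kd_mprojS; apply: mproj_ideal; apply: Ka.
case: (i) b1i => [|j] b1i.
  move=> a'I w; rewrite size_map => sw; have sw' : size w = size (vars k ws) by rewrite size_map.
  rewrite -[c w](subrK ('X_v * mproj e (a w) - kd (vars k ws) (mproj e \o b1) w)).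
  apply: ID; first exact: Kc'.
  rewrite (eq_kd _ (c' := fun=> 0)) ?kd0 ?subr0; first by apply/IM/a'I.
  by move=> u _; rewrite /= b1i ?raddf0.
move=> [b2 b2j Hb2]; exists (fun w => 'X_v * b2 w - mproj e (b1 w)).
  move=> w cw; have -> : b1 w = 0 by apply: b1i; rewrite eqSS.
  by rewrite b2j // mulr0 raddf0 subr0.
move=> w; rewrite size_map => sw; have sw' : size w = size (vars k ws) by rewrite size_map.
rewrite kdB kdM.
have -> : c w - ('X_v * kd (vars k ws) b2 w - kd (vars k ws) (mproj e \o b1) w) =
    (c w - ('X_v * mproj e (a w) - kd (vars k ws) (mproj e \o b1) w)) +
    'X_v * (mproj e (a w) - kd (vars k ws) b2 w).
  by ring.
by apply: ID; [apply: Kc' | apply/IM/Hb2].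
Qed.

Lemma hvanish_cat ws1 ws2 i : hvanish (ws1 ++ ws2) (size ws1 + i) -> hvanish ws2 i.
Proof.
by elim: ws1 => [//|v ws1 IH] /hvanish_cons.
Qed.

End Nakayama.
End GradedPolynomials.

Section PolynomialDepth.
Variables (K : realType) (k : fieldType) (n : nat) (G : sgraph n).
Local Notation S := {mpoly k[n]}.
Local Notation I := (mono_ideal (edge_mono G) : S -> Prop).

(** The ideal I + (f_0, .., f_(t-1)), read in S / I. *)
Definition idl (f : seq S) t (p : S) := insum f t (pol_pi G p).

Lemma idl0 f p : idl f 0 p <-> I p.
Proof. by rewrite /idl insum_nil pol_pi_eq0. Qed.

Lemma idlS f t p : idl f t.+1 p <-> exists a, idl f t (p - f`_t * a).
Proof.
rewrite /idl insumS; split=> [[x [m' [Hm' e]]]|[a Ha]].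
  have [a ea] := pol_pi_surj x; exists a.
  by rewrite linearB /= [pol_pi G (_ * _)]linearZ /= -ea e addrC addKr.
exists (pol_pi G a), (pol_pi G (p - f`_t * a)); split=> //.
by rewrite linearB /= [pol_pi G (_ * _)]linearZ /= addrC subrK.
Qed.

Lemma idl_submod f t : submod (idl f t : S^o -> Prop).
Proof.
split=> [|p q Hp Hq|a p [y Hy]].
- by rewrite /idl linear0; exact: insum0.
- by rewrite /idl linearD; exact: insumD.
exists (fun j => a *: y j); rewrite linearZ /= Hy scaler_sumr.
by apply: eq_bigr => j _; rewrite !scalerA mulrC.
Qed.

Lemma regular_seqP (f : seq S) : regular_seq (pol_edge_quot k G) f <->
  (forall t p, (t < size f)%N -> idl f t (f`_t * p) -> idl f t p) /\
  (exists p, ~ idl f (size f) p).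
Proof.
have qP t : (t <= size f)%N -> forall m : pol_edge_quot k G,
    (quotmod_pi _ m = 0 :> quot_ideal (pol_edge_quot k G) [set` take t f]%classic)
    <-> insum f t m.
  by move=> tf m; apply: quot_take_eq0 tf m; apply: normal_seq_comm.
have qf := @quot_ideal_eq0 _ (pol_edge_quot k G) _ (@normal_seq_comm S f).
split=> [[reg [u nu]]|[reg [p np]]]; split.
- move=> t p tf Hp; apply/(qP _ (ltnW tf)); apply: reg => //.
  by rewrite -quotmod_piZ; apply/(qP _ (ltnW tf)); rewrite -linearZ.
- have [m em] := quotmod_piP u; have [p ep] := pol_pi_surj m; exists p.
  by move=> Hp; case/eqP: nu; rewrite em ep; apply/qf.
- move=> t tf u; have [m ->] := quotmod_piP u; have [p' ->] := pol_pi_surj m.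
  rewrite -quotmod_piZ => /(qP _ (ltnW tf)) H.
  by apply/(qP _ (ltnW tf)); apply: reg => //; rewrite /idl [pol_pi G (_ * _)]linearZ.
exists (quotmod_pi _ (pol_pi G p)); apply/eqP => H; apply: np.
by apply/qf.
Qed.

Variable B : {set 'I_n}.
Hypothesis B_edge : forall i j, G i j -> (i \in B) != (j \in B).
Hypothesis no_iso : no_isolated G.

(** If f were longer than the side opposite to B, the Koszul cohomology on all the
    variables would vanish in a degree equal to the size of that side.  Dropping the
    variables of that side leaves H^0 = 0 on the variables of B, which contradicts the
    monomial of the side, nonzero and killed by the variables of B. *)
Lemma regular_seq_size (f : seq S) :
  {subset f <= ideal_gen (range (fun i => 'X_i : S))} ->
  regular_seq (pol_edge_quot k G) f -> (size f <= #|~: B|)%N.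
Proof.
move=> f_max /regular_seqP[reg _]; rewrite leqNgt; apply/negP => sf.
pose ws := enum (~: B) ++ enum B.
have all_ws i : i \in ws by rewrite mem_cat !mem_enum inE orNb.
have idl_incl t p : idl f t p -> idl f t.+1 p.
  by move=> Hp; apply/idlS; exists 0; rewrite mulr0 subr0.
have f_in t : (t < size f)%N -> exists g : nat -> S,
    f`_t = \sum_(j < size (vars k ws)) (vars k ws)`_j * g j.
  move=> tf; suff : insum (N := S^o) (vars k ws) (size (vars k ws)) f`_t.
    by move=> [y ey]; exists y.
  elim/span_ind: _ / (f_max _ (mem_nth 0 tf)) => [|p q|a p|_ [_ [b [[i _ <-] ->]]]].
  - exact: insum0.
  - exact: insumD.
  - by apply: insumZ => //; apply: normal_seq_comm.
  have iws : (index i ws < size ws)%N by rewrite index_mem.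
  rewrite -[i in 'X_i](nth_index i (all_ws i)) -(nth_map i 0 (fun i => 'X_i)) //.
  by apply: insum_gen; rewrite size_map.
have van : hvanish k (edge_mono G) ws (size (enum (~: B)) + 0)%N.
  rewrite addn0 => e c ci _ cc.
  have vanJ := @koszul_vanish _ (vars k ws) (size f) (fun t => f`_t) (idl f)
    (idl_submod f) _ idl_incl _ reg f_in (size (enum (~: B))) 0%N c.
  have I0 : mono_ideal (edge_mono G) = idl f 0.
    by apply/funext => p; apply/propext; rewrite idl0.
  rewrite I0; apply: vanJ => //.
  - by move=> t p tf /idlS.
  - by move=> t a; apply/idlS; exists a; rewrite subrr /idl linear0; exact: insum0.
  - by rewrite addn0 -cardE.
  - by move=> w; rewrite size_map -I0; apply: cc.
have := hvanish_cat (@edge_mono_up _ G) van.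
pose mA := side_mon B.
pose c w : S := if count id w == 0%N then 'X_[mA] else 0.
move=> /(_ (mdeg mA) c) H; apply: (@side_mon_neq0 k _ _ _ B_edge); apply/pol_pi_eq0.
have -> : 'X_[mA] = c (nseq (size (enum B)) false) by rewrite /c count_nseq.
apply: H; last by rewrite size_nseq size_map.
- by move=> w; rewrite /c => /negPf ->.
- move=> w; rewrite /c; case: eqP => _; last by rewrite raddf0.
  apply/mpolyP => m; rewrite mcoeff_mproj.
  by rewrite mcoeffX; case: (mA =P m) => [->|_]; rewrite ?eqxx // if_same.
move=> w sw; apply: (kd_ideal (mono_ideal_submod k (@edge_mono_up _ G)));
  last by rewrite size_map.
move=> j v; rewrite !size_map => jB _; rewrite /c.
case: ifP => _; last by rewrite mulr0 => m; rewrite mcoeff0 eqxx.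
have [i0 _] : exists i : 'I_n, i \in enum B.
  by case: (enum B) jB => // i l _; exists i; rewrite inE eqxx.
rewrite (nth_map i0) //; set b := nth i0 _ j.
apply/pol_pi_eq0; apply: (side_mon_kill k B_edge no_iso).
by rewrite -mem_enum mem_nth.
Qed.

Lemma depthS_upper : (depthS K k G <= (#|~: B|%:R)%:E)%E.
Proof.
apply: ge_ereal_sup => _ [f [f_max reg] <-]; rewrite lee_fin ler_nat.
exact: regular_seq_size.
Qed.

End PolynomialDepth.

(** * Bounding Betti numbers from above *)

Section HomologyBound.
Variables (k : fieldType) (n : nat).
Local Notation E := (exterior k n).
Local Notation e := (@ext_gen k n).
Local Notation mon := 'X_{1..n}.
Implicit Types (A B W : {set 'I_n}) (F : {set 'I_n} -> Prop).

(** The elements without monomials in F; when F is the set of faces of a simplicial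
    complex this is its Stanley-Reisner ideal in the exterior algebra. *)
Definition nonface_ideal F (x : E^o) := forall A, F A -> (x : E) A = 0.

Definition down_closed F := forall A B, B \subset A -> F A -> F B.

Lemma nonface_submod F : down_closed F -> submod (nonface_ideal F).
Proof.
move=> dF; split=> [A _|x y Hx Hy A FA|a x Hx A FA].
- by rewrite ffunE.
- by rewrite ffunE Hx ?Hy ?addr0.
rewrite ffunE big1 // => B sBA; rewrite Hx ?mulr0 //.
by apply: dF FA; rewrite subsetDl.
Qed.

(** The homology of the complex of E^o / J in degree t has dimension at most R:
    every finite family of cycles has at most R coordinates that detect the
    boundaries among its linear combinations. *)
Definition homology_le t (J : E^o -> Prop) R := forall m (z : 'I_m -> mon -> E^o),
  (forall j, cyc t J (z j)) -> exists R' (Phi : 'M[k]_(m, R')), (R' <= R)%N /\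
    forall a, a *m Phi = 0 -> bnd t J (lincomb a z).

Lemma indep_leq_homology t J R m (z : 'I_m -> mon -> E^o) :
  homology_le t J R -> indep t J z -> (m <= R)%N.
Proof.
move=> HR [cz iz]; have [R' [Phi [R'R HPhi]]] := HR m z cz.
apply: leq_trans R'R.
suff /eqP <- : row_free Phi by apply: rank_leq_col.
by apply: inj_row_free => a /HPhi; apply: iz.
Qed.

Section Extension.
Variables (u : 'I_n) (F : {set 'I_n} -> Prop).
Hypothesis dF : down_closed F.

Let link A := u \notin A /\ F (u |: A).
Let del A := u \notin A /\ F A.
Let J := nonface_ideal F.

Let sJ : submod J. Proof. exact: nonface_submod. Qed.

Let gen_link (x : E) : J (e u * x) <-> nonface_ideal link x.
Proof.
split=> [H A [uA FA]|H A FA].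
  have := H _ FA; rewrite [X in X = 0 -> _]ext_gen_mulE setU11 setU1K // => /eqP.
  by rewrite mulf_eq0 signr_eq0 => /eqP.
rewrite [LHS]ext_gen_mulE; case: ifP => // uA.
by rewrite H ?mulr0 //; split; rewrite ?setD11 // setD1K.
Qed.

Let del_div (x : E) : nonface_ideal del x -> J (x - e u * contr u x : E).
Proof.
move=> H A FA; rewrite extB ext_gen_mulE contrE; case: ifP => uA; last first.
  by rewrite subr0 H //; split; rewrite ?uA.
by rewrite setD11 signr_sqr_id setD1K // subrr.
Qed.

Lemma dcar_gen (z : mon -> E) mu :
  dcar (fun nu => (e u * z nu : E^o)) mu = - (e u * (dcar (z : mon -> E^o) mu : E)).
Proof.
rewrite /dcar mulr_sumr -sumrN; apply: eq_bigr => i _.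
by rewrite [LHS]mulrA ext_gen_anticomm mulNr -mulrA.
Qed.

(** Long exact sequence of 0 -> E / (J : e_u) -> E / J -> E / (J + (e_u)) -> 0; for a
    Stanley-Reisner ideal the outer ideals are those of the link and of the deletion
    of u. *)
Lemma homology_ext t R R' : homology_le t (nonface_ideal link) R ->
  homology_le t (nonface_ideal del) R' -> homology_le t J (R + R').
Proof.
have [J0 JD JM] := sJ; have JB x y := @submodB _ _ J x y sJ.
move=> Hlink Hdel m z cz.
have [|R2 [Phi2 [R2le HPhi2]]] := Hdel m z.
  by move=> j mu tmu A [_ FA]; apply: cz FA.
(* The combinations of the z j that bound modulo e_u, on which the link is tested. *)
pose Ker := kermx Phi2.
have /choice[y Hy] l : exists y, forall mu, mdeg mu = t ->
    nonface_ideal del (lincomb (row l Ker) z mu - dcar y mu).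
  by apply: HPhi2; rewrite -row_mul mulmx_ker row0.
pose r l mu : E := lincomb (row l Ker) z mu - dcar (y l) mu.
pose v l mu : E^o := contr u (r l mu).
have Jrv l mu : mdeg mu = t -> J (r l mu - e u * v l mu).
  by move=> tmu; apply: del_div; apply: Hy.
have cv l : cyc t (nonface_ideal link) (v l).
  move=> mu tmu; apply/gen_link.
  have -> : e u * dcar (v l) mu = (dcar (fun nu => (r l nu - e u * v l nu : E^o)) mu -
      dcar (fun nu => (r l nu : E^o)) mu : E).
    by rewrite (dcarB (N := E^o)) dcar_gen opprK addrAC subrr add0r.
  apply: JB; first by apply: dcar_submod => // i; apply: Jrv; rewrite mdegD mdeg1 addn1.
  rewrite (dcarB (N := E^o)) dcarK subr0 dcar_lincomb; apply: submod_sum => // j _.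
  by apply: JM; apply: cz.
have [R1 [Phi1 [R1le HPhi1]]] := Hlink m v cv.
exists (R2 + R1)%N, (row_mx Phi2 (pinvmx Ker *m Phi1)); split.
  by rewrite addnC leq_add.
move=> a; rewrite mul_mx_row => /eqP; rewrite row_mx_eq0 => /andP[/eqP a2 /eqP].
have aK : (a <= Ker)%MS by apply/sub_kermxP.
pose b := a *m pinvmx Ker; rewrite mulmxA -/b => /HPhi1[w Hw].
have bK : b *m Ker = a by rewrite /b mulmxKpV.
exists (fun mu => \sum_l (b 0 l)%:A *: y l mu - e u * w mu) => mu tmu.
have ez : lincomb a z mu = \sum_l (b 0 l)%:A *: lincomb (row l Ker) z mu :> E^o.
  rewrite -bK /lincomb; under [RHS]eq_bigr => l _ do rewrite scaler_sumr.
  rewrite exchange_big; apply: eq_bigr => j _ /=.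
  rewrite mxE scaler_suml scaler_suml; apply: eq_bigr => l _.
  by rewrite [row _ _ _ _]mxE [RHS]scalerA -[in RHS]scalerAl mul1r scalerA.
have e1 : dcar (fun mu => \sum_l (b 0 l)%:A *: y l mu - e u * w mu : E^o) mu =
    \sum_l (b 0 l)%:A *: dcar (y l) mu + e u * (dcar (w : mon -> E^o) mu : E) :> E.
  by rewrite (dcarB (N := E^o)) dcar_gen dcar_sum opprK.
have e2 : \sum_l (b 0 l)%:A *: (r l mu - e u * v l mu : E^o) =
    \sum_l (b 0 l)%:A *: (r l mu : E^o) - e u * (lincomb b v mu : E) :> E.
  rewrite mulr_sumr -sumrB; apply: eq_bigr => l _; rewrite scalerBr; congr (_ - _).
  by rewrite [LHS]mulrA scaleA_comm -mulrA.
have e3 : \sum_l (b 0 l)%:A *: (r l mu : E^o) =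
    lincomb a z mu - \sum_l (b 0 l)%:A *: dcar (y l) mu :> E.
  by rewrite ez -sumrB; apply: eq_bigr => l _; rewrite -scalerBr.
have -> : lincomb a z mu - dcar (fun mu => \sum_l (b 0 l)%:A *: y l mu - e u * w mu : E^o) mu =
    \sum_l (b 0 l)%:A *: (r l mu - e u * v l mu : E^o) +
    (e u * (lincomb b v mu - dcar (w : mon -> E^o) mu : E) : E^o) :> E.
  by rewrite e1 e2 e3 mulrBr opprD !addrA subrK.
apply: JD; last by apply/gen_link/Hw.
by apply: submod_sum => // l _; apply/JM/Jrv.
Qed.

End Extension.

Section VariableQuotient.
Variables (W : {set 'I_n}) (w0 : 'I_n).

Let off A := [disjoint A & W] : Prop.
Let J := nonface_ideal off.

Let sJ : submod J.
Proof.
apply: nonface_submod => A B sBA; apply: disjointWl; exact: sBA.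
Qed.

(** Subtracts the boundary that h_j provides; it removes from the cycle all terms
    that involve y_j or e_j. *)
Definition reduce_step j (z : mon -> E^o) mu : E^o :=
  z mu - dcar (hcar (N := E^o) (@contr k n) j z) mu.

Definition reduce s z := foldr reduce_step z s.

Lemma reduce_lincomb s m (a : 'rV[k]_m) (z : 'I_m -> mon -> E^o) mu :
  reduce s (lincomb a z) mu = lincomb a (fun j => reduce s (z j)) mu.
Proof.
elim: s mu => [//|i s IH] mu /=; rewrite /reduce_step IH.
rewrite (eq_dcar (z' := lincomb a (fun j => hcar (N := E^o) (@contr k n) i (reduce s (z j))))).
  rewrite dcar_lincomb -sumrB; apply: eq_bigr => j _; by rewrite scalerBr.
move=> l; rewrite /hcar IH; case: ifPn => mul; last first.
  by rewrite /lincomb big1 // => j _; rewrite (negPf mul) scaler0.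
rewrite /lincomb raddf_sum; apply: eq_bigr => j _; rewrite mul.
have aE (b : k) (x : E) : (b%:A *: (x : E^o) : E) = b *: x.
  by rewrite -[RHS]mul1r -scalerAr scalerAl.
by rewrite !aE; exact: contrZ.
Qed.

Lemma contr_off j (x : E) : j \notin W -> J x -> J (contr j x).
Proof.
move=> jW Hx A offA; rewrite [LHS]contrE; case: ifP => // jA.
by rewrite Hx ?mulr0 // /off disjoints_subset subUset sub1set inE jW -disjoints_subset.
Qed.

(** E / (e_w : w in W) is the exterior algebra on the other variables, whose
    contractions are still available: a cycle is homologous to one that involves no
    e_j nor y_j with j outside of W. *)
Lemma reduce_spec (s : seq 'I_n) z : {subset s <= ~: W} -> (forall mu, J (dcar z mu)) ->
  [/\ forall mu, J (dcar (reduce s z) mu),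
      exists v, forall mu, reduce s z mu = z mu - dcar v mu &
      forall j (mu : mon) A, j \in s -> [disjoint A & W] -> (0 < mu j)%N || (j \in A) ->
        (reduce s z mu : E) A = 0].
Proof.
move=> + cz; elim: s => [|j s IH] sW.
  by split=> //; exists (fun=> 0) => mu; rewrite /dcar big1 ?subr0 // => i _; rewrite scaler0.
have [|c1 [v Hv] H] := IH; first by move=> i si; apply: sW; rewrite inE si orbT.
have jW : j \notin W by have := sW j; rewrite !inE eqxx => /(_ isT).
have cB i : zmod_morphism (@contr k n i) by exact: contr_is_additive.
have cE : forall i j (x : E^o),
    contr j (e i *: x) = (if i == j then x else 0) - e i *: (contr j x : E^o) :> E^o.
  by move=> i j' x; exact: contr_gen.
split=> [mu||i mu A].
- by rewrite /= /reduce_step (dcarB (N := E^o)) dcarK subr0.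
- exists (fun mu => v mu + hcar (N := E^o) (@contr k n) j (reduce s z) mu) => mu.
  by rewrite /= /reduce_step {1}Hv (dcarD (N := E^o)) opprD addrA.
move=> ijs offA; rewrite /= /reduce_step; case: (posnP (mu j)) => muj.
  rewrite (hcar_zero _ _ muj) extB [X in _ - X]ext_gen_mulE contrE.
  case: (boolP (j \in A)) => jA.
    by rewrite setD11 signr_sqr_id setD1K // subrr.
  rewrite subr0 => mui; apply: (H i) => //; move: ijs mui; rewrite inE.
  by case: eqVneq => [->|//]; rewrite muj (negPf jA).
move=> _; rewrite (@hcar_pos _ _ E^o (@contr k n) cB cE _ _ _ muj).
by apply: (contr_off jW (c1 _) offA).
Qed.

(** The monomials of degree t in the y_w, w in W, counted by their exponents outside
    of w0; the exponent of w0 is then determined. *)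
Definition mon_of t (f : {ffun 'I_n -> 'I_t.+1}) : mon :=
  [multinom if i == w0 then t - \sum_(l | l != w0) f l else (f i : nat) | i < n]%N.

Lemma mon_of_surj t mu : mdeg mu = t -> (forall i, i \notin W -> mu i = 0%N) ->
  exists2 f, f \in pffun_on ord0 (W :\ w0) predT & mon_of (t := t) f = mu.
Proof.
move=> tmu muW; pose f : {ffun 'I_n -> 'I_t.+1} :=
  [ffun i => inord (if i == w0 then 0 else mu i)%N].
have fE i : i != w0 -> f i = mu i :> nat.
  move=> ne; rewrite ffunE (negPf ne) inordK // ltnS -tmu mdegE (bigD1 i) //=.
  exact: leq_addr.
exists f.
  apply/pffun_onP; split=> //; apply/supportP => i; rewrite !inE negb_and negbK.
  case/orP=> [/eqP ->|iW]; rewrite ffunE ?eqxx; first by apply: val_inj; rewrite /= inordK.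
  by rewrite muW // if_same; apply: val_inj; rewrite /= inordK.
apply/mnmP => i; rewrite mnmE; case: eqVneq => [->|/fE //].
by rewrite (eq_bigr (fun l => mu l)) // -{1}tmu mdegE (bigD1 w0) //= addnK.
Qed.

(** Reduced cycles are given by their coefficients on the monomials of degree t in the
    y_w with w in W. *)
Lemma homology_vars t : homology_le t J (t.+1 ^ #|W :\ w0|).
Proof.
have [J0 JD JM] := sJ; move=> m z cz; pose s := enum (~: W).
have sW : {subset s <= ~: W} by move=> i; rewrite mem_enum.
pose P := pffun_on (ord0 : 'I_t.+1) (W :\ w0) predT.
exists #|P|, (\matrix_(j < m, c < #|P|)
  (reduce s (trunc t (z j)) (mon_of (enum_val c)) : E) set0).
split; first by rewrite card_pffun_on card_ord.
move=> a aPhi; pose u := lincomb a (fun j => trunc t (z j)).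
have cu mu : J (dcar u mu).
  rewrite dcar_lincomb; apply: submod_sum => // j _; apply: JM.
  exact: dcar_trunc.
have [_ [v Hv] red0] := reduce_spec sW cu.
exists v => mu tmu; have -> : lincomb a z mu = u mu.
  by apply: eq_bigr => j _; rewrite /trunc tmu eqxx.
rewrite -Hv => A offA.
have [A0|[j jA]] := set_0Vmem A; last first.
  apply: (red0 j) => //; last by rewrite jA orbT.
  by rewrite mem_enum inE; apply: contraL jA => jW; rewrite (disjointFl offA).
have [/existsP[j /andP[jW muj]]|/existsPn muW] := boolP [exists j, (j \notin W) && (0 < mu j)%N].
  by apply: (red0 j) => //; rewrite ?muj // mem_enum inE.
have [|f fP <-] := @mon_of_surj t mu tmu.
  by move=> i iW; have := muW i; rewrite iW /= -leqNgt leqn0 => /eqP.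
rewrite A0 -(enum_rankK_in fP fP) reduce_lincomb sum_ffunE.
have := congr1 (fun M : 'rV_#|P| => M 0 (enum_rank_in fP f)) aPhi; rewrite !mxE => H.
rewrite -[RHS]H; apply: eq_bigr => j _; rewrite mxE.
by rewrite -[LHS]/((_ *: 1 * _ : E) _) -scalerAl mul1r ffunE.
Qed.

End VariableQuotient.

End HomologyBound.

(** * The double star *)

Section DoubleStar.
Variable n' : nat.
Local Notation n := n'.+2.

(** Two adjacent centres 0 and 1, the odd vertices being leaves at 0 and the even
    ones leaves at 1. *)
Definition dstar_rel : rel 'I_n := fun i j => (odd i != odd j) && (minn i j < 2)%N.

Lemma dstar_sym : symmetric dstar_rel.
Proof. by move=> i j; rewrite /dstar_rel eq_sym minnC. Qed.

Lemma dstar_irr : irreflexive dstar_rel.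
Proof. by move=> i; rewrite /dstar_rel eqxx. Qed.

Definition dstar : sgraph n := SGraph dstar_sym dstar_irr.

Lemma dstar_bipartite : bipartite dstar.
Proof. by exists (fun i => odd i) => i j /andP[]. Qed.

Definition vx (i : nat) : 'I_n := inord i.

Lemma vxE i : (i < n)%N -> vx i = i :> nat.
Proof. by move=> ni; rewrite inordK. Qed.

Lemma vx0 : vx 0 = 0%N :> nat. Proof. exact: vxE. Qed.
Lemma vx1 : vx 1 = 1%N :> nat. Proof. exact: vxE. Qed.

Lemma dstar0 i : dstar (vx 0) i = odd i.
Proof. by rewrite /= /dstar_rel vx0 min0n /= andbT; case: odd. Qed.

Lemma dstar1 i : dstar (vx 1) i = ~~ odd i.
Proof.
rewrite /= /dstar_rel vx1 /=; case: (odd i) => //=.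
by rewrite gtn_min.
Qed.

Lemma dstar_leaf (i j : 'I_n) : (1 < i)%N -> dstar i j -> j = vx (~~ odd i).
Proof.
move=> i1 /andP[oij]; rewrite gtn_min ltnNge i1 /= => j2; apply: val_inj.
rewrite /= vxE; last by case: (odd i).
by case: (j : nat) j2 oij => [|[|]] //=; case: (odd i).
Qed.

Lemma dstar_no_isolated : no_isolated dstar.
Proof.
move=> i; exists (vx (~~ odd i)); rewrite adj_sym.
by case: (boolP (odd i)) => oi; [rewrite dstar0 | rewrite dstar1].
Qed.

Definition odds : {set 'I_n} := [set i : 'I_n | odd i].
Definition evens : {set 'I_n} := [set i : 'I_n | ~~ odd i].

End DoubleStar.

Lemma card_odds (n : nat) : #|[set i : 'I_n | odd i]| = n./2.
Proof.
rewrite -sum1dep_card big_mkcond; elim: n => [|n IH]; first by rewrite big_ord0.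
by rewrite big_ord_recr /= IH addnC uphalf_half; case: odd.
Qed.

Lemma card_evens (n : nat) : #|[set i : 'I_n | ~~ odd i]| = uphalf n.
Proof.
have := cardsC [set i : 'I_n | odd i]; rewrite card_ord card_odds => e.
have -> : [set i : 'I_n | ~~ odd i] = ~: [set i : 'I_n | odd i].
  by apply/setP => i; rewrite !inE.
by rewrite uphalf_half; move: e; have := odd_double_half n; lia.
Qed.

Section DoubleStarExterior.
Variables (K : realType) (k : fieldType) (n' : nat).
Local Notation n := n'.+2.
Local Notation E := (exterior k n).
Local Notation e := (@ext_gen k n).
Local Notation mon := 'X_{1..n}.
Local Notation G := (dstar n').
Local Notation vx := (@vx n').
Implicit Types (A : {set 'I_n}) (x : E).

Definition part1 x : E := [ffun A : {set 'I_n} => if vx 1 \in A then x A else 0].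

Lemma part1E x A : part1 x A = if vx 1 \in A then x A else 0.
Proof. by rewrite ffunE. Qed.

Lemma part1_gen i x : i != vx 1 -> part1 (e i * x) = e i * part1 x.
Proof.
move=> i1; apply/ffunP => A; rewrite part1E !ext_gen_mulE part1E !inE eq_sym i1 /=.
by case: (vx 1 \in A); case: (i \in A); rewrite ?mulr0.
Qed.

Lemma part1_is_additive : zmod_morphism part1.
Proof. by move=> x y; apply/ffunP => A; rewrite !ffunE; case: ifP; rewrite ?subr0. Qed.

HB.instance Definition _ := GRing.isZmodMorphism.Build E E part1 part1_is_additive.

(** E / I is a direct sum of two modules over the exterior algebra on the leaves,
    spanned by the monomials with or without e_1.  The first is free over the e_j
    with j odd, the second over those with j even; hence these contractions. *)
Definition leaf_contr j x : E :=
  contr (vx j.*2) (x - part1 x) + contr (vx j.*2.+1) (part1 x).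

Lemma leaf_contr_is_additive j : zmod_morphism (leaf_contr j).
Proof.
move=> x y; have cB i a b : contr i (a - b) = contr i a - contr i b :> E by exact: raddfB.
have ac (a b c d : E) : a - b - (c - d) = (a - c) - (b - d).
  by rewrite !opprB addrACA [RHS]addrACA; congr (_ + _); rewrite addrC.
rewrite /leaf_contr (_ : part1 (x - y) = part1 x - part1 y); last exact: raddfB.
by rewrite ac [contr _ (_ - _ - _)]cB [contr _ (part1 x - _)]cB opprD addrACA.
Qed.

HB.instance Definition _ j :=
  GRing.isZmodMorphism.Build E E (leaf_contr j) (leaf_contr_is_additive j).

Definition leaf_form j : E := e (vx j.*2) + e (vx j.*2.+1).

Lemma contr_leaf_form i j (b : bool) x : (i.*2.+1 < n)%N -> (j.*2.+1 < n)%N ->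
  contr (vx (i.*2 + b)) (leaf_form j * x) =
  (if i == j then x else 0) - leaf_form j * contr (vx (i.*2 + b)) x.
Proof.
move=> ni nj; rewrite /leaf_form mulrDl raddfD /= !contr_gen mulrDl opprD addrACA.
congr (_ + _); rewrite -!val_eqE /= !vxE; [|lia..].
case: b; rewrite ?addn1 ?addn0.
  have -> : (j.*2 == i.*2.+1) = false by lia.
  have -> : (j.*2.+1 == i.*2.+1) = (i == j) by lia.
  by rewrite add0r.
have -> : (j.*2 == i.*2) = (i == j) by lia.
have -> : (j.*2.+1 == i.*2) = false by lia.
by rewrite addr0.
Qed.

Lemma part1_leaf_form j x : (0 < j)%N -> (j.*2.+1 < n)%N ->
  part1 (leaf_form j * x) = leaf_form j * part1 x.
Proof.
move=> j0 nj; rewrite /leaf_form !mulrDl raddfD /= !part1_gen //.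
  by rewrite -val_eqE /= !vxE //; lia.
by rewrite -val_eqE /= !vxE //; lia.
Qed.

Lemma leaf_contrE i j x : (0 < j)%N -> (i.*2.+1 < n)%N -> (j.*2.+1 < n)%N ->
  leaf_contr i (leaf_form j * x) =
  (if i == j then x else 0) - leaf_form j * leaf_contr i x.
Proof.
move=> j0 ni nj; rewrite /leaf_contr part1_leaf_form // -mulrBr.
have := @contr_leaf_form i j false (x - part1 x) ni nj; rewrite addn0 => ->.
have := @contr_leaf_form i j true (part1 x) ni nj; rewrite addn1 => ->.
rewrite mulrDr opprD addrACA; congr (_ + _).
by case: eqP => _; rewrite ?subrK ?addr0.
Qed.

Lemma leaf_contr_ideal j x : (0 < j)%N -> (j.*2.+1 < n)%N ->
  ext_edge_ideal G x -> ext_edge_ideal G (leaf_contr j x).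
Proof.
move=> j0 nj Ix A iA.
have extD (y z : E) : (y + z) A = y A + z A by rewrite ffunE.
have zE : vx j.*2 = j.*2 :> nat by rewrite vxE //; lia.
have wE : vx j.*2.+1 = j.*2.+1 :> nat by rewrite vxE.
have leaf (i : 'I_n) : (1 < i)%N -> vx (~~ odd i) \notin A -> indep_set G (i |: A).
  move=> i1 nA x' y'; rewrite !inE => /orP[/eqP ->|x'A] /orP[/eqP ->|y'A].
  - by rewrite adj_irr.
  - by apply: contra nA => /(dstar_leaf i1) <-.
  - by rewrite adj_sym; apply: contra nA => /(dstar_leaf i1) <-.
  - exact: iA.
rewrite extD [X in X + _]contr_eq0 ?add0r; last first.
  move=> _; rewrite extB part1E; case: ifPn => A1; rewrite ?subrr // subr0; apply: Ix.
  apply: leaf; first by rewrite zE; lia.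
  rewrite zE odd_double; apply: contra A1; rewrite !inE => ->; exact: orbT.
apply: contr_eq0 => _; rewrite part1E; case: ifPn => // A1; apply: Ix.
apply: leaf; first by rewrite wE; lia.
have A1' : vx 1 \in A.
  move: A1; rewrite !inE -val_eqE /= vx1 wE; case: eqP => //; lia.
rewrite wE /= odd_double /=; apply/negP => A0.
by have := iA _ _ A0 A1'; rewrite dstar0 vx1.
Qed.

Local Notation p := (n'./2).
Definition leaf_seq : seq E := [seq leaf_form j | j <- iota 1 p].

Lemma leaf_seqE j : (j < p)%N -> leaf_seq`_j = leaf_form j.+1.
Proof. by move=> jp; rewrite (nth_map 0%N) ?size_iota // nth_iota // add1n. Qed.

Lemma leaf_bound j : (j < p)%N -> (j.+1.*2.+1 < n)%N.
Proof. by move=> jp; have := odd_double_half n'; lia. Qed.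

Lemma leaf_seq_linear : linear_forms leaf_seq.
Proof.
move=> j; rewrite size_map size_iota => jp; rewrite leaf_seqE // => A; rewrite !ffunE.
case: (A =P [set vx j.+1.*2]%SET) => [->|_]; first by rewrite cards1.
case: (A =P [set vx j.+1.*2.+1]%SET) => [->|_]; first by rewrite cards1.
by rewrite addr0 eqxx.
Qed.

(** Contraction with the j-th form preserves I and anticommutes with the other forms,
    so it turns a relation l_i m in (l_1, .., l_(i-1)) M into one that expresses m. *)
Lemma leaf_seq_regular : ext_regular_seq (ext_edge_quot k G) leaf_seq.
Proof.
have ds := leaf_seq_linear; have ns := normal_linear_forms ds.
move=> i si; split; first exact: ds.
have ip : (i < p)%N by move: si; rewrite size_map size_iota.
apply/(ext_regularP _ _ ns (ltnW si)) => m; split=> [[y ey]|[m' Hm']]; last first.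
  rewrite -[m](subrK (leaf_seq`_i *: m')) scalerDr scalerA ext_deg1_sqr ?scale0r ?addr0.
    by apply: insumZ => //; apply: ltnW.
  exact: ds.
have [x ex] := ext_pi_surj m; have [u Hu] := choice (fun j => ext_pi_surj (y j)).
pose h := leaf_contr i.+1; exists (ext_pi G (h x)), (fun j => - ext_pi G (h (u j))).
have Ix : ext_edge_ideal G (leaf_form i.+1 * x - \sum_(j < i) leaf_form j.+1 * u j).
  apply/ext_pi_eq0; rewrite raddfB raddf_sum /=; apply/eqP; rewrite subr_eq0; apply/eqP.
  move: ey; rewrite leaf_seqE // ex -linearZ /= => ->; apply: eq_bigr => j _.
  by rewrite leaf_seqE ?(ltn_trans _ ip) // Hu -linearZ.
have ni := leaf_bound ip.
have := leaf_contr_ideal (isT : (0 < i.+1)%N) ni Ix.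
rewrite (raddfB (leaf_contr i.+1)) (raddf_sum (leaf_contr i.+1)) /= leaf_contrE // eqxx.
have -> : \sum_(j < i) leaf_contr i.+1 (leaf_form j.+1 * u j) =
    - \sum_(j < i) leaf_form j.+1 * h (u j).
  rewrite -sumrN; apply: eq_bigr => j _.
  have jp : (j < p)%N := ltn_trans (ltn_ord j) ip.
  rewrite leaf_contrE ?leaf_bound //.
  by rewrite eqSS gtn_eqF // sub0r.
rewrite opprK => /ext_pi_eq0.
rewrite (raddfD (ext_pi G)) (raddfB (ext_pi G)) (raddf_sum (ext_pi G)) /= => /eqP.
rewrite ex leaf_seqE // addr_eq0 => /eqP e1.
rewrite -linearZ /= [LHS]e1 -sumrN; apply: eq_bigr => j _.
by rewrite leaf_seqE ?(ltn_trans _ ip) // scalerN -linearZ.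
Qed.

Lemma depthE_dstar : ((n./2%:R - 1)%:E <= depthE K k G)%E.
Proof.
apply: ereal_sup_ubound; exists leaf_seq; first exact: leaf_seq_regular.
by rewrite size_map size_iota /= -[n'./2.+1%:R]natr1 addrK.
Qed.

(** The filtration of E / I by E / (e_i : i = 0 or odd), E / (e_i : i = 1 or even) and
    E / (e_0, e_1), obtained by removing the centres one after the other. *)
Lemma dstar_homology t : homology_le t (@ext_edge_ideal k n G : E^o -> Prop)
  (3 * t.+1 ^ uphalf n).
Proof.
have downI : down_closed (indep_set G) by move=> A B; exact: indep_subset.
pose F0 (A : {set 'I_n}) := vx 0 \notin A /\ indep_set G A.
have downF0 : down_closed F0.
  move=> A B sBA [A0 iA]; split; last exact: downI iA.
  by apply: contra A0; apply: (subsetP sBA).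
have vx01 : vx 0 != vx 1 by rewrite -val_eqE /= vx0 vx1.
have face (P P' : {set 'I_n} -> Prop) : (forall A, P A <-> P' A) ->
    nonface_ideal (k := k) P = nonface_ideal P'.
  by move=> PP'; congr nonface_ideal; apply/funext => A; apply/propext.
have link0 : homology_le t (nonface_ideal (k := k) (fun A => vx 0 \notin A /\
    indep_set G (vx 0 |: A))) (t.+1 ^ n./2).
  rewrite (face _ (fun A => [disjoint A & vx 0 |: odds n'])) => [|A].
    have := @homology_vars k n (vx 0 |: odds n') (vx 0) t.
    by rewrite setU1K ?card_odds // inE vx0.
  rewrite disjoint_sym disjoint_subset; split=> [[A0 iA]|/subsetP dA].
    apply/subsetP => i; rewrite !inE => /orP[/eqP -> //|oi]; apply/negP => iA'.
    by have := iA (vx 0) i; rewrite setU11 !inE iA' orbT dstar0 oi => /(_ isT isT).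
  split; first by have := dA (vx 0) (setU11 _ _); rewrite inE.
  have ev i : i \in vx 0 |: A -> ~~ odd i.
    rewrite !inE => /orP[/eqP ->|]; first by rewrite vx0.
    by apply: contraL => oi; apply: dA; rewrite !inE oi orbT.
  by move=> i j /ev/negPf oi /ev/negPf oj; apply/negP => /andP[]; rewrite oi oj.
have link1 : homology_le t (nonface_ideal (k := k) (fun A => vx 1 \notin A /\
    F0 (vx 1 |: A))) (t.+1 ^ uphalf n).
  rewrite (face _ (fun A => [disjoint A & vx 1 |: evens n'])) => [|A].
    have := @homology_vars k n (vx 1 |: evens n') (vx 1) t.
    by rewrite setU1K ?card_evens // inE vx1.
  rewrite disjoint_sym disjoint_subset; split=> [[A1 [_ iA]]|/subsetP dA].
    apply/subsetP => i; rewrite !inE => /orP[/eqP -> //|oi]; apply/negP => iA'.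
    by have := iA (vx 1) i; rewrite setU11 !inE iA' orbT dstar1 oi => /(_ isT isT).
  split; first by have := dA (vx 1) (setU11 _ _); rewrite inE.
  have od i : i \in vx 1 |: A -> odd i.
    rewrite !inE => /orP[/eqP ->|]; first by rewrite vx1.
    by apply: contraLR => oi; apply: dA; rewrite !inE oi orbT.
  split; first by apply/negP => /od; rewrite vx0.
  by move=> i j /od oi /od oj; apply/negP => /andP[]; rewrite oi oj.
have del1 : homology_le t (nonface_ideal (k := k) (fun A => vx 1 \notin A /\ F0 A))
    (t.+1 ^ 1).
  rewrite (face _ (fun A => [disjoint A & [set vx 0; vx 1]%SET])) => [|A].
    have := @homology_vars k n [set vx 0; vx 1]%SET (vx 0) t.
    by rewrite setU1K ?cards1 // inE.
  rewrite disjoint_sym disjoint_subset; split=> [[A1 [A0 iA]]|/subsetP dA].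
    by apply/subsetP => i; rewrite !inE => /orP[] /eqP ->.
  have A0 : vx 0 \notin A by have := dA (vx 0); rewrite !inE eqxx => /(_ isT).
  have A1 : vx 1 \notin A by have := dA (vx 1); rewrite !inE eqxx orbT => /(_ isT).
  do 2 split=> //; move=> i j iA jA; apply/negP => /andP[_].
  have big l : l \in A -> (1 < l)%N.
    move=> lA; case El : (l : nat) => [|[|//]].
      by case/negP: A0; rewrite (_ : vx 0 = l) //; apply: val_inj; rewrite /= vx0 El.
    by case/negP: A1; rewrite (_ : vx 1 = l) //; apply: val_inj; rewrite /= vx1 El.
  by rewrite gtn_min => /orP[]; rewrite ltnNge big.
have := homology_ext downI link0 (homology_ext downF0 link1 del1).
move=> H m z cz; have [R' [Phi [R'le HPhi]]] := H m z cz.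
exists R', Phi; split=> //; apply: leq_trans R'le _.
have le_pow a : (a <= uphalf n)%N -> (t.+1 ^ a <= t.+1 ^ uphalf n)%N by apply: leq_pexp2l.
by rewrite mulSn mulSn mul1n !leq_add ?le_pow // uphalf_half leq_addl.
Qed.

Lemma cx_dstar : (cxE K k G <= ((uphalf n)%:R + 1)%:E)%E.
Proof.
apply: ereal_inf_lbound; exists ((uphalf n).+1 : int); last first.
  by rewrite natr1.
exists (3 * 2 ^ uphalf n)%:R => i i_gt0.
have [deg [g [D res]]] := ext_bettiP k G.
have [_ _ Dmin surj ex0 exS] := res.
have D0 j q' q : D j q' q set0 = 0 by apply/aug_idealP.
have [z iz] := betti_leq_indep surj ex0 exS i D0.
have [w iw] : exists w : 'I_(ext_betti (@ext_edge_quot_deg k n G) i) -> mon -> E^o,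
    indep i (@ext_edge_ideal k n G : E^o -> Prop) w.
  apply: (indep_lift (p := ext_pi G)) iz => [y|u]; first exact: ext_pi_surj.
  by rewrite ext_pi_eq0.
have := indep_leq_homology (@dstar_homology i) iw.
set b := ext_betti _ i => b_le.
have -> : (uphalf n).+1%:Z - 1 = uphalf n by lia.
rewrite -exprnP -natrX -natrM ler_nat; apply: leq_trans b_le _.
rewrite -mulnA leq_mul2l /= -expnMn leq_exp2r //; first by lia.
Qed.

End DoubleStarExterior.

(** * Finite free resolutions *)

Section FreeResolutions.
Variable R : comNzRingType.

(** The submodule L of R^b has a resolution of length less than d by free modules
    of finite rank; so the projective dimension of R^b / L is at most d. *)
Fixpoint free_res (d b : nat) (L : 'rV[R]_b -> Prop) : Prop :=
  match d with
  | 0 => forall u, L u -> u = 0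
  | d'.+1 => exists b' (D : 'M[R]_(b', b)),
      (forall u, L u <-> exists v, u = v *m D) /\
      free_res d' (fun v : 'rV[R]_b' => v *m D = 0)
  end.

(** Pad with a zero module. *)
Lemma free_res_mono d b (L : 'rV[R]_b -> Prop) :
  submod L -> free_res d L -> free_res d.+1 L.
Proof.
elim: d b L => [|d IH] b L sL.
  move=> L0; exists 0%N, 0; split=> [u|v _]; last exact: thinmx0.
  split=> [/L0 ->|[v ->]]; first by exists 0; rewrite mul0mx.
  by rewrite mulmx0; case: sL.
move=> [b' [D [imD kerD]]]; exists b', D; split=> //.
by apply: IH => //; apply: ker_submod.
Qed.

(** The horseshoe lemma, for 0 -> LA -> LB -> LC -> 0: lift the generators of LC to LB,
    and repeat with the kernels, which form an exact sequence again. *)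
Lemma horseshoe d a c (LA : 'rV[R]_a -> Prop) (LC : 'rV[R]_c -> Prop)
    (LB : 'rV[R]_(a + c) -> Prop) :
  submod LB -> (forall u, LB (row_mx u 0) <-> LA u) ->
  (forall w, LB w -> LC (rsubmx w)) ->
  (forall v, LC v -> exists u, LB (row_mx u v)) ->
  free_res d LA -> free_res d LC -> free_res d LB.
Proof.
elim: d a c LA LC LB => [|d IH] a c LA LC LB sB kerB imB liftB.
  move=> A0 C0 w Bw; have w2 := C0 _ (imB w Bw).
  by move: Bw; rewrite -[w]hsubmxK w2 => /kerB/A0 ->; rewrite row_mx0.
move=> [a' [DA [imA kerA]]] [c' [DC [imC kerC]]].
have [B0 BD BZ] := sB.
have /choice[x Hx] j : exists x, LB (row_mx x (row j DC)).
  by apply: liftB; apply/imC; exists (delta_mx 0 j); rewrite rowE.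
pose X : 'M_(c', a) := \matrix_j x j.
pose DB : 'M_(a' + c', a + c) := block_mx DA 0 X DC.
have mulDB v1 v2 : row_mx v1 v2 *m DB = row_mx (v1 *m DA + v2 *m X) (v2 *m DC).
  by rewrite mul_row_block mulmx0 add0r.
have LX v : LB (row_mx (v *m X) (v *m DC)).
  rewrite !mulmx_sum_row.
  have -> : row_mx (\sum_j v 0 j *: row j X) (\sum_j v 0 j *: row j DC) =
      \sum_j v 0 j *: row_mx (row j X) (row j DC).
    elim/big_rec3: _ => [|j y1 y2 y3 _ <-]; first by rewrite row_mx0.
    by rewrite scale_row_mx add_row_mx.
  by apply: submod_sum => // j _; apply: BZ; rewrite rowK.
have LDB v : LB (v *m DB).
  rewrite -[v]hsubmxK mulDB -[rsubmx v *m DC]add0r -add_row_mx.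
  by apply: BD => //; apply/kerB/imA; exists (lsubmx v).
exists (a' + c')%N, DB; split=> [w|].
  split=> [Bw|[v ->]]; last exact: LDB.
  have [v2 ev2] := (imC _).1 (imB w Bw).
  have [v1 ev1] : exists v1, lsubmx w - v2 *m X = v1 *m DA.
    apply/imA/kerB; have -> : row_mx (lsubmx w - v2 *m X) 0 =
        w - row_mx (v2 *m X) (v2 *m DC).
      by rewrite -{2}[w]hsubmxK opp_row_mx add_row_mx ev2 subrr.
    exact: submodB.
  by exists (row_mx v1 v2); rewrite mulDB -ev1 subrK -ev2 hsubmxK.
apply: (IH _ _ _ _ _ (ker_submod DB)) kerA kerC => [u|w|v vDC].
- rewrite mulDB !mul0mx addr0; split=> [/eqP|->]; last by rewrite row_mx0.
  by rewrite row_mx_eq0 => /andP[/eqP].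
- by rewrite -{1}[w]hsubmxK mulDB => /eqP; rewrite row_mx_eq0 => /andP[_ /eqP].
have [u eu] : exists u, v *m X = u *m DA.
  by apply/imA/kerB; have := LX v; rewrite vDC.
by exists (- u); rewrite mulDB mulNmx eu addNr vDC row_mx0.
Qed.

(** If x is a nonzerodivisor on R and on R^b / L, then R^b / (L + x R^b) has a
    resolution one step longer than that of R^b / L: the kernel of its
    presentation is an extension of L by the relations of L. *)
Lemma free_res_cone d b (L : 'rV[R]_b -> Prop) x : submod L ->
  (forall u : 'rV[R]_b, x *: u = 0 -> u = 0) -> (forall u, L (x *: u) -> L u) ->
  free_res d L -> free_res d.+1 (fun u => exists l v, L l /\ u = l + x *: v).
Proof.
move=> sL x_reg x_sat fL; have [b' [D [imD kerD]]] := free_res_mono sL fL.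
exists (b' + b)%N, (col_mx D x%:M); split=> [u|].
  split=> [[l [v [/imD[w ->] ->]]]|[w ->]].
    by exists (row_mx w v); rewrite mul_row_col mul_mx_scalar.
  exists (lsubmx w *m D), (rsubmx w); split; first by apply/imD; exists (lsubmx w).
  by rewrite -{1}[w]hsubmxK mul_row_col mul_mx_scalar.
apply: (horseshoe (ker_submod _)) kerD fL => [u|w|v /imD[t ->]].
- by rewrite mul_row_col mul0mx addr0.
- rewrite -{1}[w]hsubmxK mul_row_col mul_mx_scalar => /eqP.
  rewrite addr_eq0 => /eqP e1; apply: x_sat; apply/imD; exists (- lsubmx w).
  by rewrite mulNmx e1 opprK.
by exists (- (x *: t)); rewrite mul_row_col mul_mx_scalar mulNmx -scalemxAl addNr.
Qed.

Lemma mulmx00D b (g : 'cV[R]_b) (u v : 'rV_b) :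
  ((u + v) *m g) 0 0 = (u *m g) 0 0 + (v *m g) 0 0.
Proof. by rewrite mulmxDl mxE. Qed.

Lemma mulmx00Z b (g : 'cV[R]_b) a (u : 'rV_b) : ((a *: u) *m g) 0 0 = a * (u *m g) 0 0.
Proof. by rewrite -scalemxAl mxE. Qed.

Lemma mulmx00N b (g : 'cV[R]_b) (u : 'rV_b) : ((- u) *m g) 0 0 = - (u *m g) 0 0.
Proof. by rewrite mulNmx mxE. Qed.

(** The cyclic module R / J has a free resolution of length at most d; the
    generators gamma are allowed to be redundant. *)
Definition cyclic_res d (J : R -> Prop) := exists b (gamma : 'cV[R]_b),
  (exists u : 'rV[R]_b, J ((u *m gamma) 0 0 - 1)) /\
  free_res d (fun u : 'rV[R]_b => J ((u *m gamma) 0 0)).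

Section Ideal.
Variables (J : R -> Prop).
Hypothesis sJ : submod (J : R^o -> Prop).

Let J0 : J 0. Proof. by case: sJ. Qed.
Let JB x y : J x -> J y -> J (x - y). Proof. exact: (submodB sJ). Qed.
Let JD x y : J x -> J y -> J (x + y). Proof. by case: sJ => _ + _; apply. Qed.
Let JM a x : J x -> J (a * x). Proof. by case: sJ => _ _; apply. Qed.

Lemma rel_submod b (gamma : 'cV[R]_b) :
  submod (fun u : 'rV[R]_b => J ((u *m gamma) 0 0)).
Proof.
split=> [|u v Hu Hv|a u Hu]; first by rewrite mul0mx mxE.
  by rewrite mulmx00D; apply: JD.
by rewrite mulmx00Z; apply: JM.
Qed.

Lemma cyclic_res_mono d : cyclic_res d J -> cyclic_res d.+1 J.
Proof.
move=> [b [gamma [Hu Hf]]]; exists b, gamma; split=> //.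
by apply: free_res_mono Hf; apply: rel_submod.
Qed.

Lemma cyclic_res_leq d d' : (d <= d')%N -> cyclic_res d J -> cyclic_res d' J.
Proof.
move=> /subnK <-; elim: (d' - d)%N => // m IH Hd; exact/cyclic_res_mono/IH.
Qed.

(** The cone construction on the presentation of R / J; u witnesses that 1 is a
    combination of the generators, which carries x R / J over to R^b. *)
Lemma cyclic_res_cone d x : (forall a, x * a = 0 -> a = 0) ->
  (forall a, J (x * a) -> J a) -> cyclic_res d J ->
  cyclic_res d.+1 (fun p => exists q a, J q /\ p = q + x * a).
Proof.
move=> x_reg x_sat [b [gamma [[u Hu] Hf]]]; exists b, gamma; split.
  by exists u, (((u *m gamma) 0 0) - 1), 0; rewrite mulr0 addr0.
have := @free_res_cone d b _ x (rel_submod gamma) _ _ Hf.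
move=> H; have {}H := H _ _.
have -> : (fun v : 'rV_b => exists q a, J q /\ (v *m gamma) 0 0 = q + x * a) =
    (fun v => exists l w, J ((l *m gamma) 0 0) /\ v = l + x *: w).
  apply/funext => v; apply/propext; split=> [[q [a [Jq e]]]|[l [w [Jl ->]]]].
    exists (v - x *: (a *: u)), (a *: u); split; last by rewrite subrK.
    rewrite mulmx00D mulmx00N !mulmx00Z e; set c := (u *m gamma) 0 0 in Hu *.
    have -> : q + x * a - x * (a * c) = q - (x * a) * (c - 1) by ring.
    by apply: JB => //; apply: JM.
  exists ((l *m gamma) 0 0), ((w *m gamma) 0 0); split=> //.
  by rewrite mulmx00D mulmx00Z.
apply: H => [w /rowP xw|w]; first by apply/rowP => i; have := xw i; rewrite !mxE; apply: x_reg.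
by rewrite mulmx00Z; apply: x_sat.
Qed.

(** The horseshoe lemma for 0 -> R / (J : x) -> R / J -> R / (J + (x)) -> 0.  The
    generators of R / J are x times those of R / (J : x) and lifts of those of
    R / (J + (x)), hence redundant. *)
Lemma cyclic_res_ext d x : cyclic_res d (fun p => J (x * p)) ->
  cyclic_res d (fun p => exists q a, J q /\ p = q + x * a) -> cyclic_res d J.
Proof.
move=> [b' [g' [[u' Hu'] Hf']]] [b'' [g'' [[u'' [q [a [Jq eq]]]] Hf'']]].
have mulg (v' : 'rV_b') (v'' : 'rV_b'') : ((row_mx v' v'') *m col_mx (x *: g') g'') 0 0 =
    x * (v' *m g') 0 0 + (v'' *m g'') 0 0.
  by rewrite mul_row_col -scalemxAr mxE; congr (_ + _); rewrite mxE.
exists (b' + b'')%N, (col_mx (x *: g') g''); split.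
  exists (row_mx (- (a *: u')) u''); rewrite mulg -addrA eq mulmx00N mulmx00Z.
  set c := (u' *m g') 0 0 in Hu' *.
  have -> : x * - (a * c) + (q + x * a) = q - a * (x * (c - 1)) by ring.
  by apply: JB => //; apply: JM.
apply: (horseshoe (rel_submod _)) Hf' Hf'' => [u|w|v [q' [a' [Jq' eq']]]].
- by rewrite mulg (_ : (0 *m g'') 0 0 = 0) ?addr0 // mul0mx mxE.
- rewrite -{1}[w]hsubmxK mulg => Hw.
  exists (x * (lsubmx w *m g') 0 0 + (rsubmx w *m g'') 0 0), (- (lsubmx w *m g') 0 0).
  by split=> //; ring.
exists (- (a' *: u')); rewrite mulg eq' mulmx00N mulmx00Z.
set c := (u' *m g') 0 0 in Hu' *.
have -> : x * - (a' * c) + (q' + x * a') = q' - a' * (x * (c - 1)) by ring.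
by apply: JB => //; apply: JM.
Qed.

End Ideal.

Lemma cyclic_res0 : cyclic_res 0 (fun p => p = 0).
Proof.
exists 1%N, 1%:M; split; first by exists 1%:M; rewrite mulmx1 mxE subrr.
by move=> u; rewrite mulmx1 => u0; apply/rowP => i; rewrite (ord1 i) u0 mxE.
Qed.

(** Lift the images of the basis. *)
Lemma projective_rV b : projective ('rV[R]_b : lmodType R).
Proof.
move=> A B g f g_surj.
have [a Ha] := choice (fun q : 'I_b => g_surj (f (delta_mx 0 q))).
exists (row_map a) => x; rewrite /= /row_map linear_sum {2}(row_sum_delta x) linear_sum.
by apply: eq_bigr => q _; rewrite !linearZ /= Ha.
Qed.

Lemma free_res_chain d b (L : 'rV[R]_b -> Prop) : submod L -> free_res d L ->
  exists (P : nat -> lmodType R) (f : forall i, {linear P i.+1 -> P i})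
         (aug : {linear P 0%N -> 'rV[R]_b}),
  [/\ forall i, projective (P i), forall u, L u <-> exists x, u = aug x,
      forall x, aug x = 0 <-> exists y, x = f 0%N y,
      forall i (x : P i.+1), f i x = 0 <-> exists y, x = f i.+1 y &
      forall i, (d <= i)%N -> forall x : P i, x = 0].
Proof.
elim: d b L => [|d IH] b L sL.
  move=> L0; have rV0 (x : 'rV[R]_0) : x = 0 by exact: thinmx0.
  pose f0 : {linear 'rV[R]_0 -> 'rV[R]_0} := idfun.
  exists (fun=> 'rV[R]_0 : lmodType R), (fun=> f0), (row_map (fun=> 0)).
  split=> //.
  - by move=> i; apply: projective_rV.
  - move=> u; split=> [/L0 ->|[x ->]].
      by exists 0; rewrite linear0.
    by rewrite (rV0 x) linear0; case: sL.
  - by move=> x; rewrite (rV0 x) linear0; split=> // _; exists 0.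
  - by move=> i x; rewrite (rV0 x) linear0; split=> // _; exists 0; rewrite linear0.
move=> [b' [D [imD kerD]]].
have [P [f [aug [Pproj im ex0 exS Pd]]]] := IH _ _ (ker_submod D) kerD.
pose P' i : lmodType R := if i is j.+1 then P j else 'rV[R]_b'.
pose f' i : {linear P' i.+1 -> P' i} :=
  match i with 0 => aug | j.+1 => f j end.
exists P', f', (mulmxr D); split.
- by case=> [|i]; [apply: projective_rV | apply: Pproj].
- by move=> u; rewrite imD.
- by move=> x; rewrite /= im.
- by case=> [|i] x; [apply: ex0 | apply: exS].
- by case=> [|i] // di; apply: Pd.
Qed.

End FreeResolutions.

(** * The double star over the polynomial ring *)

Section MonomialColon.
Variables (k : fieldType) (n : nat).
Local Notation S := {mpoly k[n]}.
Local Notation mon := 'X_{1..n}.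
Implicit Types (p q : S) (m : mon) (D : mon -> Prop).

Lemma mono_ideal_colon D i p :
  mono_ideal D ('X_i * p) <-> mono_ideal (fun m => D (m + U_(i))%MM) p.
Proof.
split=> H m nz.
  by apply: H; rewrite mcoeffXM mnmDE mnm1E eqxx addn1 /= addmK.
move: nz; rewrite mcoeffXM; case: ifP => [mi|]; last by rewrite eqxx.
by move/H; rewrite submK // mnm1_le.
Qed.

Lemma mono_ideal_add D i p : upset D ->
  (exists q a, mono_ideal D q /\ p = q + 'X_i * a) <->
  mono_ideal (fun m => D m \/ (0 < m i)%N) p.
Proof.
move=> upD; have [D0 DD _] := mono_ideal_submod k upD; split.
  move=> [q [a [Dq ->]]] m; rewrite mcoeffD mcoeffXM.
  by case: ifP => [mi _|_]; [right | rewrite addr0 => /Dq; left].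
elim/mono_ideal_ind: p / => [|p q [p1 [a [Hp ->]]] [q1 [b [Hq ->]]]|c m [Dm|mi]].
- by exists 0, 0; rewrite mulr0 addr0; split.
- by exists (p1 + q1), (a + b); rewrite mulrDr addrACA; split=> //; apply: DD.
- exists (c *: 'X_[m]), 0; rewrite mulr0 addr0; split=> // m'.
  by rewrite mcoeffZ mcoeffX; case: (m =P m') => [<-|]; rewrite ?mulr0 ?eqxx.
by exists 0, (c *: 'X_[(m - U_(i))%MM]); rewrite add0r -scalerAr -mpolyX_factor.
Qed.

Definition var_mono (ws : seq 'I_n) m := exists2 w, w \in ws & (0 < m w)%N.

Lemma var_mono_up ws : upset (var_mono ws).
Proof. by move=> m m' [w ws_w mw]; exists w => //; rewrite mnmDE addn_gt0 mw orbT. Qed.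

Lemma eq_mono_ideal D D' : (forall m, D m <-> D' m) ->
  mono_ideal (k := k) D = mono_ideal D'.
Proof. by move=> DD'; congr mono_ideal; apply/funext => m; apply/propext. Qed.

Lemma mono_ideal0 D : (forall m, ~ D m) -> mono_ideal D = (fun p => p = 0).
Proof.
move=> D0; apply/funext => p; apply/propext; split=> [Dp|-> m].
  by apply/mpolyP => m; rewrite mcoeff0; apply/eqP; apply: contrapT => /negP /Dp/D0.
by rewrite mcoeff0 eqxx.
Qed.

(** The Koszul resolution, as an iterated cone. *)
Lemma cyclic_res_vars ws : uniq ws ->
  cyclic_res (size ws) (mono_ideal (k := k) (var_mono ws)).
Proof.
elim: ws => [_|w ws IH /= /andP[nw uws]].
  by rewrite mono_ideal0 => [|m [w]] //; apply: cyclic_res0.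
rewrite (@eq_mono_ideal _ (fun m => var_mono ws m \/ (0 < m w)%N)) => [|m]; last first.
  split=> [[v]|[[v vws mv]|mw]]; last by exists w; rewrite ?inE ?eqxx.
    by rewrite inE => /orP[/eqP ->|vws] mv; [right|left; exists v].
  by exists v; rewrite // inE vws orbT.
have -> : mono_ideal (k := k) (fun m => var_mono ws m \/ (0 < m w)%N) =
    (fun p => exists q a, mono_ideal (var_mono ws) q /\ p = q + 'X_w * a).
  by apply/funext => p; apply/propext; rewrite mono_ideal_add //; apply: var_mono_up.
apply: cyclic_res_cone (IH uws) => [|a /eqP|a].
- exact: mono_ideal_submod (@var_mono_up ws).
- rewrite mulf_eq0 => /orP[/eqP X0|/eqP //].
  by have /eqP := congr1 (mcoeff U_(w)%MM) X0; rewrite mcoeffX eqxx mcoeff0 oner_eq0.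
rewrite mono_ideal_colon => H m /H[v vws]; rewrite mnmDE mnm1E.
case: eqP => [ewv|_]; last by rewrite addn0; exists v.
by rewrite ewv vws in nw.
Qed.

End MonomialColon.

Section DoubleStarFiltration.
Variables (k : fieldType) (n' : nat).
Local Notation n := n'.+2.
Local Notation S := {mpoly k[n]}.
Local Notation G := (dstar n').
Local Notation vx := (@vx n').
(* The filtration is used twice, for resolutions and for regular sequences; so it is
   stated for a property Q of ideals that goes through extensions. *)
Variable Q : (S -> Prop) -> Prop.

Hypothesis Q_ext : forall D i, upset D ->
  Q (mono_ideal (fun m => D (m + U_(i))%MM)) ->
  Q (mono_ideal (fun m => D m \/ (0 < m i)%N)) -> Q (mono_ideal D).
Hypothesis Q_odds : Q (mono_ideal (var_mono (enum (odds n')))).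
Hypothesis Q_evens : Q (mono_ideal (var_mono (enum (evens n')))).
Hypothesis Q_centre : (0 < n')%N -> Q (mono_ideal (var_mono [:: vx 0; vx 1])).

(** I : x_0 is generated by the odd variables, (I + (x_0)) : x_1 by the even ones, and
    I + (x_0, x_1) by the variables of the centres, which form a vertex cover. *)
Lemma dstar_filtration : Q (mono_ideal (edge_mono G)).
Proof.
have pos_add (m : 'X_{1..n}) i l : (0 < (m + U_(i))%MM l)%N -> i != l -> (0 < m l)%N.
  by rewrite mnmDE mnm1E => + /negPf ne; rewrite ne addn0.
have v0 : ~~ odd (vx 0) by rewrite vx0.
have v1 : odd (vx 1) by rewrite vx1.
have oddv (i l : 'I_n) : odd i != odd l -> i != l by apply: contraNneq => ->.
apply: (Q_ext (i := vx 0)); first exact: edge_mono_up.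
  rewrite (@eq_mono_ideal _ _ _ (var_mono (enum (odds n')))) // => m; split.
    move=> [i [j [Gij mi mj]]].
    have [oi|oi] := boolP (odd i).
      exists i; first by rewrite mem_enum inE.
      by apply: pos_add mi _; apply: oddv; rewrite oi (negPf v0).
    exists j; first by rewrite mem_enum inE; case/andP: Gij; rewrite (negPf oi); case: odd.
    by apply: pos_add mj _; apply: oddv; case/andP: Gij; rewrite (negPf oi) (negPf v0).
  move=> [w]; rewrite mem_enum inE => ow mw; exists (vx 0), w.
  by rewrite dstar0 ow !mnmDE !addn_gt0 mw mnm1E eqxx orbT.
pose D1 (m : 'X_{1..n}) := edge_mono G m \/ (0 < m (vx 0))%N.
have upD1 : upset D1.
  move=> m m' [/(@edge_mono_up _ _ m m')|m0]; first by left.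
  by right; rewrite mnmDE addn_gt0 m0 orbT.
change (Q (mono_ideal D1)).
(* For the single edge I + (x_0) = (x_0), and there is no third factor. *)
have [en'|n'0] := posnP n'.
  rewrite (@eq_mono_ideal _ _ _ (var_mono (enum (evens n')))) // => m; split.
    move=> [[i [j [Gij mi mj]]]|m0]; last by exists (vx 0); rewrite // mem_enum inE.
    have [oi|oi] := boolP (odd i); last by exists i; rewrite // mem_enum inE.
    by exists j; rewrite // mem_enum inE; case/andP: Gij; rewrite oi; case: odd.
  move=> [w]; rewrite mem_enum inE => ow mw; right.
  have -> // : vx 0 = w; apply: val_inj; rewrite /= vx0.
  by case: (w : nat) (ltn_ord w) ow => [|[|l]] //; rewrite en'.
apply: (Q_ext (i := vx 1) upD1).
  rewrite (@eq_mono_ideal _ _ _ (var_mono (enum (evens n')))) // => m; split.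
    move=> [[i [j [Gij mi mj]]]|m0]; last first.
      exists (vx 0); rewrite ?mem_enum ?inE //.
      by apply: pos_add m0 _; apply: oddv; rewrite v1 (negPf v0).
    have [oi|oi] := boolP (odd i); last first.
      exists i; first by rewrite mem_enum inE.
      by apply: pos_add mi _; apply: oddv; rewrite v1 (negPf oi).
    exists j; first by rewrite mem_enum inE; case/andP: Gij; rewrite oi; case: odd.
    by apply: pos_add mj _; apply: oddv; case/andP: Gij; rewrite oi v1.
  move=> [w]; rewrite mem_enum inE => ow mw; left; exists (vx 1), w.
  by rewrite dstar1 ow !mnmDE !addn_gt0 mw mnm1E eqxx orbT.
rewrite (@eq_mono_ideal _ _ _ (var_mono [:: vx 0; vx 1])); first exact: Q_centre.
move=> m; split=> [[[[i [j [Gij mi mj]]]|m0]|m1]|[w]].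
- have centre (l : 'I_n) : (l < 2)%N -> l \in [:: vx 0; vx 1].
    by rewrite !inE -!val_eqE /= vx0 vx1; case: (l : nat) => [|[|]].
  case/andP: Gij => _; rewrite gtn_min => /orP[] l2.
    by exists i; first exact: centre.
  by exists j; first exact: centre.
- by exists (vx 0); rewrite // inE eqxx.
- by exists (vx 1); rewrite // !inE eqxx orbT.
rewrite !inE => /orP[] /eqP -> mw; last by right.
by left; right.
Qed.

End DoubleStarFiltration.

Section DoubleStarProjectiveDimension.
Variables (K : realType) (k : fieldType) (n' : nat).
Local Notation n := n'.+2.
Local Notation S := {mpoly k[n]}.
Local Notation G := (dstar n').

Lemma cyclic_res_pd (H : sgraph n) d : cyclic_res d (mono_ideal (k := k) (edge_mono H)) ->
  (pdS K k H <= d%:R%:E)%E.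
Proof.
move=> [b [gamma [[u0 Hu0] Hf]]]; apply: ereal_inf_lbound; exists d => //.
have sI := mono_ideal_submod k (@edge_mono_up _ H).
pose pi : {linear 'rV[S]_b -> pol_edge_quot k H} :=
  row_map (fun q => pol_pi H (gamma q 0)).
have piE u : pi u = pol_pi H ((u *m gamma) 0 0).
  rewrite mxE /= /row_map; rewrite (raddf_sum (pol_pi H)); apply: eq_bigr => q _.
  by rewrite -linearZ.
have [P [f [aug [Pproj im ex0 exS Pd]]]] := free_res_chain (rel_submod sI gamma) Hf.
pose P' i : lmodType S := if i is j.+1 then P j else 'rV[S]_b.
pose f' i : {linear P' i.+1 -> P' i} := match i with 0 => aug | j.+1 => f j end.
exists P', f', pi; split; first split.
- by case=> [|i]; [apply: projective_rV | apply: Pproj].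
- move=> m; have [p ->] := pol_pi_surj m; exists (p *: u0).
  rewrite piE mulmx00Z; apply/eqP; rewrite -subr_eq0; apply/eqP.
  rewrite -(raddfB (pol_pi H)); apply/pol_pi_eq0.
  have -> : p * (u0 *m gamma) 0 0 - p = p * ((u0 *m gamma) 0 0 - 1) by ring.
  by case: sI => _ _; apply.
- by move=> x; rewrite piE pol_pi_eq0 im.
- by case=> [|i] x; [apply: ex0 | apply: exS].
- by case=> [|i] // di; apply: Pd.
Qed.

Lemma pd_dstar : (pdS K k G <= (uphalf n)%:R%:E)%E.
Proof.
apply: cyclic_res_pd; apply: dstar_filtration => [D i upD H1 H2|||n'0].
- have sD := mono_ideal_submod k upD; apply: (cyclic_res_ext (x := 'X_i) sD).
    rewrite (_ : (fun p => _) = mono_ideal (fun m => D (m + U_(i))%MM)) //.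
    by apply/funext => p; apply/propext; exact: mono_ideal_colon.
  rewrite (_ : (fun p => _) = mono_ideal (fun m => D m \/ (0 < m i)%N)) //.
  by apply/funext => p; apply/propext; exact: mono_ideal_add.
- apply: (cyclic_res_leq (mono_ideal_submod k (@var_mono_up _ _)))
    (cyclic_res_vars k (enum_uniq _)).
  by rewrite -cardE card_odds uphalf_half leq_addl.
- apply: (cyclic_res_leq (mono_ideal_submod k (@var_mono_up _ _)))
    (cyclic_res_vars k (enum_uniq _)).
  by rewrite -cardE card_evens.
apply: (cyclic_res_leq (mono_ideal_submod k (@var_mono_up _ _))) (cyclic_res_vars k _).
  by rewrite /= !ltnS uphalf_half; case: (n') n'0 => [|[|m]] //= _; rewrite addnS.
by rewrite /= !inE -val_eqE /= vx0 vx1.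
Qed.

End DoubleStarProjectiveDimension.

(** * A regular sequence on the double star *)

Section WeaklyRegular.
Variables (R : comNzRingType) (f : seq R).
Implicit Types J : R -> Prop.

Definition add_idl J t p := exists y : nat -> R, J (p - \sum_(j < t) f`_j * y j).

(** f is weakly regular on R / J: the quotient R / (J + (f)) may be zero. *)
Definition wreg J := forall t p, (t < size f)%N ->
  add_idl J t (f`_t * p) -> add_idl J t p.

Lemma add_idl0 J p : add_idl J 0 p <-> J p.
Proof.
by split=> [[y]|Jp]; [rewrite big_ord0 subr0 | exists (fun=> 0); rewrite big_ord0 subr0].
Qed.

Lemma add_idlS J t p : add_idl J t.+1 p <-> exists a, add_idl J t (p - f`_t * a).
Proof.
split=> [[y Hy]|[a [y Hy]]].
  by exists (y t), y; move: Hy; rewrite big_ord_recr /= opprD addrA addrAC.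
exists (fun j => if j == t then a else y j); rewrite big_ord_recr /= eqxx.
rewrite (eq_bigr (fun j : 'I_t => f`_j * y j)) => [|j _]; last by rewrite ltn_eqF.
by rewrite opprD addrA addrAC.
Qed.

Section Ideal.
Variable J : R -> Prop.
Hypothesis sJ : submod (J : R^o -> Prop).

Lemma add_idl_submod t : submod (add_idl J t : R^o -> Prop).
Proof.
have [J0 JD JM] := sJ; split=> [|p q [y Hy] [z Hz]|a p [y Hy]].
- by exists (fun=> 0); rewrite big1 ?subr0 // => j _; rewrite mulr0.
- exists (fun j => y j + z j); under eq_bigr => j _ do rewrite mulrDr.
  by rewrite big_split opprD addrACA; apply: JD.
- exists (fun j => a * y j); under eq_bigr => j _ do rewrite mulrCA.
  by rewrite -mulr_sumr -mulrBr; apply: JM.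
Qed.

Lemma add_idl_incl t p : J p -> add_idl J t p.
Proof. by move=> Jp; exists (fun=> 0); rewrite big1 ?subr0 // => j _; rewrite mulr0. Qed.

Lemma add_idl_leq t t' p : (t <= t')%N -> add_idl J t p -> add_idl J t' p.
Proof.
move=> /subnK <-; elim: (t' - t)%N => // m IH Hp; apply/add_idlS; exists 0.
by rewrite mulr0 subr0; apply: IH.
Qed.

Lemma add_idl_gen t j a : (j < t)%N -> add_idl J t (f`_j * a).
Proof.
move=> jt; apply: (add_idl_leq jt); apply/add_idlS; exists a; rewrite subrr.
by case: (add_idl_submod j).
Qed.

Variable x : R.
Let colon p := J (x * p).
Let quo p := exists q a, J q /\ p = q + x * a.

Let add_quo t p : add_idl quo t p <-> exists a, add_idl J t (p - x * a).
Proof.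
split=> [[y [q [a [Jq e]]]]|[a [y Hy]]].
  by exists a, y; rewrite addrAC e addrK.
exists y, (p - x * a - \sum_(j < t) f`_j * y j), a; split=> //.
by rewrite [RHS]addrAC subrK.
Qed.

Let add_colon t a : add_idl colon t a -> add_idl J t (x * a).
Proof.
move=> [y Hy]; exists (fun j => x * y j); under eq_bigr => j _ do rewrite mulrCA.
by rewrite -mulr_sumr -mulrBr.
Qed.

(** Regular sequences on R / (J : x) and R / (J + (x)) are regular on R / J; the
    second condition makes Tor_1 (R / (J + (x)), R / (f_0, .., f_(t-1))) vanish. *)
Lemma wreg_ext : wreg colon -> wreg quo -> wreg J.
Proof.
move=> Hc Hq.
have lift t b : (t < size f)%N -> add_idl J t (f`_t * b) ->
    exists a, add_idl J t (b - x * a).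
  move=> tf Hb; apply/add_quo/Hq => //; apply/add_quo; exists 0.
  by rewrite mulr0 subr0.
(* J + (f_0, .., f_(t-1)) meets the ideal (x) in x times the same ideal for J : x. *)
have inter t a : (t <= size f)%N -> add_idl J t (x * a) -> add_idl colon t a.
  elim: t a => [|t IH] a tf; first by rewrite !add_idl0.
  have [_ _ IM] := add_idl_submod t.
  move=> /add_idlS[b Hb].
  have [a' Ha'] : exists a', add_idl J t (b - x * a').
    apply/add_quo/Hq => //; apply/add_quo; exists a.
    by rewrite -[_ - _]opprB -mulN1r; apply: IM.
  apply/add_idlS; exists a'; apply: IH; first exact: ltnW.
  have -> : x * (a - f`_t * a') = (x * a - f`_t * b) - (- f`_t) * (b - x * a') by ring.
  by apply: (submodB (add_idl_submod t)) => //; apply: IM.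
move=> t b tf Hb; have [a Ha] := lift t b tf Hb.
have [I0 ID IM] := add_idl_submod t.
rewrite -[b](subrK (x * a)); apply: ID => //; apply: add_colon; apply: Hc => //.
apply: inter; first exact: ltnW.
have -> : x * (f`_t * a) = f`_t * b - f`_t * (b - x * a) by ring.
by apply: (submodB (add_idl_submod t)) => //; apply: IM.
Qed.

End Ideal.
End WeaklyRegular.

Section Substitution.
Variables (k : fieldType) (n : nat) (f : seq {mpoly k[n]}) (ws : seq 'I_n).
Local Notation S := {mpoly k[n]}.
Let J := mono_ideal (k := k) (var_mono ws).

(** If J + (f_0, .., f_(t-1)) is the kernel of a substitution of the variables, it
    is a prime ideal, and f_t is regular modulo it as soon as the substitution does
    not kill f_t. *)
Lemma wreg_subst (g : nat -> n.-tuple S) :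
  (forall t i, (t < size f)%N -> add_idl f J t ('X_i - tnth (g t) i)) ->
  (forall t w, (t < size f)%N -> w \in ws -> tnth (g t) w = 0) ->
  (forall t j, (j < t < size f)%N -> f`_j \mPo g t = 0) ->
  (forall t, (t < size f)%N -> f`_t \mPo g t != 0) -> wreg f J.
Proof.
move=> Hg gW gf gt t p tf Hp.
have sJ : submod (J : S^o -> Prop) := mono_ideal_submod k (@var_mono_up _ ws).
have [I0 ID IM] := add_idl_submod f sJ t.
have compX i : 'X_i \mPo g t = tnth (g t) i.
  by rewrite comp_mpolyXU -tnth_nth.
(* The substitution is the identity modulo the ideal and kills the ideal; so the ideal
   is its kernel. *)
have cong q : add_idl f J t (q - (q \mPo g t)).
  rewrite [q]mpolyE (raddf_sum (comp_mpoly (g t))) /= -sumrB; elim/big_ind: _ => // m _ /=.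
  rewrite comp_mpolyZ -scalerBr -mul_mpolyC; apply: (IM).
  have [d] := ubnP (mdeg m); elim: d m => // d IH m; rewrite ltnS => md.
  have [->|m0] := eqVneq m 0%MM; first by rewrite mpolyX0 comp_mpoly1 subrr.
  have [i mi] : exists i, (0 < m i)%N.
    apply/existsP; apply: contraNT m0; rewrite negb_exists => /forallP m0.
    by apply/eqP/mnmP => i; rewrite mnm0E; apply/eqP; rewrite -leqn0 leqNgt.
  pose q' : S := 'X_[(m - U_(i))%MM]; pose c := q' \mPo g t.
  have -> : 'X_[m] - ('X_[m] \mPo g t) =
      'X_i * (q' - c) + c * ('X_i - tnth (g t) i).
    have -> : 'X_[m] \mPo g t = tnth (g t) i * c.
      by rewrite (mpolyX_factor _ mi) rmorphM /= compX.
    by rewrite (mpolyX_factor _ mi) -/q'; ring.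
  apply: ID; apply: IM; last exact: Hg.
  apply: IH; apply: leq_trans md.
  by rewrite -{2}(submK (mnm1_le mi)) mdegD mdeg1 addn1.
have kill q : add_idl f J t q -> q \mPo g t = 0.
  move=> [y Hy].
  have fy0 : (\sum_(j < t) f`_j * y j) \mPo g t = 0.
    rewrite (raddf_sum (comp_mpoly (g t))) big1 // => j _ /=.
    by rewrite rmorphM /= gf ?mul0r // ltn_ord tf.
  rewrite -[q](subrK (\sum_(j < t) f`_j * y j)) rmorphD /= fy0 addr0.
  elim/mono_ideal_ind: (_ - _) / Hy => [|q1 q2 e1 e2|c m [w wws mw]].
  - exact: comp_mpoly0.
  - by rewrite rmorphD /= e1 e2 addr0.
  by rewrite comp_mpolyZ (mpolyX_factor _ mw) rmorphM /= compX gW // mul0r scaler0.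
have /eqP := kill _ Hp; rewrite rmorphM mulf_eq0 (negPf (gt t tf)) /= => /eqP p0.
by have := cong p; rewrite p0 subr0.
Qed.

End Substitution.

Section DoubleStarDepth.
Variables (K : realType) (k : fieldType) (n' : nat).
Local Notation n := n'.+2.
Local Notation S := {mpoly k[n]}.
Local Notation G := (dstar n').
Local Notation vx := (@vx n').
Local Notation q := n'./2.

Definition leaf_var j : S := 'X_(vx j.+1.*2) + 'X_(vx j.+1.*2.+1).

(** Modulo the variables of the centres, x_0 + x_1 would be zero; the leaf x_2, present
    unless the graph is a single edge, makes this form regular there as well. *)
Definition centre_var : S :=
  'X_(vx 0) + 'X_(vx 1) + (if (0 < n')%N then 'X_(vx 2) else 0).

Definition dstar_seq : seq S := rcons [seq leaf_var j | j <- iota 0 q] centre_var.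

Lemma size_dstar_seq : size dstar_seq = q.+1.
Proof. by rewrite size_rcons size_map size_iota. Qed.

Lemma dstar_seq_leaf j : (j < q)%N -> dstar_seq`_j = leaf_var j.
Proof.
move=> jq; rewrite nth_rcons size_map size_iota jq.
by rewrite (nth_map 0%N) ?size_iota // nth_iota.
Qed.

Lemma dstar_seq_last : dstar_seq`_q = centre_var.
Proof. by rewrite nth_rcons size_map size_iota ltnn eqxx. Qed.

Lemma leaf_var_bound j : (j < q)%N -> (j.+1.*2.+1 < n)%N.
Proof. by move=> jq; have := odd_double_half n'; lia. Qed.

Lemma comp_var (F : 'I_n -> S) i : 'X_i \mPo [tuple F i | i < n] = F i.
Proof. by rewrite comp_mpolyXU -tnth_nth tnth_mktuple. Qed.

Lemma mpoly_neq0 (p : S) i : p@_(U_(i))%MM != 0 -> p != 0.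
Proof. by apply: contraNneq => ->; rewrite mcoeff0. Qed.

Lemma vx_eq i j : (i < n)%N -> (j < n)%N -> (vx i == vx j) = (i == j).
Proof. by move=> ni nj; rewrite -val_eqE /= !vxE. Qed.

Lemma even_leaf (i : 'I_n) t : ~~ odd i -> (1 < i <= t.*2)%N ->
  exists2 j, (j < t)%N & i = vx j.+1.*2.
Proof.
move=> ei /andP[i1 it]; have ie := odd_double_half i; rewrite (negPf ei) add0n in ie.
exists (i./2).-1; first by lia.
by apply: val_inj; rewrite /= vxE; have := ltn_ord i; lia.
Qed.

Lemma leaf_var_le t j : (t <= q)%N -> (j < t)%N -> (j < q)%N.
Proof. by move=> tq jt; apply: leq_trans tq. Qed.

Section Side.
Variables (J : S -> Prop) (t : nat).
Hypothesis sJ : submod (J : S^o -> Prop).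

Lemma leaf_pair j : (j < t)%N -> (t <= q)%N ->
  add_idl dstar_seq J t ('X_(vx j.+1.*2) + 'X_(vx j.+1.*2.+1)).
Proof.
move=> jt tq; have := add_idl_gen dstar_seq sJ 1 jt.
by rewrite mulr1 dstar_seq_leaf // (leaf_var_le tq jt).
Qed.

Lemma leaf_even j : (j < t)%N -> (t <= q)%N -> J 'X_(vx j.+1.*2.+1) ->
  add_idl dstar_seq J t 'X_(vx j.+1.*2).
Proof.
move=> jt tq Jx; rewrite -['X_(vx j.+1.*2)](addrK 'X_(vx j.+1.*2.+1)).
by apply: (submodB (add_idl_submod _ sJ _)); [apply: leaf_pair | apply: add_idl_incl].
Qed.

Lemma leaf_odd j : (j < t)%N -> (t <= q)%N -> J 'X_(vx j.+1.*2) ->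
  add_idl dstar_seq J t 'X_(vx j.+1.*2.+1).
Proof.
move=> jt tq Jx; rewrite -['X_(vx j.+1.*2.+1)](addKr 'X_(vx j.+1.*2)) addrC.
by apply: (submodB (add_idl_submod _ sJ _)); [apply: leaf_pair | apply: add_idl_incl].
Qed.

End Side.

Lemma var_ideal (ws : seq 'I_n) i : i \in ws ->
  mono_ideal (k := k) (var_mono ws) 'X_i.
Proof.
move=> iws m; rewrite mcoeffX; case: (_ =P m) => [<- _|]; last by rewrite eqxx.
by exists i; rewrite // mnm1E eqxx.
Qed.

Let sJ ws := mono_ideal_submod k (@var_mono_up n ws).

(** Modulo the odd variables the first t forms are the even leaves up to 2 t. *)
Definition odd_subst t : n.-tuple S := [tuple
  if odd i then 0 else if (1 < i <= t.*2)%N then 0 else 'X_i | i < n].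

Lemma wreg_odds : wreg dstar_seq (mono_ideal (k := k) (var_mono (enum (odds n')))).
Proof.
apply: (wreg_subst (g := odd_subst)) => [t i|t w _|t j|t]; rewrite ?size_dstar_seq ?ltnS.
- move=> tq; rewrite tnth_mktuple; case: ifP => oi.
    by rewrite subr0; apply: add_idl_incl; apply: var_ideal; rewrite mem_enum inE.
  case: ifP => it; last by rewrite subrr; apply: add_idl_incl; case: (sJ (enum (odds n'))).
  have [|j jt ->] := even_leaf _ it; first by rewrite oi.
  rewrite subr0; apply: (@leaf_even (mono_ideal (var_mono (enum (odds n')))) t (sJ _) j jt tq).
  apply: var_ideal.
  by rewrite mem_enum inE vxE ?(leaf_var_bound (leaf_var_le tq jt)) //= odd_double.
- by rewrite mem_enum inE tnth_mktuple => ->.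
- move=> /andP[jt tq]; have jq := leaf_var_le tq jt; have nj := leaf_var_bound jq.
  rewrite dstar_seq_leaf // raddfD /= !comp_var !vxE ?(ltnW nj) //= odd_double /=.
  by rewrite ifT ?addr0 // leq_double jt.
move=> tq; have [tq'|qt] := ltnP t q.
  have nt := leaf_var_bound tq'.
  rewrite dstar_seq_leaf // raddfD /= !comp_var !vxE ?(ltnW nt) //= odd_double /= addr0.
  rewrite ifF; last by apply/negbTE; lia.
  by apply: (@mpoly_neq0 _ (vx t.+1.*2)); rewrite mcoeffXU eqxx oner_eq0.
have -> : t = q by apply/eqP; rewrite eqn_leq tq qt.
rewrite dstar_seq_last !raddfD /= !comp_var vx0 vx1 /= addr0.
apply: (@mpoly_neq0 _ (vx 0)); rewrite mcoeffD mcoeffXU eqxx.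
case: ifP => n0; last by rewrite raddf0 mcoeff0 addr0 oner_eq0.
rewrite comp_var vxE // /=; case: ifP => _; first by rewrite mcoeff0 addr0 oner_eq0.
by rewrite mcoeffXU vx_eq // addr0 oner_eq0.
Qed.

(** Modulo the even variables the first t forms are the odd leaves up to 2 t + 1. *)
Definition even_subst t : n.-tuple S := [tuple
  if ~~ odd i then 0 else if (1 < i <= t.*2.+1)%N then 0 else 'X_i | i < n].

Lemma wreg_evens : wreg dstar_seq (mono_ideal (k := k) (var_mono (enum (evens n')))).
Proof.
apply: (wreg_subst (g := even_subst)) => [t i|t w _|t j|t]; rewrite ?size_dstar_seq ?ltnS.
- move=> tq; rewrite tnth_mktuple; case: ifP => oi.
    by rewrite subr0; apply: add_idl_incl; apply: var_ideal; rewrite mem_enum inE.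
  case: ifP => it; last by rewrite subrr; apply: add_idl_incl; case: (sJ (enum (evens n'))).
  have [j jt ->] : exists2 j, (j < t)%N & i = vx j.+1.*2.+1.
    have ie := odd_double_half i; rewrite (negPn (negbT oi)) in ie.
    exists (i./2).-1; first by lia.
    by apply: val_inj; rewrite /= vxE; have := ltn_ord i; lia.
  rewrite subr0; apply: (@leaf_odd (mono_ideal (var_mono (enum (evens n')))) t (sJ _) j jt tq).
  apply: var_ideal.
  by rewrite mem_enum inE vxE ?odd_double // ltnW // (leaf_var_bound (leaf_var_le tq jt)).
- by rewrite mem_enum inE tnth_mktuple => ->.
- move=> /andP[jt tq]; have jq := leaf_var_le tq jt; have nj := leaf_var_bound jq.
  rewrite dstar_seq_leaf // raddfD /= !comp_var !vxE ?(ltnW nj) //= odd_double /=.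
  by rewrite ifT ?addr0 // ltnS leq_double jt.
move=> tq; have [tq'|qt] := ltnP t q.
  have nt := leaf_var_bound tq'.
  rewrite dstar_seq_leaf // raddfD /= !comp_var !vxE ?(ltnW nt) //= odd_double /= add0r.
  rewrite ifF; last by apply/negbTE; lia.
  by apply: (@mpoly_neq0 _ (vx t.+1.*2.+1)); rewrite mcoeffXU eqxx oner_eq0.
have -> : t = q by apply/eqP; rewrite eqn_leq tq qt.
rewrite dstar_seq_last !raddfD /= !comp_var vx0 vx1 /= add0r.
apply: (@mpoly_neq0 _ (vx 1)); rewrite mcoeffD mcoeffXU eqxx.
case: ifP => n0; last by rewrite raddf0 mcoeff0 addr0 oner_eq0.
by rewrite comp_var vxE // mcoeff0 addr0 oner_eq0.
Qed.

(** Modulo the variables of the centres the first t forms identify each even leaf x_i,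
    i <= 2 t, with - x_(i+1). *)
Definition centre_subst t : n.-tuple S := [tuple
  if (i < 2)%N then 0 else
  if ~~ odd i && (i <= t.*2)%N then - 'X_(vx i.+1) else 'X_i | i < n].

Lemma wreg_centre : (0 < n')%N ->
  wreg dstar_seq (mono_ideal (k := k) (var_mono [:: vx 0; vx 1])).
Proof.
move=> n'0.
apply: (wreg_subst (g := centre_subst)) => [t i|t w _|t j|t]; rewrite ?size_dstar_seq ?ltnS.
- move=> tq; rewrite tnth_mktuple; case: ifP => i2.
    rewrite subr0; apply: add_idl_incl; apply: var_ideal.
    by rewrite !inE -!val_eqE /= vx0 vx1; case: (i : nat) i2 => [|[|]].
  case: ifP => it; last by rewrite subrr; apply: add_idl_incl; case: (sJ [:: vx 0; vx 1]).
  have /andP[ei it'] := it.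
  have [|j jt ->] := even_leaf (t := t) ei; first by rewrite it' ltnNge -ltnS i2.
  rewrite opprK vxE; last by rewrite ltnW // leaf_var_bound // (leaf_var_le tq jt).
  exact: (@leaf_pair (mono_ideal (var_mono [:: vx 0; vx 1])) t (sJ _) j jt tq).
- rewrite tnth_mktuple !inE => /orP[] /eqP ->; by rewrite ?vx0 ?vx1.
- move=> /andP[jt tq]; have jq := leaf_var_le tq jt; have nj := leaf_var_bound jq.
  rewrite dstar_seq_leaf // raddfD /= !comp_var !vxE ?(ltnW nj) //= odd_double /=.
  by rewrite leq_double jt addNr.
move=> tq; have [tq'|qt] := ltnP t q.
  have nt := leaf_var_bound tq'.
  rewrite dstar_seq_leaf // raddfD /= !comp_var !vxE ?(ltnW nt) //= odd_double /=.
  rewrite leq_double ltnn; apply: (@mpoly_neq0 _ (vx t.+1.*2)).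
  rewrite mcoeffD !mcoeffXU eqxx vx_eq ?(ltnW nt) // gtn_eqF // addr0.
  exact: oner_neq0.
have -> : t = q by apply/eqP; rewrite eqn_leq tq qt.
rewrite dstar_seq_last /centre_var n'0 !raddfD /= !comp_var vx0 vx1 vxE //= !add0r.
case: ifP => q1; last by apply: (@mpoly_neq0 _ (vx 2)); rewrite mcoeffXU eqxx oner_eq0.
apply: (@mpoly_neq0 _ (vx 3)); rewrite mcoeffN mcoeffXU eqxx oppr_eq0; exact: oner_neq0.
Qed.

Lemma wreg_dstar : wreg dstar_seq (mono_ideal (k := k) (edge_mono G)).
Proof.
apply: dstar_filtration => [D i upD H1 H2|||n'0].
- have sD := mono_ideal_submod k upD; apply: (wreg_ext (x := 'X_i) sD).
    rewrite (_ : (fun p => _) = mono_ideal (fun m => D (m + U_(i))%MM)) //.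
    by apply/funext => p; apply/propext; exact: mono_ideal_colon.
  rewrite (_ : (fun p => _) = mono_ideal (fun m => D m \/ (0 < m i)%N)) //.
  by apply/funext => p; apply/propext; exact: mono_ideal_add.
- exact: wreg_odds.
- exact: wreg_evens.
- exact: wreg_centre.
Qed.

Lemma idl_add_idl f t (p : S) :
  idl G f t p <-> add_idl f (mono_ideal (k := k) (edge_mono G)) t p.
Proof.
elim: t p => [|t IH] p; first by rewrite idl0 add_idl0.
rewrite idlS add_idlS; split=> -[a Ha]; exists a.
  by rewrite -IH.
by rewrite IH.
Qed.

Lemma dstar_seq_aug f0 : f0 \in dstar_seq -> f0@_0%MM = 0.
Proof.
have X0 i : ('X_i : S)@_0%MM = 0.
  by rewrite mcoeffX; case: eqP => // /(congr1 (@mdeg n)); rewrite mdeg1 mdeg0.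
rewrite mem_rcons inE => /orP[/eqP ->|/mapP[j _ ->]]; last by rewrite mcoeffD !X0 addr0.
by rewrite !mcoeffD !X0 add0r; case: ifP; rewrite ?X0 ?mcoeff0 addr0.
Qed.

Lemma dstar_seq_max : {subset dstar_seq <= ideal_gen (range (fun i => 'X_i : S))}.
Proof.
have X_in i : ('X_i : S) \in ideal_gen (range (fun i => 'X_i : S)).
  by apply: span_gen; exists 'X_i, 1; rewrite mulr1; split=> //; exists i.
move=> f0; rewrite mem_rcons inE => /orP[/eqP ->|/mapP[j _ ->]]; last exact: rpredD.
by apply: rpredD; [exact: rpredD | case: ifP => _; [exact: X_in | exact: rpred0]].
Qed.

Lemma depthS_dstar : ((n./2%:R)%:E <= depthS K k G)%E.
Proof.
apply: ereal_sup_ubound; exists dstar_seq; last by rewrite size_dstar_seq.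
split; first exact: dstar_seq_max.
apply/regular_seqP; split=> [t p tf /idl_add_idl H|].
  by apply/idl_add_idl/wreg_dstar.
exists 1 => /idl_add_idl[y /(_ 0%MM)].
have -> : (1 - \sum_(j < size dstar_seq) dstar_seq`_j * y j)@_0%MM = 1.
  rewrite mcoeffB mcoeff1 eqxx raddf_sum big1 ?subr0 //= => j _.
  by rewrite [LHS]rmorphM /= dstar_seq_aug ?mul0r // mem_nth.
by rewrite oner_eq0 => /(_ isT)[i [j []]]; rewrite mnm0E.
Qed.

End DoubleStarDepth.

(** * The bounds, and their tightness *)

(** One side X has at most half of the vertices.  The depths are bounded by the smaller
    side, the projective dimension and the complexity by the larger one. *)
Lemma bipartite_bounds (K : realType) (k : fieldType) (n : nat) (G : sgraph n) :
  (0 < n)%N -> bipartite G -> no_isolated G ->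
  [/\ (depthS K k G <= (n./2%:R)%:E)%E,
      (depthE K k G <= (n./2%:R - 1)%:E)%E,
      ((uphalf n)%:R%:E <= pdS K k G)%E &
      (((uphalf n)%:R + 1)%:E <= cxE K k G)%E].
Proof.
move=> n_gt0 [c bip] no_iso; pose B := [set i | c i].
have edgeC (X : {set 'I_n}) : (forall i j, G i j -> (i \in X) != (j \in X)) ->
    forall i j, G i j -> (i \in ~: X) != (j \in ~: X).
  by move=> HX i j /HX; rewrite !inE; case: (i \in X); case: (j \in X).
have edgeB i j : G i j -> (i \in B) != (j \in B) by move/bip; rewrite !inE.
have [X edgeX leX] : exists2 X : {set 'I_n},
    forall i j, G i j -> (i \in X) != (j \in X) & (#|X| <= #|~: X|)%N.
  have [leB|/ltnW leB] := leqP #|B| #|~: B|; first by exists B.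
  by exists (~: B); [exact: edgeC | rewrite setCK].
have card_pos (Y : {set 'I_n}) : (forall i j, G i j -> (i \in Y) != (j \in Y)) -> (0 < #|Y|)%N.
  move=> edgeY; have [j Gij] := no_iso (Ordinal n_gt0); apply/card_gt0P.
  case iY : (Ordinal n_gt0 \in Y); first by exists (Ordinal n_gt0).
  by exists j; have := edgeY _ _ Gij; rewrite iY; case: (j \in Y).
have edgeX' := edgeC X edgeX.
have cardX : (#|X| + #|~: X| = n)%N by rewrite cardsC card_ord.
have X_half : (#|X| <= n./2)%N by have := odd_double_half n; lia.
have X'_half : (uphalf n <= #|~: X|)%N.
  by rewrite uphalf_half; have := odd_double_half n; lia.
split.
- apply: le_trans (depthS_upper K k edgeX' no_iso) _.
  by rewrite setCK lee_fin ler_nat.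
- apply: le_trans (depthE_upper K k edgeX no_iso (card_pos X edgeX)) _.
  by rewrite lee_fin lerD2r ler_nat.
- by apply: le_trans _ (pd_lower K k edgeX' no_iso); rewrite lee_fin ler_nat.
- apply: le_trans _ (cx_lower K k edgeX' no_iso (card_pos _ edgeX')).
  by rewrite lee_fin lerD2r ler_nat.
Qed.

Theorem theorem4p4 (K : realType) (k : closedFieldType)
    (char0 : [pchar k] =i pred0) :
  (forall (n : nat) (G : sgraph n), (0 < n)%N ->
     bipartite G -> no_isolated G ->
     [/\ (depthS K k G <= (n./2%:R)%:E)%E,
         (depthE K k G <= (n./2%:R - 1)%:E)%E,
         ((uphalf n)%:R%:E <= pdS K k G)%E &
         (((uphalf n)%:R + 1)%:E <= cxE K k G)%E]) /\
  (forall n : nat, (2 <= n)%N -> exists G : sgraph n,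
     [/\ bipartite G, no_isolated G &
     [/\ depthS K k G = (n./2%:R)%:E,
         depthE K k G = (n./2%:R - 1)%:E,
         pdS K k G = (uphalf n)%:R%:E &
         cxE K k G = ((uphalf n)%:R + 1)%:E]]).
Proof.
split=> [n G|[|[|n']] // _]; first exact: bipartite_bounds.
exists (dstar n'); have bip := @dstar_bipartite n'; have iso := @dstar_no_isolated n'.
have [dS dE pd cx] := bipartite_bounds K k (ltn0Sn _) bip iso.
split=> //; split; apply: le_anti; apply/andP; split=> //.
- exact: depthS_dstar.
- exact: depthE_dstar.
- exact: pd_dstar.
- exact: cx_dstar.
Qed.
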